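(* Let $n$ be a positive integer, let $B$ be the unit ball of $\mathbf{C}^n$, let $1\le p<\infty$, $\sigma>-1$, and $\lambda=(n+\sigma+1)/2$. The operator $$\tilde T_\sigma f(z)=c_\sigma\int_B\frac{(1-|w|^2)^\sigma}{|1-\langle z,w\rangle|^{2\lambda}}\,f(w)\,dv(w),\quad z\in B,$$ is bounded from $L^p(B)$ into $L^p(B)$ if and only if $\sigma>1/p-1$. The norm of $\tilde T_\sigma:L^p(B)\rightarrow L^p(B)$ is $$\|\tilde T_\sigma\|_{L^p(B)\rightarrow L^p(B)}=\frac{\Gamma(2\lambda)}{\Gamma^2(\lambda)\Gamma(\sigma+1)}\,\Gamma(1/p)\,\Gamma(\sigma+1-1/p)=\frac{\Gamma(n+\sigma+1)}{\Gamma^2((n+\sigma+1)/2)\,\Gamma(\sigma+1)}\,\Gamma(1/p)\,\Gamma(\sigma+1-1/p)$$ for all $\sigma>1/p-1$.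
   Context: $\langle z,w\rangle=z_1\overline{w}_1+\dots+z_n\overline{w}_n$ is the inner product in $\mathbf{C}^n$, $|z|=\sqrt{\langle z,z\rangle}$, and $B=\{z\in\mathbf{C}^n:|z|<1\}$. $dv$ is the Lebesgue measure on $B$ normalized so that $v(B)=1$. $L^p(B)$ is the Lebesgue space of measurable functions on $B$ with $\|f\|_p^p=\int_B|f(z)|^p\,dv(z)<\infty$. The constant is $c_\sigma=\frac{\Gamma(n+\sigma+1)}{\Gamma(\sigma+1)\Gamma(n+1)}$, chosen so that $c_\sigma(1-|w|^2)^\sigma\,dv(w)$ is a probability measure on $B$. For a linear operator $T:X\to Y$ between normed spaces, $\|T\|_{X\rightarrow Y}=\sup_{\|x\|_X\le1}\|Tx\|_Y$. $\Gamma$ is the Euler gamma function and $\Gamma^2(x)=(\Gamma(x))^2$. *)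

(* Defs.v *)
From HB Require Import structures.
From mathcomp Require Import all_boot all_order all_algebra.
From mathcomp Require Import complex.
From mathcomp Require Import all_classical all_reals all_analysis.

Set Implicit Arguments.
Unset Strict Implicit.
Unset Printing Implicit Defensive.
Import Order.TTheory GRing.Theory Num.Theory.
Import numFieldNormedType.Exports.
Import ComplexField.Normc.

Local Open Scope classical_set_scope.
Local Open Scope ring_scope.

(* R[i] carries the sigma-algebra pulled back from R * R, i.e. its Borel sets. *)
Section complex_measurable.
Context {R : realType}.

Definition pair_of_complex (z : R[i]) : measurableTypeR R * measurableTypeR R :=
  (complex.Re z, complex.Im z).

Definition complex_of_pair (x : measurableTypeR R * measurableTypeR R) : R[i] :=
  (x.1 +i* x.2)%C.

HB.instance Definition _ := isPointed.Build R[i] 0.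

Let sigma_complex := preimage_set_system setT pair_of_complex measurable.

Let sigma_algebra_complex : sigma_algebra setT sigma_complex.
Proof. exact/sigma_algebra_preimage/sigma_algebra_measurable. Qed.

Let sigma_complexC A : sigma_complex A -> sigma_complex (~` A).
Proof. by rewrite -setTD; have [_ + _] := sigma_algebra_complex; exact. Qed.

Definition complex_display : measure_display.
Proof. by constructor. Qed.

HB.instance Definition _ := @isMeasurable.Build complex_display R[i]
  sigma_complex (let: And3 h _ _ := sigma_algebra_complex in h) sigma_complexC
  (let: And3 _ _ h := sigma_algebra_complex in h).

Lemma measurable_pair_of_complex : measurable_fun setT pair_of_complex.
Proof. by move=> _ Y mY; exists Y. Qed.

Lemma measurable_complex_of_pair : measurable_fun setT complex_of_pair.
Proof.
move=> _ _ [Y mY <-]; rewrite !setTI -comp_preimage.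
by rewrite (_ : _ \o _ = id)//; apply/funext => -[].
Qed.

End complex_measurable.

Section sigma_finite_transport.
Context {d1 d2} {T1 : measurableType d1} {T2 : measurableType d2}
  {R : realType}.
Variables (mu : {sigma_finite_measure set T1 -> \bar R}) (f : T1 -> T2)
  (g : T2 -> T1).
Hypotheses (mf : measurable_fun setT f) (mg : measurable_fun setT g)
  (fK : cancel f g).

Let push := pushforward mu f.

Let push_measure : {measure set T2 -> \bar R} :=
  measure_function_pushforward__canonical__measure_function_Measure mu mf.

HB.instance Definition _ := Measure.copy push push_measure.

Let push_sigma_finite : sigma_finite setT push.
Proof.
have [F FT Foo] := sigma_finiteT mu.
exists (fun k => g @^-1` F k); first by rewrite -preimage_bigcup -FT.
move=> k; have [mF Fk] := Foo k; split.
  by rewrite -[X in measurable X]setTI; exact: mg.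
rewrite /push /pushforward -comp_preimage (_ : g \o f = id) //.
by apply/funext => x /=; rewrite fK.
Qed.

HB.instance Definition _ := Measure_isSigmaFinite.Build _ _ _ push
  push_sigma_finite.

Definition transport : {sigma_finite_measure set T2 -> \bar R} := push.

End sigma_finite_transport.

(* The library's canonical sigma-finite structure on a product measure is
   restricted to products of subprobabilities. *)
Section sigma_finite_product.
Context {d1 d2} {T1 : measurableType d1} {T2 : measurableType d2}
  {R : realType}.
Variables (m1 : {sigma_finite_measure set T1 -> \bar R})
  (m2 : {sigma_finite_measure set T2 -> \bar R}).

Let prod := (m1 \x m2)%E.

Let prod_measure : {measure set (T1 * T2)%type -> \bar R} :=
  product_measure1 m1 m2.

HB.instance Definition _ := Measure.copy prod prod_measure.

Let prod_sigma_finite : sigma_finite setT prod.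
Proof.
have /sigma_finiteP[F [TF ndF Foo]] := sigma_finiteT m1.
have /sigma_finiteP[G [TG ndG Goo]] := sigma_finiteT m2.
exists (fun n => F n `*` G n).
  rewrite -setXTT TF TG predeqE => -[x y]; split.
    move=> [/= [n _ Fnx] [k _ Gky]]; exists (maxn n k) => //; split.
    - by move: x Fnx; exact/subsetPset/ndF/leq_maxl.
    - by move: y Gky; exact/subsetPset/ndG/leq_maxr.
  by move=> [n _ []/= ? ?]; split; exists n.
move=> k; have [? ?] := Foo k; have [? ?] := Goo k.
split; first exact: measurableX.
by rewrite /prod product_measure1E// lte_mul_pinfty// ge0_fin_numE.
Qed.

HB.instance Definition _ := Measure_isSigmaFinite.Build _ _ _ prod
  prod_sigma_finite.

Definition sigma_finite_prod :
  {sigma_finite_measure set (T1 * T2)%type -> \bar R} := prod.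

End sigma_finite_product.

Section lebesgue_Cn.
Context {R : realType}.

Lemma complex_of_pairK : cancel (@complex_of_pair R) pair_of_complex.
Proof. by case. Qed.

Definition lebesgue_C : {sigma_finite_measure set R[i] -> \bar R} :=
  transport (sigma_finite_prod lebesgue_measure lebesgue_measure)
    measurable_complex_of_pair measurable_pair_of_complex
    complex_of_pairK.

Definition cons_pair n (x : R[i] * n.-tuple R[i]) : n.+1.-tuple R[i] :=
  [tuple of x.1 :: x.2].

Definition uncons_pair n (z : n.+1.-tuple R[i]) : R[i] * n.-tuple R[i] :=
  (thead z, [tuple of behead z]).

Lemma measurable_cons_pair n : measurable_fun setT (@cons_pair n).
Proof. exact: measurable_cons. Qed.

Lemma measurable_uncons_pair n : measurable_fun setT (@uncons_pair n).
Proof.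
apply: measurable_fun_pair; last exact: measurable_behead.
exact: measurable_tnth.
Qed.

Lemma cons_pairK n : cancel (@cons_pair n) (@uncons_pair n).
Proof. by case=> x t; congr pair; apply/val_inj. Qed.

(* Lebesgue measure on C^n; the point mass on the single element when n = 0. *)
Fixpoint lebesgue_Cn n : {sigma_finite_measure set (n.-tuple R[i]) -> \bar R} :=
  if n is m.+1 then
    transport (sigma_finite_prod lebesgue_C (lebesgue_Cn m))
      (@measurable_cons_pair m) (@measurable_uncons_pair m) (@cons_pairK m)
  else \d_ [tuple].

End lebesgue_Cn.

Section Cn.
Context {R : realType}.
Implicit Type n : nat.

Definition dotC n (z w : n.-tuple R[i]) : R[i] :=
  \sum_(i < n) tnth z i * conjc (tnth w i).

Definition normCn n (z : n.-tuple R[i]) : R :=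
  Num.sqrt (complex.Re (dotC z z)).

Definition unit_ball {n} : set (n.-tuple R[i]) := [set z | normCn z < 1].

Lemma inv_volume_ball_ge0 n : 0 <= (fine (lebesgue_Cn n unit_ball))^-1 :> R.
Proof. by rewrite invr_ge0 fine_ge0. Qed.

(* Lebesgue measure on C^n divided by the volume of the unit ball; only its
   restriction to the ball is used. *)
Definition normalized_volume {n} : {measure set (n.-tuple R[i]) -> \bar R} :=
  mscale (NngNum (inv_volume_ball_ge0 n)) (lebesgue_Cn n).

Definition Lp_norm n (p : R) (f : n.-tuple R[i] -> R[i]) : \bar R :=
  'N[normalized_volume]_p%:E[(fun z => (normc (f z))%:E) \_ unit_ball].

(* L^p(B): only the values of f on the ball matter, and functions are not
   identified up to almost everywhere equality. *)
Definition Lp_ball n (p : R) : set (n.-tuple R[i] -> R[i]) :=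
  [set f | measurable_fun unit_ball f /\ (Lp_norm p f < +oo)%E].

Definition integrableC n (f : n.-tuple R[i] -> R[i]) : Prop :=
  normalized_volume.-integrable unit_ball
    (fun w => (complex.Re (f w))%:E) /\
  normalized_volume.-integrable unit_ball
    (fun w => (complex.Im (f w))%:E).

Definition integralC n (f : n.-tuple R[i] -> R[i]) : R[i] :=
  ((\int[normalized_volume]_(w in unit_ball) complex.Re (f w)) +i*
   (\int[normalized_volume]_(w in unit_ball) complex.Im (f w)))%C.

(* Euler's integral, meaningful for 0 < x. *)
Definition Gamma (x : R) : R :=
  \int[lebesgue_measure]_(t in `]0, +oo[) (t `^ (x - 1) * expR (- t)).

Definition c_sigma n (sigma : R) : R :=
  Gamma (n%:R + sigma + 1) / (Gamma (sigma + 1) * Gamma (n%:R + 1)).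

Definition Tsigma_integrand n (sigma lambda : R) (f : n.-tuple R[i] -> R[i])
    (z w : n.-tuple R[i]) : R[i] :=
  ((1 - normCn w ^+ 2) `^ sigma / normc (1 - dotC z w) `^ (2 * lambda))%:C%C
  * f w.

Definition Tsigma n (sigma lambda : R) (f : n.-tuple R[i] -> R[i])
    (z : n.-tuple R[i]) : R[i] :=
  (c_sigma n sigma)%:C%C * integralC (Tsigma_integrand sigma lambda f z).

(* integralC takes a junk value on non-integrable functions, so convergence of
   the defining integral has to be asserted separately. *)
Definition Tsigma_defined n (sigma lambda : R) (f : n.-tuple R[i] -> R[i]) :=
  forall z, unit_ball z -> integrableC (Tsigma_integrand sigma lambda f z).

Definition bounded_on_Lp n (p : R)
    (T : (n.-tuple R[i] -> R[i]) -> n.-tuple R[i] -> R[i]) : Prop :=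
  (forall f, Lp_ball p f -> Lp_ball p (T f)) /\
  exists M : R, forall f, Lp_ball p f -> (Lp_norm p (T f) <= M%:E * Lp_norm p f)%E.

Definition opnorm_Lp n (p : R)
    (T : (n.-tuple R[i] -> R[i]) -> n.-tuple R[i] -> R[i]) : \bar R :=
  ereal_sup [set Lp_norm p (T f) | f in [set f | Lp_ball p f /\
                                                 (Lp_norm p f <= 1)%E]].

End Cn.

(* Main.v *)
(* Write |1 - <z,w>|^(-2 lambda) as the squared modulus of the binomial series
   sum_k Gamma(lambda+k) / (Gamma(lambda) k!) <z,w>^k.  Its terms are orthogonal
   with respect to (1 - |w|^2)^a dv(w), so the integral of the kernel against this
   weight is a power series in |z|^2 with coefficients proportional to
   Gamma(lambda+k)^2 / (k! Gamma(a+1+n+k)).  When a + b = sigma, log-convexity of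
   Gamma bounds it by Gamma(a+1) Gamma(b) / Gamma(lambda)^2 (1 - |z|^2)^(-b), up
   to normalization, and asymptotics of Gamma show that this is sharp up to a
   bounded error as |z| -> 1.  Schur's test with the weight (1 - |w|^2)^(-1/p)
   turns this into the upper bound for the norm.  The functions (1 - |w|^2)^(-b)
   with b increasing to 1/p give the matching lower bound; at sigma = 1/p - 1 it
   tends to infinity.  For sigma < 1/p - 1 the function (1 - |w|^2)^(-1-sigma) is
   in L^p, but the integral defining its image diverges at z = 0. *)
Require Import Defs.
From mathcomp Require Import all_boot all_order all_algebra.
From mathcomp Require Import complex ring lra.
From mathcomp Require Import all_classical all_reals all_analysis.
From mathcomp Require Import measurable_realfun.
From mathcomp Require cyclic separable cyclotomic.

Set Implicit Arguments.
Unset Strict Implicit.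
Unset Printing Implicit Defensive.
Import Order.TTheory GRing.Theory Num.Theory.
Import numFieldNormedType.Exports.
Local Open Scope classical_set_scope.
Local Open Scope ring_scope.

(** * Integrals of powers, and the Gamma and Beta functions *)

(** Neither polar coordinates in $\mathbf{C}^n$ nor unitary invariance is used. The integrals of
    $|\langle z,w\rangle|^{2k}$ are found by induction on $n$, one complex coordinate at a time:
    averaging over roots of unity removes the angle, and the push-forward of area under $|u|^2$ is a
    constant times Lebesgue measure on the half-line, which leaves a Beta integral. Complex powers
    and logarithms are avoided too: the binomial series is a pair of real sums, controlled through
    the differential equation that they satisfy up to their last term. In Schur's test the exponent
    $1/p$ is the one for which the integrals in $w$ and in $z$ carry the same constant, because
    $\Gamma(a+1)\Gamma(b)$ is symmetric in $a+1$ and $b$; so the two bounds combine to the $p$-th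
    power of that constant. In the lower bound the bounded error is a multiple of the function 1 on
    the ball. The test functions have norms tending to infinity as their exponent tends to $1/p$, so
    after normalization Minkowski's inequality makes the error negligible. *)

Section power_integral.
Context {R : realType}.
Local Notation mu := (@lebesgue_measure R).

(** Uniqueness of Lebesgue measure: $|a|$ times the push-forward of [mu] under $x\mapsto ax+b$ gives
    every half-open interval its length. *)
Lemma lebesgue_measure_affine (a b : R) (A : set R) : a != 0 -> measurable A ->
  (mu ((fun x : R => (a * x + b)%R) @^-1` A) = (`|a|^-1)%:E * mu A)%E.
Proof.
move=> a0 mA; pose phi (x : measurableTypeR R) : measurableTypeR R := a * x + b.
have mphi : measurable_fun setT phi.
  by apply: measurable_funD => //; apply: measurable_funM.
pose nu := mscale (NngNum (normr_ge0 a))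
  (measure_function_pushforward__canonical__measure_function_Measure mu mphi).
have E X : measurable X -> mu X = nu X.
  apply: lebesgue_measure_unique => _ [[c d] _ <-] /=.
  rewrite /nu /mscale/= /pushforward.
  rewrite lebesgue_measure_itv/=.
  have [a_gt0|a_le0] := ltP 0 a.
    have -> : phi @^-1` `]c, d] = `](c - b) / a, (d - b) / a]%classic.
      apply/seteqP; split=> x; rewrite /phi/= !in_itv/= ltr_pdivrMr// ler_pdivlMr//;
        by rewrite ltrBlDr lerBrDr mulrC.
    rewrite lebesgue_measure_itv/= !lte_fin ltr_pM2r ?invr_gt0// ltrD2r.
    case: ifPn => _; last by rewrite mule0.
    rewrite gtr0_norm// -!EFinB -EFinM; congr (_%:E); field.
    by rewrite gt_eqF.
  have a_lt0 : a < 0 by rewrite lt_neqAle a0 a_le0.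
  have -> : phi @^-1` `]c, d] = `[(d - b) / a, (c - b) / a[%classic.
    apply/seteqP; split=> x; rewrite /phi/= !in_itv/= ltr_ndivlMr// ler_ndivrMr//;
      by rewrite ltrBlDr lerBrDr mulrC andbC.
  rewrite lebesgue_measure_itv/= !lte_fin ltr_nM2r ?invr_lt0// ltrD2r.
  case: ifPn => _; last by rewrite mule0.
  rewrite ltr0_norm// -!EFinB -EFinM; congr (_%:E); field.
  by rewrite lt_eqF.
rewrite [in RHS]E// /nu /mscale/= muleA -EFinM mulVf ?mul1e//.
by rewrite normr_eq0.
Qed.

Lemma ge0_integral_affine (a b : R) (f : R -> \bar R) : a != 0 ->
  measurable_fun setT f -> (forall x, 0 <= f x)%E ->
  (\int[mu]_x f (a * x + b)%R = (`|a|^-1)%:E * \int[mu]_x f x)%E.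
Proof.
move=> a0 mf f0; pose phi (x : measurableTypeR R) : measurableTypeR R := a * x + b.
have mphi : measurable_fun setT phi.
  by apply: measurable_funD => //; apply: measurable_funM.
have ai : 0 <= `|a|^-1 by rewrite invr_ge0.
transitivity (\int[pushforward mu phi]_x f x)%E.
  by rewrite ge0_integral_pushforward.
rewrite -(ge0_integral_mscale mu measurableT (NngNum ai))//.
apply: eq_measure_integral => A mA _ /=.
by rewrite /mscale/= -(lebesgue_measure_affine b a0 mA).
Qed.

Lemma integral_powR_cc (b e t : R) : 0 < e < t -> b != 0 ->
  (\int[mu]_(x in `[e, t]) (x `^ (b - 1))%:E = ((t `^ b - e `^ b) / b)%:E)%E.
Proof.
move=> /andP[e0 et] b0.
have t0 := lt_trans e0 et.
rewrite (@continuous_FTC2 _ _ (fun x => b^-1 * x `^ b))//.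
- by rewrite -EFinB; congr (_%:E); rewrite -mulrBr mulrC.
- apply: derivable_within_continuous => x; rewrite in_itv/= => /andP[ex _].
  by apply: derivable_powR; rewrite in_itv/= andbT (lt_le_trans e0).
- have d x : 0 < x -> derivable (fun x => b^-1 * x `^ b) x 1.
    move=> x0; apply: derivableM => //.
    by apply: derivable_powR; rewrite in_itv/= andbT.
  have c x : 0 < x -> {for x, continuous (fun x => b^-1 * x `^ b)}.
    by move=> x0; apply: differentiable_continuous; apply/derivable1_diffP; exact: d.
  split.
  + by move=> x; rewrite in_itv/= => /andP[ex _]; apply: d; exact: lt_trans ex.
  + by apply: cvg_at_right_filter; exact: c.
  + by apply: cvg_at_left_filter; exact: c.
- move=> x; rewrite in_itv/= => /andP[ex _].
  have x0 := lt_trans e0 ex.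
  rewrite derive1E deriveM//; last first.
    by apply: derivable_powR; rewrite in_itv/= andbT.
  rewrite derive_cst scaler0 addr0 -derive1E powR_derive1 ?in_itv/= ?andbT//.
  by rewrite /GRing.scale/= mulrA mulVf// mul1r.
Qed.

(** The integrand may be unbounded at 0, so the fundamental theorem of calculus is applied on
    compact intervals that exhaust $(0,t]$. *)
Lemma integral_powR_oo (b t : R) : 0 < b -> 0 < t ->
  (\int[mu]_(x in `]0%R, t[) (x `^ (b - 1))%:E = (t `^ b / b)%:E)%E.
Proof.
move=> b0 t0.
(* The offset 2 keeps the left endpoint strictly below [t], as [integral_powR_cc] requires. *)
pose F (k : nat) := `[t / k.+2%:R, t]%classic : set R.
have UF : \bigcup_k F k = `]0%R, t]%classic.
  apply/seteqP; split=> [x [k _]|x]; rewrite /F/= !in_itv/=.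
    move=> /andP[h1 ->]; rewrite andbT; apply: lt_le_trans h1.
    by rewrite divr_gt0.
  move=> /andP[x0 xt]; have [k hk] : exists k : nat, t / x <= k%:R.
    by exists (Num.bound (t / x)); apply/ltW/archi_boundP; rewrite divr_ge0// ltW.
  exists k => //; rewrite /F/= in_itv/= xt andbT.
  rewrite ler_pdivrMr// mulrC -ler_pdivrMr//.
  by apply: le_trans hk _; rewrite ler_nat; apply: leqW; apply: leqW.
have cv1 : (\int[mu]_(x in F k) (x `^ (b - 1))%:E @[k --> \oo] -->
   \int[mu]_(x in `]0%R, t]) (x `^ (b - 1))%:E)%E.
  rewrite -UF; apply: ge0_nondecreasing_set_cvg_integral.
  - apply/nondecreasing_seqP => k; rewrite subsetEset /F => x/=.
    rewrite !in_itv/= => /andP[h ->]; rewrite andbT; apply: le_trans h.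
    by rewrite ler_pM2l// lef_pV2 ?posrE// ler_nat.
  - by move=> k; exact: measurable_itv.
  - by move=> k; apply/measurable_EFinP; apply: measurable_funTS; exact: measurable_powR.
  - by move=> k x _; rewrite lee_fin powR_ge0.
have cv2 : (\int[mu]_(x in F k) (x `^ (b - 1))%:E @[k --> \oo] --> (t `^ b / b)%:E)%E.
  have E k : (\int[mu]_(x in F k) (x `^ (b - 1))%:E =
      ((t `^ b - (t / k.+2%:R) `^ b) / b)%:E)%E.
    apply: integral_powR_cc; rewrite ?gt_eqF// divr_gt0//=.
    by rewrite ltr_pdivrMr// ltr_pMr// ltr1n.
  under eq_fun do rewrite E.
  apply: cvg_EFin; first by apply: nearW.
  have -> : t `^ b / b = (t `^ b - 0) / b by rewrite subr0.
  apply: cvgM; last exact: cvg_cst.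
  apply: cvgB; first exact: cvg_cst.
  apply: (@cvg_comp _ _ _ (fun k : nat => t / k.+2%:R) (fun x => x `^ b) _ (0^'+));
      last exact: powR_cvg0.
  have cv0 : t / k.+2%:R @[k --> \oo] --> (0 : R).
    have : (fun k : nat => t * harmonic k.+1) @ \oo --> (t * 0 : R).
      apply: cvgM; first exact: cvg_cst.
      by have := @cvg_harmonic R; rewrite -(@cvg_shiftS R).
    by rewrite mulr0.
  move=> P P0; have h : \forall k \near \oo, 0 < t / k.+2%:R -> P (t / k.+2%:R) :=
    cv0 _ P0.
  suff : \forall k \near \oo, P (t / k.+2%:R) by [].
  by apply: filterS h => k; apply; rewrite divr_gt0.
have -> : (\int[mu]_(x in `]0%R, t[) (x `^ (b - 1))%:E =
    \int[mu]_(x in `]0%R, t]) (x `^ (b - 1))%:E)%E.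
  rewrite integral_itv_bndo_bndc//.
  by apply/measurable_EFinP; apply: measurable_funTS; exact: measurable_powR.
exact: (cvg_unique _ cv1 cv2).
Qed.
End power_integral.

Section tonelli_triangle.
Context {R : realType}.
Local Notation mu := (@lebesgue_measure R).
Local Open Scope ereal_scope.

(** A substitute for integration by parts without boundary terms or integrability conditions; with
    [k] a power it yields the recurrences of the Gamma and Beta integrals. *)
Lemma tonelli_triangle (g k : R -> \bar R) :
  measurable_fun setT g -> measurable_fun setT k ->
  (forall x, 0 <= g x) -> (forall x, 0 <= k x) ->
  \int[mu]_(t in `]0%R, +oo[) (g t * \int[mu]_(s in `]0%R, t[) k s) =
  \int[mu]_(s in `]0%R, +oo[) (k s * \int[mu]_(t in `]s, +oo[) g t).
Proof.
move=> mg mk g0 k0.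
pose h (x : measurableTypeR R * measurableTypeR R) : \bar R :=
  if (0 < x.2)%R && (x.2 < x.1)%R then g x.1 * k x.2 else 0.
have mh : measurable_fun setT h.
  apply: measurable_fun_ifT => //.
    by apply: measurable_and; exact: measurable_fun_ltr.
  by apply: emeasurable_funM; exact: measurableT_comp.
have h0 x : 0 <= h x by rewrite /h; case: ifP => // _; exact: mule_ge0.
have := @fubini_tonelli _ _ _ _ _ mu mu h mh h0.
congr (_ = _).
  rewrite [RHS]integral_mkcond; apply: eq_integral => t _.
  rewrite patchE mem_setE in_itv/= andbT; case: ifPn => [t0|t0].
    rewrite -ge0_integralZl//; last exact: measurable_funTS.
    rewrite [RHS]integral_mkcond; apply: eq_integral => s _.
    by rewrite patchE mem_setE in_itv.
  rewrite integral0_eq// => s _; rewrite /h/=; case: ifP => // /andP[s0 st].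
  by rewrite (lt_trans s0 st) in t0.
rewrite [RHS]integral_mkcond; apply: eq_integral => s _.
rewrite patchE mem_setE in_itv/= andbT; case: ifPn => [s0|s0].
  rewrite -ge0_integralZl//; last exact: measurable_funTS.
  rewrite [RHS]integral_mkcond; apply: eq_integral => t _.
  by rewrite patchE mem_setE in_itv/= /h/= s0/= andbT muleC.
by rewrite integral0_eq// => t _; rewrite /h/= (negbTE s0).
Qed.

End tonelli_triangle.

(** Young's inequality with conjugate exponents $1/a$ and $1/b$, applied to $u^a$ and $v^b$. *)
Lemma weighted_young (R : realType) (u v a b : R) : 0 <= u -> 0 <= v ->
  0 < a -> 0 < b -> a + b = 1 -> u `^ a * v `^ b <= a * u + b * v.
Proof.
move=> u0 v0 a0 b0 ab.
have ai : 0 < a^-1 by rewrite invr_gt0.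
have bi : 0 < b^-1 by rewrite invr_gt0.
have abi : a^-1^-1 + b^-1^-1 = 1 by rewrite !invrK.
have := conjugate_powR (powR_ge0 u a) (powR_ge0 v b) ai bi abi.
rewrite -(powRrM u) -(powRrM v) (divff (lt0r_neq0 a0)) (divff (lt0r_neq0 b0)).
by rewrite !powRr1// !invrK (mulrC u) (mulrC v).
Qed.

(** * The Gamma function: recurrence, finiteness, log-convexity *)

Section gamma.
Context {R : realType}.
Local Notation mu := (@lebesgue_measure R).
Implicit Types x y : R.

(** Euler's integral in $[0,\infty]$. [Gamma] is its real part under [fine], which would turn a
    divergent integral into 0, so finiteness has to be settled here. *)
Let gE x : \bar R :=
  (\int[mu]_(t in `]0%R, +oo[) (t `^ (x - 1) * expR (- t))%:E)%E.

Let mexpN : measurable_fun setT (fun t : R => expR (- t)).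
Proof. exact: measurableT_comp. Qed.

Let mpow x : measurable_fun setT (fun t : R => t `^ (x - 1) * expR (- t)).
Proof. by apply: measurable_funM => //; exact: measurable_powR. Qed.

Lemma integral_expRN_oy x :
  (\int[mu]_(t in `]x, +oo[) (expR (- t))%:E = (expR (- x))%:E)%E.
Proof.
rewrite integral_itv_obnd_cbnd; last by apply/measurable_EFinP; exact: measurable_funTS.
have dE (t : R) : is_derive t (1 : R) (fun t : R => - expR (- t)) (expR (- t)).
  apply: is_derive_eq.
  by rewrite mulrN1 opprK.
have cE : continuous (fun t : R => expR (- t)).
  by move=> t; apply: continuous_comp; [exact: continuousN|exact: continuous_expR].
rewrite (@ge0_continuous_FTC2y _ _ (fun t => - expR (- t)) _ 0)//.
- by rewrite -EFinB sub0r opprK.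
- exact: continuous_subspaceT.
- by rewrite -[X in _ --> X]oppr0; apply: cvgN; exact: cvgr_expR.
- by apply: cvg_at_right_filter; apply: cvgN; exact: cE.
- by move=> t _; rewrite derive1E; have [_ ->] := dE t.
Qed.

Let gE_ge0 x : (0 <= gE x)%E.
Proof. by apply: integral_ge0 => t _; rewrite lee_fin mulr_ge0 ?powR_ge0 ?expR_ge0. Qed.

Let gE1 : gE 1 = 1%E.
Proof.
rewrite /gE; under eq_integral do rewrite subrr powRr0 mul1r.
by rewrite integral_expRN_oy oppr0 expR0.
Qed.

(** Tonelli on the triangle $0<s<t$: $t^x/x$ is the integral of $s^{x-1}$ over $(0,t)$, and $e^{-s}$
    that of $e^{-t}$ over $(s,\infty)$. The identity holds in $[0,\infty]$, so it can be used to
    prove finiteness. *)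
Let gES x : 0 < x -> gE (x + 1) = (x%:E * gE x)%E.
Proof.
move=> x0.
have := @tonelli_triangle R (fun t => (expR (- t))%:E) (fun s => (s `^ (x - 1))%:E).
rewrite (_ : (\int[mu]_(t in `]0%R, +oo[) _)%E = (x^-1%:E * gE (x + 1))%E); last first.
  rewrite /gE -ge0_integralZl//=; last 3 first.
  - by apply: measurable_funTS; apply/measurable_EFinP; exact: mpow.
  - by move=> t _; rewrite lee_fin mulr_ge0 ?powR_ge0 ?expR_ge0.
  - by rewrite lee_fin invr_ge0 ltW.
  apply: eq_integral => t; rewrite inE/= in_itv/= andbT => t0.
  rewrite integral_powR_oo// addrK -!EFinM; congr (_%:E); ring.
have -> : (\int[mu]_(s in `]0%R, +oo[) ((s `^ (x - 1))%:E *
    \int[mu]_(t in `]s, +oo[) (expR (- t))%:E))%E = gE x.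
  by apply: eq_integral => s _; rewrite integral_expRN_oy EFinM.
move=> <-.
- by rewrite muleA -EFinM mulfV ?gt_eqF// mul1e.
- exact/measurable_EFinP.
- by apply/measurable_EFinP; exact: measurable_powR.
- by move=> t; rewrite lee_fin expR_ge0.
- by move=> t; rewrite lee_fin powR_ge0.
Qed.

Let gE_nat n : (gE n.+1%:R < +oo)%E.
Proof.
elim: n => [|n ih]; first by rewrite gE1 ltry.
by rewrite -natr1 gES ?ltr0Sn// lte_mul_pinfty ?lee_fin.
Qed.

(** The power $t^{x-1}$ is at most 1 for $t\le1$ and at most an integer power of $t$ for $t>1$, so
    the sum of two values already known to be finite dominates. *)
Let gE_ge1 x : 1 <= x -> (gE x < +oo)%E.
Proof.
move=> x1; pose n := Num.bound x.
have xn : x <= n.+1%:R.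
  by rewrite (le_trans (ltW (archi_boundP _)))// ?ler_nat// (le_trans ler01).
apply: (@le_lt_trans _ _ (gE 1 + gE n.+1%:R)%E); last by rewrite lte_add_pinfty// ?gE1 ?ltry.
rewrite /gE -ge0_integralD//=.
- apply: ge0_le_integral => //=.
  + by move=> t _; rewrite lee_fin mulr_ge0 ?powR_ge0 ?expR_ge0.
  + by apply: measurable_funTS; apply/measurable_EFinP; exact: mpow.
  + by apply: measurable_funTS; apply: emeasurable_funD; apply/measurable_EFinP; exact: mpow.
  + move=> t; rewrite /= in_itv/= andbT => t0; rewrite -EFinD lee_fin -mulrDl.
    rewrite ler_pM2r ?expR_gt0// subrr powRr0.
    have [t1|t1] := leP t 1.
      have : t `^ (x - 1) <= 1.
        by rewrite -[leRHS](powRr0 t); apply: ger_powR; rewrite ?t0 ?subr_ge0.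
      by move/le_trans; apply; rewrite lerDl powR_ge0.
    have : t `^ (x - 1) <= t `^ (n.+1%:R - 1).
      by apply: ler_powR; [exact: ltW|rewrite lerD2r].
    by move/le_trans; apply; rewrite lerDr.
- by move=> t _; rewrite lee_fin mulr_ge0 ?powR_ge0 ?expR_ge0.
- by apply: measurable_funTS; apply/measurable_EFinP; exact: mpow.
- by move=> t _; rewrite lee_fin mulr_ge0 ?powR_ge0 ?expR_ge0.
- by apply: measurable_funTS; apply/measurable_EFinP; exact: mpow.
Qed.

(** The recurrence read backwards: an infinite value at [x] would force one at [x + 1]. *)
Let gE_lty x : 0 < x -> (gE x < +oo)%E.
Proof.
move=> x0; have : (gE (x + 1) < +oo)%E by apply: gE_ge1; rewrite lerDr ltW.
by rewrite gES// => h; rewrite ltey; apply/eqP => gy; move: h; rewrite gy gt0_muley// lte_fin.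
Qed.

Let Gamma_EFin x : 0 < x -> (Gamma x)%:E = gE x.
Proof.
move=> x0; rewrite /Gamma /Rintegral fineK// ge0_fin_numE; first exact: gE_lty.
exact: gE_ge0.
Qed.

Lemma Gamma1 : Gamma 1 = 1 :> R.
Proof. by apply/EFin_inj; rewrite Gamma_EFin. Qed.

Lemma GammaS x : 0 < x -> Gamma (x + 1) = x * Gamma x.
Proof.
move=> x0; apply/EFin_inj.
by rewrite EFinM !Gamma_EFin ?gES// addr_gt0.
Qed.

Let gE_ge1_gt0 x : 1 <= x -> (0 < gE x)%E.
Proof.
move=> x1; apply: (@lt_le_trans _ _ (\int[mu]_(t in `]1%R, +oo[) (expR (- t))%:E)%E).
  by rewrite integral_expRN_oy lte_fin expR_gt0.
apply: (@le_trans _ _ (\int[mu]_(t in `]1%R, +oo[) (t `^ (x - 1) * expR (- t))%:E)%E).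
  apply: ge0_le_integral => //=.
  - by apply: measurable_funTS; exact/measurable_EFinP.
  - by apply: measurable_funTS; apply/measurable_EFinP; exact: mpow.
  - move=> t; rewrite in_itv/= andbT => t1; rewrite lee_fin ler_pMl ?expR_gt0//.
    by rewrite -[leLHS](powRr0 t); apply: ler_powR; [exact: ltW|rewrite subr_ge0].
apply: ge0_subset_integral => //=.
- by apply: measurable_funTS; apply/measurable_EFinP; exact: mpow.
- by move=> t _; rewrite lee_fin mulr_ge0 ?powR_ge0 ?expR_ge0.
- by apply: subset_itvr; rewrite bnd_simp.
Qed.

Lemma Gamma_gt0 x : 0 < x -> 0 < Gamma x.
Proof.
move=> x0; have : 0 < Gamma (x + 1).
  by rewrite -lte_fin Gamma_EFin ?addr_gt0// gE_ge1_gt0// lerDr ltW.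
by rewrite GammaS// pmulr_rgt0.
Qed.

(** Hölder's inequality done pointwise: both integrands are divided by their integrals, Young's
    inequality is applied at each [t], and integration leaves $a+b=1$. *)
Lemma Gamma_log_convex x y (a b : R) : 0 < x -> 0 < y -> 0 < a -> 0 < b ->
  a + b = 1 -> Gamma (a * x + b * y) <= Gamma x `^ a * Gamma y `^ b.
Proof.
move=> x0 y0 a0 b0 ab.
have Gx := Gamma_gt0 x0; have Gy := Gamma_gt0 y0.
pose c := Gamma x `^ a * Gamma y `^ b.
have c0 : 0 < c by rewrite mulr_gt0 ?powR_gt0.
have ax0 : 0 < a * x + b * y by rewrite addr_gt0// mulr_gt0.
suff : (gE (a * x + b * y)%R <= c%:E * ((a / Gamma x)%:E * gE x + (b / Gamma y)%:E * gE y))%E.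
  rewrite -(Gamma_EFin ax0) -(Gamma_EFin x0) -(Gamma_EFin y0).
  rewrite -(EFinM (a / Gamma x)) -(EFinM (b / Gamma y)) -EFinD -EFinM lee_fin => /le_trans; apply.
  by rewrite !divfK ?gt_eqF// ab mulr1.
have pa : 0 <= a / Gamma x by rewrite divr_ge0 ?ltW.
have pb : 0 <= b / Gamma y by rewrite divr_ge0 ?ltW.
have pos (z t : R) : (0 <= (t `^ (z - 1) * expR (- t))%:E)%E.
  by rewrite lee_fin mulr_ge0 ?powR_ge0 ?expR_ge0.
have mE (z : R) : measurable_fun (`]0, +oo[%classic : set R) (fun t : R => (t `^ (z - 1) * expR (- t))%:E).
  by apply: measurable_funTS; apply/measurable_EFinP; exact: mpow.
have mZ (k z : R) : measurable_fun (`]0, +oo[%classic : set R)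
    (fun t : R => k%:E * (t `^ (z - 1) * expR (- t))%:E)%E.
  by apply: emeasurable_funM => //; exact: mE.
have Zge0 (k z t : R) : 0 <= k -> (0 <= k%:E * (t `^ (z - 1) * expR (- t))%:E)%E.
  by move=> k0; apply: mule_ge0; [rewrite lee_fin|exact: pos].
have mD : measurable_fun (`]0, +oo[%classic : set R) (fun t : R =>
    (a / Gamma x)%:E * (t `^ (x - 1) * expR (- t))%:E +
    (b / Gamma y)%:E * (t `^ (y - 1) * expR (- t))%:E)%E.
  by apply: emeasurable_funD; exact: mZ.
rewrite /gE -ge0_integralZl//; last exact: mE.
rewrite -ge0_integralZl//; last exact: mE.
rewrite -ge0_integralD//; last 4 first.
- by move=> t _; exact: Zge0.
- exact: mZ.
- by move=> t _; exact: Zge0.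
- exact: mZ.
rewrite -ge0_integralZl//; last 2 first.
- by move=> t _; apply: adde_ge0; exact: Zge0.
- by rewrite lee_fin ltW.
apply: ge0_le_integral => //.
- exact: mE.
- exact: emeasurable_funM.
move=> t; rewrite /= in_itv/= andbT => t0.
rewrite -!EFinM lee_fin.
have u0 : 0 <= t `^ (x - 1) * expR (- t) / Gamma x.
  by rewrite divr_ge0 ?mulr_ge0 ?powR_ge0 ?expR_ge0 ?ltW.
have v0 : 0 <= t `^ (y - 1) * expR (- t) / Gamma y.
  by rewrite divr_ge0 ?mulr_ge0 ?powR_ge0 ?expR_ge0 ?ltW.
set u := (X in 0 <= X) in u0; set v := (X in 0 <= X) in v0.
have h := weighted_young u0 v0 a0 b0 ab.
have -> : a / Gamma x * (t `^ (x - 1) * expR (- t)) + b / Gamma y * (t `^ (y - 1) * expR (- t)) = a * u + b * v.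
  by rewrite /u /v; ring.
have -> : t `^ (a * x + b * y - 1) * expR (- t) = c * (u `^ a * v `^ b).
  have P (X e g d : R) : 0 <= X -> 0 <= e -> 0 < g ->
      (X * e / g) `^ d = X `^ d * e `^ d / g `^ d.
    move=> X0 e0 g0; rewrite powRM ?mulr_ge0 ?invr_ge0 ?(ltW g0)//.
    rewrite powRM//; congr (_ * _).
    by rewrite -powR_inv1 ?(ltW g0)// -powRrM mulN1r powRN.
  rewrite /u /v P ?powR_ge0 ?expR_ge0// P ?powR_ge0 ?expR_ge0//.
  rewrite -(powRrM t (x - 1)) -(powRrM t (y - 1)) -expRM -expRM.
  have -> : a * x + b * y - 1 = (x - 1) * a + (y - 1) * b.
    by rewrite -[1 in LHS]ab; ring.
  rewrite powRD; last by rewrite (gt_eqF t0) implybT.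
  have -> : expR (- t) = expR (- t * a) * expR (- t * b).
    by rewrite -expRD -mulrDr ab mulr1.
  have ca0 : Gamma x `^ a != 0 by rewrite gt_eqF// powR_gt0.
  have cb0 : Gamma y `^ b != 0 by rewrite gt_eqF// powR_gt0.
  rewrite /c; move: ca0 cb0.
  move: (Gamma x `^ a) (Gamma y `^ b) (t `^ _) (t `^ _) (expR _) (expR _) => *.
  by field; apply/andP.
by rewrite ler_pM2l.
Qed.

End gamma.

(* Keeps [rewrite] from unfolding the integral when it looks for products. *)
#[local] Opaque Gamma.

(** * Beta integrals *)

Section beta.
Context {R : realType}.
Local Notation mu := (@lebesgue_measure R).
Implicit Types (b s t u : R) (j : nat).

(* The cut-off at 0 lets integrals over balls be written over the whole space. *)
Definition ppow b t : R := if 0 < t then t `^ b else 0.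

Lemma ppow_ge0 b t : 0 <= ppow b t.
Proof. by rewrite /ppow; case: ifP => // _; exact: powR_ge0. Qed.

Lemma measurable_ppow b : measurable_fun setT (ppow b).
Proof.
apply: measurable_fun_ifT => //.
exact: measurable_fun_ltr.
Qed.

Lemma integral_ppow_tail b s u : -1 < b ->
  (\int[mu]_(t in `]u, +oo[) (ppow b (s - t))%:E = (ppow (b + 1) (s - u) / (b + 1))%:E)%E.
Proof.
move=> b1; have b10 : 0 < b + 1 by rewrite -ltrBlDr sub0r.
pose h (y : R) : \bar R := if y < s - u then (ppow b y)%:E else 0%E.
have mh : measurable_fun setT h.
  apply: measurable_fun_ifT => //; first exact: measurable_fun_ltr.
  by apply/measurable_EFinP; exact: measurable_ppow.
have h0 y : (0 <= h y)%E by rewrite /h; case: ifP => // _; rewrite lee_fin ppow_ge0.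
have N1 : -1 != 0 :> R by rewrite oppr_eq0 oner_eq0.
have := ge0_integral_affine s N1 mh h0.
rewrite normrN1 invr1 mul1e => E.
transitivity (\int[mu]_x h (-1 * x + s)%R)%E.
  rewrite integral_mkcond; apply: eq_integral => t _.
  rewrite patchE mem_setE in_itv/= andbT /h mulN1r (addrC (- t) s) ltrD2l ltrN2.
  by case: ifP => //; rewrite -leNgt.
rewrite E.
transitivity (\int[mu]_(y in `]0%R, (s - u)%R[) (y `^ (b + 1 - 1))%:E)%E.
  rewrite [RHS]integral_mkcond; apply: eq_integral => y _.
  rewrite patchE mem_setE in_itv/= /h /ppow addrK.
  by case: (ltP 0 y) => _ /=; case: ifP.
rewrite /ppow; case: ifPn => su; first by rewrite integral_powR_oo.
by rewrite set_itv_ge ?integral_set0 ?mul0r// bnd_simp -leNgt leNgt.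
Qed.

(** Induction on [j] with [b] free: [tonelli_triangle] lowers the power of [t] by one and raises [b]
    by one. For [s <= 0] both sides vanish, so [s] may be any real number when this is used
    fibrewise. *)
Lemma integral_beta j b s : -1 < b ->
  (\int[mu]_(t in `]0%R, +oo[) (t ^+ j * ppow b (s - t))%:E =
   (j`!%:R * Gamma (b + 1) / Gamma (b + 1 + j%:R + 1) * ppow (b + 1 + j%:R) s)%:E)%E.
Proof.
elim: j b => [|j ih] b b1.
  have b10 : 0 < b + 1 by rewrite -ltrBlDr sub0r.
  under eq_integral do rewrite expr0 mul1r.
  rewrite integral_ppow_tail// subr0 fact0 !addr0 [Gamma (b + 1 + 1)]GammaS//.
  have := Gamma_gt0 b10 => G0.
  by congr (_%:E); field; rewrite !gt_eqF.
have b10 : 0 < b + 1 by rewrite -ltrBlDr sub0r.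
have j0 : 0 < j.+1%:R :> R by [].
have := @tonelli_triangle R (fun t => (ppow b (s - t))%:E)
  (fun u => (u `^ (j.+1%:R - 1))%:E).
have -> : (\int[mu]_(t in `]0%R, +oo[) ((ppow b (s - t))%:E *
    \int[mu]_(u in `]0%R, t[) (u `^ (j.+1%:R - 1))%:E) =
    j.+1%:R^-1%:E * \int[mu]_(t in `]0%R, +oo[) (t ^+ j.+1 * ppow b (s - t))%:E)%E.
  rewrite -ge0_integralZl; last 4 first.
  - exact: measurable_itv.
  - apply: measurable_funTS; apply/measurable_EFinP; apply: measurable_funM => //.
    by apply: (measurableT_comp (measurable_ppow b)); exact: measurable_funB.
  - move=> t; rewrite /= in_itv/= andbT => t0.
    by rewrite lee_fin mulr_ge0 ?exprn_ge0 ?ppow_ge0 ?ltW.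
  - by rewrite lee_fin invr_ge0.
  apply: eq_integral => t; rewrite inE/= in_itv/= andbT => t0.
  rewrite integral_powR_oo// -!EFinM powR_mulrn ?ltW//; congr (_%:E); ring.
have -> : (\int[mu]_(u in `]0%R, +oo[) ((u `^ (j.+1%:R - 1))%:E *
    \int[mu]_(t in `]u, +oo[) (ppow b (s - t))%:E) =
    (b + 1)^-1%:E * \int[mu]_(t in `]0%R, +oo[) (t ^+ j * ppow (b + 1) (s - t))%:E)%E.
  rewrite -ge0_integralZl; last 4 first.
  - exact: measurable_itv.
  - apply: measurable_funTS; apply/measurable_EFinP; apply: measurable_funM => //.
    by apply: (measurableT_comp (measurable_ppow _)); exact: measurable_funB.
  - move=> t; rewrite /= in_itv/= andbT => t0.
    by rewrite lee_fin mulr_ge0 ?exprn_ge0 ?ppow_ge0 ?ltW.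
  - by rewrite lee_fin invr_ge0 ltW.
  apply: eq_integral => t; rewrite inE/= in_itv/= andbT => t0.
  rewrite integral_ppow_tail// -!EFinM -natr1 addrK powR_mulrn ?ltW//; congr (_%:E); ring.
move=> H.
have -> : (\int[mu]_(t in `]0%R, +oo[) (t ^+ j.+1 * ppow b (s - t))%:E =
  j.+1%:R%:E * (j.+1%:R^-1%:E * \int[mu]_(t in `]0%R, +oo[) (t ^+ j.+1 * ppow b (s - t))%:E))%E.
  by rewrite muleA -EFinM mulfV ?mul1e// gt_eqF.
rewrite {}H; last 4 first.
- apply/measurable_EFinP.
  by apply: (measurableT_comp (measurable_ppow _)); exact: measurable_funB.
- by apply/measurable_EFinP; exact: measurable_powR.
- by move=> x; rewrite lee_fin ppow_ge0.
- by move=> x; rewrite lee_fin powR_ge0.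
rewrite ih; last by rewrite (lt_trans b1)// ltrDl.
rewrite -!EFinM; congr (_%:E).
rewrite [Gamma (b + 1 + 1)]GammaS// factS natrM.
have -> : b + 1 + 1 + j%:R = b + 1 + j.+1%:R by rewrite -natr1; ring.
have : 0 < Gamma (b + 1 + j.+1%:R + 1).
  exact: Gamma_gt0 (addr_gt0 (addr_gt0 b10 j0) ltr01).
set G := Gamma (_ + _ + 1) => G0; field.
by rewrite !gt_eqF.
Qed.

End beta.

(** * Integration in the complex plane *)

Section plane.
Context {R : realType}.
Local Notation mu := (@lebesgue_measure R).
Local Notation MR := (measurableTypeR R).
Implicit Types G : MR * MR -> \bar R.

Lemma measurable_Rshear (p q r s : R) :
  measurable_fun setT (fun z : MR * MR => (p * z.1 + q * z.2, r * z.1 + s * z.2) : MR * MR).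
Proof.
have h (a b : R) : measurable_fun setT (fun z : MR * MR => a * z.1 + b * z.2 : MR).
  by apply: measurable_funD; apply: measurable_funM.
by apply: measurable_fun_pair; exact: h.
Qed.

Let measurable_lin G (p q r s : R) : measurable_fun setT G ->
  measurable_fun setT (fun z : MR * MR => G (p * z.1 + q * z.2, r * z.1 + s * z.2)).
Proof. by move=> mG; exact: (measurableT_comp mG (measurable_Rshear _ _ _ _)). Qed.

Local Notation II G := (\int[mu]_x \int[mu]_y G (x, y))%E.

Lemma integral2_linear1 (a b : R) G : a != 0 -> measurable_fun setT G ->
  (forall z, 0 <= G z)%E ->
  (II (fun z => G (a * z.1 + b * z.2, z.2)%R) = `|a|^-1%:E * II G)%E.
Proof.
move=> a0 mG G0.
have mL : measurable_fun setT (fun z : MR * MR => G (a * z.1 + b * z.2, z.2)%R).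
  have := measurable_lin a b 0 1 mG; congr measurable_fun.
  by apply/funext => z; rewrite mul0r add0r mul1r.
rewrite (fubini_tonelli _ mL)//= (fubini_tonelli _ mG)//.
rewrite -ge0_integralZl//.
- apply: eq_integral => y _.
  have := @ge0_integral_affine _ a (b * y) (fun x => G (x, y)) a0.
  by apply => //; exact: measurable_fun_pair1.
- exact: (measurable_fun_fubini_tonelli_G _ mG).
- by move=> y _; exact: integral_ge0.
Qed.

Lemma integral2_linear2 (a b : R) G : a != 0 -> measurable_fun setT G ->
  (forall z, 0 <= G z)%E ->
  (II (fun z => G (z.1, b * z.1 + a * z.2)%R) = `|a|^-1%:E * II G)%E.
Proof.
move=> a0 mG G0; rewrite -ge0_integralZl//.
- apply: eq_integral => x _ /=.
  have := @ge0_integral_affine _ a (b * x) (fun y => G (x, y)) a0.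
  under eq_integral do rewrite addrC.
  by apply => //; exact: measurable_fun_pair2.
- exact: (measurable_fun_fubini_tonelli_F _ mG).
- by move=> y _; exact: integral_ge0.
Qed.

(* A rotation by an angle that is not a multiple of pi is a product of three
   shears. *)
Lemma integral2_rotation (a b : R) G : a ^+ 2 + b ^+ 2 = 1 -> measurable_fun setT G ->
  (forall z, 0 <= G z)%E ->
  (II (fun z => G (a * z.1 - b * z.2, a * z.2 + b * z.1)%R) = II G)%E.
Proof.
move=> ab mG G0; have [b0|b0] := eqVneq b 0.
  have a1 : `|a| = 1.
    by apply/eqP; rewrite -sqrp_eq1// real_normK ?num_real// -ab b0 expr0n addr0.
  have a0 : a != 0 by rewrite -normr_eq0 a1 oner_eq0.
  have mL : measurable_fun setT (fun z : MR * MR => G (z.1, 0 * z.1 + a * z.2)%R).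
    have := measurable_lin 1 0 0 a mG; congr measurable_fun.
    by apply/funext => z; rewrite mul0r mul1r addr0.
  have := integral2_linear1 0 a0 mL (fun z => G0 _).
  rewrite integral2_linear2// a1 invr1 !mul1e => <-.
  apply: eq_integral => x _; apply: eq_integral => y _ /=.
  by congr (G (_, _)); rewrite b0; ring.
(* With $a=\cos\theta$ and $b=\sin\theta$ this is $-\tan(\theta/2)$: the rotation is a horizontal
   shear by [p], a vertical one by [b], and the horizontal one again. *)
pose p := (a - 1) / b.
have pE : p * (a + 1) = - b.
  apply: (mulIf b0); rewrite /p.
  have -> : (a - 1) / b * (a + 1) * b = (a ^+ 2 - 1) * (b / b) by field.
  have -> : a ^+ 2 = 1 - b ^+ 2 by rewrite -ab addrK.
  by rewrite divff// mulr1; ring.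
have pb : 1 + p * b = a by rewrite /p divfK//; ring.
have o0 : 1 != 0 :> R by exact: oner_neq0.
pose G1 : MR * MR -> \bar R := fun z => G (1 * z.1 + p * z.2, z.2)%R.
have mG1 : measurable_fun setT G1.
  have := measurable_lin 1 p 0 1 mG; congr measurable_fun.
  by apply/funext => z; rewrite /G1 mul0r add0r mul1r mul1r.
pose G2 : MR * MR -> \bar R := fun z => G1 (z.1, b * z.1 + 1 * z.2)%R.
have mG2 : measurable_fun setT G2.
  have := measurable_lin 1 0 b 1 mG1; congr measurable_fun.
  by apply/funext => z; rewrite /G2 mul0r addr0 !mul1r.
transitivity (II (fun z => G2 (1 * z.1 + p * z.2, z.2)%R)).
  apply: eq_integral => x _; apply: eq_integral => y _ /=.
  rewrite /G2 /G1 /= !mul1r; congr (G (_, _)).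
    have -> : x + p * y + p * (b * (x + p * y) + y) =
        (1 + p * b) * x + p * (1 + p * b + 1) * y by ring.
    by rewrite pb pE mulNr.
  by rewrite -pb; ring.
have n1 (x : \bar R) : (`|1 : R|^-1%:E * x = x)%E by rewrite normr1 invr1 mul1e.
have := integral2_linear1 p o0 mG2 (fun z => G0 _); rewrite n1 => ->.
have := integral2_linear2 b o0 mG1 (fun z => G0 _); rewrite n1 => ->.
by have := integral2_linear1 p o0 mG G0; rewrite n1 => ->.
Qed.

End plane.

Section complex_plane.
Context {R : realType}.
Local Notation mu := (@lebesgue_measure R).
Local Notation MR := (measurableTypeR R).
Implicit Types F : R[i] -> \bar R.

Lemma measurable_fun_C d (T : measurableType d) (f : T -> R[i]) :
  measurable_fun setT (fun x => complex.Re (f x)) ->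
  measurable_fun setT (fun x => complex.Im (f x)) ->
  measurable_fun setT f.
Proof.
move=> mRe mIm.
have -> : f = (fun x => complex_of_pair (complex.Re (f x), complex.Im (f x))).
  by apply/funext => x; case: (f x).
apply: (measurableT_comp (@measurable_complex_of_pair R)).
exact: measurable_fun_pair.
Qed.

Lemma measurable_Re : measurable_fun setT (fun z : R[i] => complex.Re z : MR).
Proof.
exact: (measurableT_comp measurable_fst (@measurable_pair_of_complex R)).
Qed.

Lemma measurable_Im : measurable_fun setT (fun z : R[i] => complex.Im z : MR).
Proof.
exact: (measurableT_comp measurable_snd (@measurable_pair_of_complex R)).
Qed.

Lemma ge0_integral_C F : measurable_fun setT F -> (forall z, 0 <= F z)%E ->
  (\int[lebesgue_C]_z F z = \int[mu]_x \int[mu]_y F (complex_of_pair (x, y)))%E.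
Proof.
move=> mF F0.
have mG : measurable_fun setT (F \o (@complex_of_pair R)).
  exact: (measurableT_comp mF (@measurable_complex_of_pair R)).
rewrite -[RHS](@fubini_tonelli1 _ _ _ _ _ mu mu (F \o (@complex_of_pair R)))//;
    last by move=> z; exact: F0.
rewrite [LHS]ge0_integral_pushforward//.
exact: measurable_complex_of_pair.
Qed.

Lemma measurable_mulC (u : R[i]) : measurable_fun setT (fun z : R[i] => u * z).
Proof.
case: u => a b; apply: measurable_fun_C.
- have -> : (fun x : R[i] => complex.Re ((a +i* b)%C * x)) =
    (fun x => a * complex.Re x - b * complex.Im x).
    by apply/funext => -[].
  by apply: measurable_funB; apply: measurable_funM => //;
      [exact: measurable_Re|exact: measurable_Im].
- have -> : (fun x : R[i] => complex.Im ((a +i* b)%C * x)) =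
    (fun x => a * complex.Im x + b * complex.Re x).
    by apply/funext => -[].
  by apply: measurable_funD; apply: measurable_funM => //;
      [exact: measurable_Im|exact: measurable_Re].
Qed.

Lemma integral_C_rotation (u : R[i]) F : ComplexField.Normc.normc u = 1 ->
  measurable_fun setT F -> (forall z, 0 <= F z)%E ->
  (\int[lebesgue_C]_z F (u * z)%R = \int[lebesgue_C]_z F z)%E.
Proof.
case: u => a b u1 mF F0.
rewrite ge0_integral_C//; last exact: (measurableT_comp mF (measurable_mulC _)).
rewrite ge0_integral_C//.
have ab : a ^+ 2 + b ^+ 2 = 1.
  by rewrite -(@sqr_sqrtr _ (_ + _)) ?addr_ge0 ?sqr_ge0// [Num.sqrt _]u1 expr1n.
have mG : measurable_fun setT (F \o (@complex_of_pair R)).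
  exact: (measurableT_comp mF (@measurable_complex_of_pair R)).
exact: (integral2_rotation ab mG (fun z => F0 _)).
Qed.

Lemma integral_C_scale (r : R) F : 0 < r ->
  measurable_fun setT F -> (forall z, 0 <= F z)%E ->
  (\int[lebesgue_C]_z F ((r%:C)%C * z)%R = (r ^- 2)%:E * \int[lebesgue_C]_z F z)%E.
Proof.
move=> r0 mF F0.
rewrite ge0_integral_C//; last exact: (measurableT_comp mF (measurable_mulC _)).
rewrite ge0_integral_C//.
have mG : measurable_fun setT (F \o (@complex_of_pair R)).
  exact: (measurableT_comp mF (@measurable_complex_of_pair R)).
have mL : measurable_fun setT (fun z : MR * MR => (F \o (@complex_of_pair R)) (z.1, 0 * z.1 + r * z.2)%R).
  apply: (measurableT_comp mG); apply: measurable_fun_pair => //.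
  by apply: measurable_funD => //; apply: measurable_funM.
have := integral2_linear1 0 (lt0r_neq0 r0) mL (fun z => F0 _).
rewrite (integral2_linear2 _ (lt0r_neq0 r0) mG (fun z => F0 _)) gtr0_norm// muleA -EFinM -invfM -expr2 => <-.
apply: eq_integral => x _; apply: eq_integral => y _ /=.
rewrite /complex_of_pair/=; congr F; rewrite !mul0r addr0 add0r.
by rewrite /GRing.mul/= !mul0r subr0 addr0.
Qed.

End complex_plane.

(** * Radial integration in the plane *)

Section radial.
Context {R : realType}.
Local Notation mu := (@lebesgue_measure R).
Local Notation MR := (measurableTypeR R).

Definition nsq (z : R[i]) : R := complex.Re z ^+ 2 + complex.Im z ^+ 2.

Lemma nsq_ge0 z : 0 <= nsq z.
Proof. by rewrite addr_ge0 ?sqr_ge0. Qed.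

Lemma measurable_nsq : measurable_fun setT nsq.
Proof.
apply: measurable_funD; apply: measurable_funX; [exact: measurable_Re|exact: measurable_Im].
Qed.

Lemma nsq_real (r : R) (z : R[i]) : nsq ((r%:C)%C * z) = r ^+ 2 * nsq z.
Proof.
by case: z => x y; rewrite /nsq /GRing.mul/= !mul0r subr0 addr0 !exprMn -mulrDr.
Qed.

Definition disc_area : R := fine (lebesgue_C [set z : R[i] | nsq z < 1]).

Lemma measurable_set_lt d (T : measurableType d) (f g : T -> R) :
  measurable_fun setT f -> measurable_fun setT g -> measurable [set x | f x < g x].
Proof.
move=> mf mg; rewrite -[X in measurable X]setTI.
exact: (@measurable_fun_ltr _ _ _ _ _ _ mf mg measurableT [set true]).
Qed.

Lemma measurable_disc (t : R) : measurable [set z : R[i] | nsq z < t].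
Proof. exact: (measurable_set_lt measurable_nsq (measurable_cst t)). Qed.

Lemma lebesgue_C_discE (t : R) :
  (lebesgue_C [set z : R[i] | (nsq z < t)%R] =
   \int[lebesgue_C]_z (if (nsq z < t)%R then 1 else 0))%E.
Proof.
rewrite -[in LHS](setIT [set z | _]) -integral_indic//; last exact: measurable_disc.
apply: eq_integral => z _; rewrite indicE.
by case: ifPn => h; [rewrite mem_set|rewrite memNset//=; exact/negP].
Qed.

Let disc_ltE : (lebesgue_C [set z : R[i] | (nsq z < 1)%R] < +oo)%E.
Proof.
pose I : set MR := `[-1, 1]%classic.
apply: (@le_lt_trans _ _ ((mu \x mu)%E (I `*` I))).
  apply: (@le_measure _ _ _ (mu \x mu)%E).
  - rewrite inE -[X in measurable X]setTI.
    exact: (measurable_complex_of_pair measurableT (measurable_disc 1)).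
  - by rewrite inE; apply: measurableX; exact: measurable_itv.
  move=> -[x y]; rewrite /preimage/= /nsq/= => xy.
  have h (u v : R) : u ^+ 2 + v ^+ 2 < 1 -> -1 <= u <= 1.
    move=> uv; rewrite -ler_norml -(@ler_pXn2r _ 2)// ?nnegrE ?normr_ge0//.
    rewrite real_normK ?num_real// expr1n; apply: ltW; apply: le_lt_trans uv.
    by rewrite lerDl sqr_ge0.
  by split; rewrite /I/= in_itv/=; [exact: h xy|apply: (h y x); rewrite addrC].
rewrite product_measure1E; [|exact: measurable_itv|exact: measurable_itv].
rewrite -[X in (X < _)%E]/(mu I * mu I)%E.
by rewrite /I lebesgue_measure_itv/= lte_fin; case: ifP => _;
    rewrite -?EFinB -?EFinM ?mul0e ltry.
Qed.

Let disc_gtE : (0 < lebesgue_C [set z : R[i] | (nsq z < 1)%R])%E.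
Proof.
pose I : set MR := `[0, 2^-1]%classic.
apply: (@lt_le_trans _ _ ((mu \x mu)%E (I `*` I))).
  rewrite product_measure1E; [|exact: measurable_itv|exact: measurable_itv].
  rewrite -[X in (_ < X)%E]/(mu I * mu I)%E.
  rewrite /I lebesgue_measure_itv/= lte_fin invr_gt0 ltr0n/= -EFinB -EFinM lte_fin.
  by rewrite subr0 mulr_gt0// invr_gt0.
apply: (@le_measure _ _ _ (mu \x mu)%E).
- by rewrite inE; apply: measurableX; exact: measurable_itv.
- rewrite inE -[X in measurable X]setTI.
  exact: (measurable_complex_of_pair measurableT (measurable_disc 1)).
move=> -[x y]; rewrite /I/= !in_itv/= => -[/andP[x0 x1] /andP[y0 y1]].
rewrite /preimage/= /nsq/=.
have h (u : R) : 0 <= u -> u <= 2^-1 -> u ^+ 2 <= 4^-1.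
  move=> u0 u1; have : u ^+ 2 <= 2^-1 ^+ 2 by rewrite lerXn2r// nnegrE// invr_ge0.
  by move/le_trans; apply; lra.
have := h x x0 x1; have := h y y0 y1; lra.
Qed.

Lemma disc_area_gt0 : 0 < disc_area.
Proof. by rewrite fine_gt0// disc_gtE disc_ltE. Qed.

Let disc_areaE : (disc_area%:E = lebesgue_C [set z : R[i] | (nsq z < 1)%R])%E.
Proof. by rewrite /disc_area fineK// ge0_fin_numE. Qed.

(** The dilation by $\sqrt t$ reduces this to the unit disc; for [t <= 0] the disc is empty. *)
Lemma lebesgue_C_disc (t : R) :
  (lebesgue_C [set z : R[i] | (nsq z < t)%R] = (disc_area * Num.max 0 t)%:E)%E.
Proof.
have [t0|t0] := leP t 0.
  rewrite mulr0 (_ : [set z | _] = set0) ?measure0//.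
  apply/seteqP; split => z //=; rewrite ltNge => /negP; apply.
  exact: le_trans (nsq_ge0 z).
pose F s (z : R[i]) : \bar R := if nsq z < s then 1%E else 0%E.
have mF s : measurable_fun setT (F s).
  apply: measurable_fun_ifT => //; apply: measurable_fun_ltr => //.
  exact: measurable_nsq.
have F0 s z : (0 <= F s z)%E by rewrite /F; case: ifP.
have r0 : 0 < Num.sqrt t by rewrite sqrtr_gt0.
have := integral_C_scale r0 (mF t) (F0 t).
rewrite -lebesgue_C_discE sqr_sqrtr ?ltW//.
under eq_integral.
  move=> z _; rewrite /F nsq_real sqr_sqrtr ?(ltW t0)//.
  rewrite -[X in _ < X]mulr1 ltr_pM2l//.
  over.
rewrite -lebesgue_C_discE -disc_areaE => E.
by rewrite EFinM E muleAC -EFinM mulVf ?mul1e// gt_eqF.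
Qed.

Let mD0 : measurable (`]0, +oo[%classic : set MR).
Proof. exact: measurable_itv. Qed.

Let mnsq : measurable_fun setT (nsq : R[i] -> MR).
Proof. exact: measurable_nsq. Qed.

(** Both sides are measures in [A]. By [lebesgue_C_disc] they agree on the open left rays, which are
    stable under intersection, generate the Borel sets, and exhaust the line with finite mass. *)
Let nu_E (A : set MR) : measurable A ->
  pushforward lebesgue_C nsq A = (disc_area%:E * mu (A `&` `]0%R, +oo[))%E.
Proof.
move=> mA.
pose nu : {measure set MR -> \bar R} := measure_function_pushforward__canonical__measure_function_Measure
  (@lebesgue_C R) mnsq.
pose m2 : {measure set MR -> \bar R} := mscale (NngNum (ltW disc_area_gt0)) (mrestr mu mD0).
rewrite -[LHS]/(nu A) -[RHS]/(m2 A).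
pose g (k : nat) : set MR := `]-oo, k%:R[%classic.
apply: (@measure_unique _ R MR (@RGenInftyO.G R) g _ _ _ _ nu m2) => //.
- exact: RGenInftyO.measurableE.
- move=> _ _ [x ->] [y ->]; exists (Num.min x y).
  apply/seteqP; split => z; rewrite /= !in_itv/= lt_min; first by move=> [-> ->].
  by move=> /andP.
- by move=> k; exists (k%:R : R).
- apply/seteqP; split => x //= _; exists (Num.bound `|x|) => //=.
  rewrite /g/= in_itv/=; apply: le_lt_trans (ler_norm x) _.
  exact: archi_boundP.
- move=> _ [x ->].
  rewrite -[LHS]/(lebesgue_C [set z : R[i] | (nsq z < x)%R]) lebesgue_C_disc.
  rewrite EFinM /m2 /mscale/= /mrestr; congr (_ * _)%E.
  rewrite -[RHS]/(mu (`]-oo, x[%classic `&` `]0, +oo[%classic)).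
  have -> : `]-oo, x[%classic `&` `]0, +oo[%classic = `]0, x[%classic :> set MR.
    apply/seteqP; split => z; rewrite /= !in_itv/= andbT; first by move=> [-> ->].
    by move=> /andP[-> ->].
  rewrite lebesgue_measure_itv/= lte_fin; case: ltP => x0 //.
  by rewrite -EFinB subr0.
- move=> k; rewrite -[X in (X < _)%E]/(lebesgue_C [set z : R[i] | (nsq z < k%:R)%R]).
  by rewrite lebesgue_C_disc ltry.
Qed.

(** Polar coordinates in the variable $t=|z|^2$, for which the density is constant. *)
Lemma integral_C_radial (f : R -> \bar R) : measurable_fun setT f ->
  (forall t, 0 <= f t)%E ->
  (\int[lebesgue_C]_z f (nsq z) = disc_area%:E * \int[mu]_(t in `]0%R, +oo[) f t)%E.
Proof.
move=> mf f0.
pose nu : {measure set MR -> \bar R} := measure_function_pushforward__canonical__measure_function_Measure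
  (@lebesgue_C R) mnsq.
transitivity (\int[nu]_t f t)%E.
  by rewrite [RHS]ge0_integral_pushforward//; exact: measurable_nsq.
have D0 : measurable (~` (`]0, +oo[%classic : set MR)) by exact: measurableC.
have N0 : (\int[nu]_(t in ~` `]0%R, +oo[%classic) f t = 0)%E.
  apply: null_set_integral => //; first exact: measurable_funTS.
  by have := nu_E D0; rewrite setICl measure0 mule0.
rewrite -(setUv (`]0%R, +oo[%classic : set MR)) ge0_integral_setU//=; last 2 first.
- by rewrite setUv.
- exact/disj_setPCl.
rewrite N0 adde0.
pose m2 : {measure set MR -> \bar R} := mscale (NngNum (ltW disc_area_gt0)) mu.
have -> : (disc_area%:E * \int[mu]_(t in `]0%R, +oo[) f t =
  \int[m2]_(t in `]0%R, +oo[) f t)%E.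
  by rewrite ge0_integral_mscale//; exact: measurable_funTS.
have H (A : set MR) : measurable A -> A `<=` `]0, +oo[ -> nu A = m2 A.
  move=> mA AD.
  have -> : nu A = (disc_area%:E * mu (A `&` `]0%R, +oo[))%E by exact: nu_E.
  by rewrite (classical_sets.setIidl AD).
exact: (eq_measure_integral m2 H).
Qed.

End radial.

(** * Integration in C^n *)

Section complex_space.
Context {R : realType}.
Local Notation MR := (measurableTypeR R).

Section measurability.
Context d (T : measurableType d).
Implicit Types f g : T -> R[i].

Lemma measurable_Re_comp f : measurable_fun setT f ->
  measurable_fun setT (fun x => complex.Re (f x)).
Proof. by move=> mf; exact: (measurableT_comp measurable_Re mf). Qed.

Lemma measurable_Im_comp f : measurable_fun setT f ->
  measurable_fun setT (fun x => complex.Im (f x)).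
Proof. by move=> mf; exact: (measurableT_comp measurable_Im mf). Qed.

Lemma measurable_addC f g : measurable_fun setT f -> measurable_fun setT g ->
  measurable_fun setT (fun x => f x + g x).
Proof.
move=> mf mg; apply: measurable_fun_C.
- rewrite (_ : (fun x => _) = (fun x => complex.Re (f x) + complex.Re (g x))); last first.
    by apply/funext => x; case: (f x); case: (g x).
  by apply: measurable_funD; exact: measurable_Re_comp.
- rewrite (_ : (fun x => _) = (fun x => complex.Im (f x) + complex.Im (g x))); last first.
    by apply/funext => x; case: (f x); case: (g x).
  by apply: measurable_funD; exact: measurable_Im_comp.
Qed.

Lemma measurable_mulC_fun f g : measurable_fun setT f -> measurable_fun setT g ->
  measurable_fun setT (fun x => f x * g x).
Proof.
move=> mf mg; apply: measurable_fun_C.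
- rewrite (_ : (fun x => _) = (fun x => complex.Re (f x) * complex.Re (g x) -
      complex.Im (f x) * complex.Im (g x))); last first.
    by apply/funext => x; case: (f x); case: (g x).
  apply: measurable_funB; apply: measurable_funM;
    solve [exact: measurable_Re_comp|exact: measurable_Im_comp].
- rewrite (_ : (fun x => _) = (fun x => complex.Re (f x) * complex.Im (g x) +
      complex.Im (f x) * complex.Re (g x))); last first.
    by apply/funext => x; case: (f x); case: (g x).
  apply: measurable_funD; apply: measurable_funM;
    solve [exact: measurable_Re_comp|exact: measurable_Im_comp].
Qed.

Lemma measurable_conj f : measurable_fun setT f ->
  measurable_fun setT (fun x => conjc (f x)).
Proof.
move=> mf; apply: measurable_fun_C.
- rewrite (_ : (fun x => _) = (fun x => complex.Re (f x))).
    exact: measurable_Re_comp.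
  by apply/funext => x; case: (f x).
- rewrite (_ : (fun x => _) = (fun x => - complex.Im (f x))).
    by apply: measurableT_comp => //; exact: measurable_Im_comp.
  by apply/funext => x; case: (f x).
Qed.

Lemma measurable_sumC (I : Type) (s : seq I) (h : I -> T -> R[i]) :
  (forall i, measurable_fun setT (h i)) ->
  measurable_fun setT (fun x => \sum_(i <- s) h i x).
Proof.
move=> mh; elim: s => [|i s ih].
  by under eq_fun do rewrite big_nil; exact: measurable_cst.
by under eq_fun do rewrite big_cons; exact: measurable_addC.
Qed.

Lemma measurable_nsq_comp f : measurable_fun setT f ->
  measurable_fun setT (fun x => nsq (f x)).
Proof. by move=> mf; exact: (measurableT_comp measurable_nsq mf). Qed.

Lemma measurable_dotC n (z w : T -> n.-tuple R[i]) :
  measurable_fun setT z -> measurable_fun setT w ->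
  measurable_fun setT (fun x => dotC (z x) (w x)).
Proof.
move=> mz mw; apply: measurable_sumC => i; apply: measurable_mulC_fun.
  exact: (measurableT_comp (measurable_tnth i) mz).
by apply: measurable_conj; exact: (measurableT_comp (measurable_tnth i) mw).
Qed.

End measurability.

Definition sqn n (z : n.-tuple R[i]) : R := complex.Re (dotC z z).

Lemma mulc_conj (z : R[i]) : z * conjc z = ((nsq z)%:C)%C.
Proof.
case: z => x y; rewrite /nsq /= -!complexr0 /GRing.mul/= mulrN opprK -!expr2.
by congr Complex; rewrite mulrN mulrC addrC subrr.
Qed.

Lemma Re_sum (I : Type) (s : seq I) (f : I -> R[i]) :
  complex.Re (\sum_(i <- s) f i) = \sum_(i <- s) complex.Re (f i).
Proof.
elim: s => [|i s ih]; first by rewrite !big_nil.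
by rewrite !big_cons -ih; case: (f i) => a b; case: (\sum_(_ <- _) _).
Qed.

Lemma sqnE n (z : n.-tuple R[i]) : sqn z = \sum_(i < n) nsq (tnth z i).
Proof. by rewrite /sqn /dotC Re_sum; apply: eq_bigr => i _; rewrite mulc_conj. Qed.

Lemma sqn_ge0 n (z : n.-tuple R[i]) : 0 <= sqn z.
Proof. by rewrite sqnE sumr_ge0// => i _; exact: nsq_ge0. Qed.

Lemma normCn_sqr n (z : n.-tuple R[i]) : normCn z ^+ 2 = sqn z.
Proof. by rewrite sqr_sqrtr// sqn_ge0. Qed.

Lemma normc_sqr (z : R[i]) : ComplexField.Normc.normc z ^+ 2 = nsq z.
Proof. by case: z => x y; rewrite sqr_sqrtr// addr_ge0 ?sqr_ge0. Qed.

Lemma unit_ballE n (z : n.-tuple R[i]) : (unit_ball z) = (sqn z < 1) :> Prop.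
Proof.
rewrite /unit_ball/= -normCn_sqr; congr is_true.
by rewrite -[in RHS](expr1n _ 2) ltr_pXn2r// ?nnegrE ?sqrtr_ge0.
Qed.

Lemma dotC_cons n (a b : R[i]) (z w : n.-tuple R[i]) :
  dotC (cons_pair (a, z)) (cons_pair (b, w)) = a * conjc b + dotC z w.
Proof.
rewrite /dotC big_ord_recl; congr (_ + _).
by apply: eq_bigr => i _; rewrite !tnthS.
Qed.

Lemma sqn_cons n (a : R[i]) (z : n.-tuple R[i]) :
  sqn (cons_pair (a, z)) = nsq a + sqn z.
Proof. by rewrite /sqn dotC_cons mulc_conj; case: (dotC z z). Qed.

Lemma cons_pair_surj n (z : n.+1.-tuple R[i]) :
  z = cons_pair (thead z, [tuple of behead z]).
Proof. exact: tuple_eta. Qed.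

Lemma measurable_sqn n : measurable_fun setT (@sqn n).
Proof. by apply: measurable_Re_comp; apply: measurable_dotC. Qed.

Section integral_CnS.
Variables (n : nat) (F : n.+1.-tuple R[i] -> \bar R).
Hypothesis mF : measurable_fun setT F.
Hypothesis F0 : forall z, (0 <= F z)%E.

Let mG : measurable_fun setT (F \o (@cons_pair R n)).
Proof. exact: (measurableT_comp mF (@measurable_cons_pair R n)). Qed.

Lemma ge0_integral_CnS :
  (\int[lebesgue_Cn n.+1]_z F z =
   \int[lebesgue_C]_u \int[lebesgue_Cn n]_v F (cons_pair (u, v)))%E.
Proof.
rewrite -[RHS](@fubini_tonelli1 _ _ _ _ _ lebesgue_C (lebesgue_Cn n) (F \o (@cons_pair R n)))//;
  last by move=> z; exact: F0.
rewrite [LHS]ge0_integral_pushforward//.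
exact: measurable_cons_pair.
Qed.

Lemma ge0_integral_CnS' :
  (\int[lebesgue_Cn n.+1]_z F z =
   \int[lebesgue_Cn n]_v \int[lebesgue_C]_u F (cons_pair (u, v)))%E.
Proof.
rewrite ge0_integral_CnS; apply: (@fubini_tonelli _ _ _ _ _ lebesgue_C (lebesgue_Cn n) (F \o (@cons_pair R n))) => //.
by move=> z; exact: F0.
Qed.

End integral_CnS.

End complex_space.

(** * Roots of unity and Parseval's identity *)

Section parseval.
Context {R : realType}.
Local Notation normc := ComplexField.Normc.normc.

(** The polynomial $X^n-1$ splits and is separable because $n\ne0$ in [F]; its [n] distinct roots
    then include a primitive one. *)
Lemma closed_prim_root_exists (F : closedFieldType) n : n%:R != 0 :> F ->
  exists z : F, n.-primitive_root z.
Proof.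
move=> nF; have n0 : (0 < n)%N by rewrite lt0n; apply: contraNneq nF => ->.
have [s] := closed_field_poly_normal ('X^n - 1%:P : {poly F}).
rewrite lead_coefXnsubC// scale1r => sE.
have s_uniq : uniq s.
  by rewrite -separable.separable_prod_XsubC -sE polyC1 cyclotomic.separable_Xn_sub_1.
have s_root : all n.-unity_root s.
  by apply/allP => z zs; rewrite /root_of_unity -polyC1 sE root_prod_XsubC.
have s_size : (n <= size s)%N.
  by rewrite -ltnS -(size_XnsubC (1 : F) n0) sE size_prod_XsubC.
by have /hasP[z _ pz] := cyclic.has_prim_root n0 s_root s_uniq s_size; exists z.
Qed.

Lemma normc_unity_root (z : R[i]) n : (n > 0)%N -> z ^+ n = 1 -> normc z = 1.
Proof.
move=> n0 zn1.
have nX k : normc (z ^+ k) = normc z ^+ k.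
  elim: k => [|k ih]; first by rewrite !expr0 ComplexField.Normc.normc1.
  by rewrite !exprS ComplexField.Normc.normcM ih.
have z0 : 0 <= normc z by case: (z) => ? ?; exact: sqrtr_ge0.
apply/eqP; rewrite -(pexpr_eq1 n0 z0).
by rewrite -nX zn1 ComplexField.Normc.normc1.
Qed.

(** Orthogonality of the characters of $\mathbf{Z}/M$: for $j\ne k$ the cross terms sum to a
    geometric sum with ratio $z=w^{j-k}$, and $z\neq1$, $z^M=1$ make it vanish. *)
Lemma parseval M (w : R[i]) (a : nat -> R[i]) : (M > 0)%N -> M.-primitive_root w ->
  \sum_(m < M) nsq (\sum_(k < M) a k * w ^+ (m * k)) = M%:R * \sum_(k < M) nsq (a k).
Proof.
move=> M0 pw; apply: (@complexI R).
have w0 : w != 0 by rewrite (prim_root_eq0 pw) -lt0n.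
have wM : w ^+ M = 1 := prim_expr_order pw.
have wJ : conjc w = w^-1.
  have := normc_unity_root M0 wM => w1.
  apply: (mulfI w0); rewrite mulfV// mulc_conj -normc_sqr w1 expr1n.
  by rewrite rmorph1.
rewrite !rmorphM !rmorph_sum/= mulr_sumr.
under eq_bigr => m _.
  rewrite -mulc_conj rmorph_sum/= big_distrlr/=.
  over.
rewrite exchange_big/=; apply: eq_bigr => j _.
rewrite exchange_big/= (bigD1 j)//= [X in _ + X]big1 ?addr0; last first.
  move=> k kj.
  have zE (m : 'I_M) : a j * w ^+ (m * j) * conjc (a k * w ^+ (m * k)) =
      (a j * conjc (a k)) * (w ^+ j / w ^+ k) ^+ m.
    rewrite rmorphM rmorphXn/= wJ exprVn expr_div_n -!exprM (mulnC j) (mulnC k).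
    by rewrite mulrACA.
  under eq_bigr do rewrite zE.
  rewrite -mulr_sumr; set z := w ^+ j / w ^+ k.
  have z1 : z - 1 != 0.
    rewrite subr_eq0; apply: contra kj => /eqP z1.
    have : w ^+ j = w ^+ k by rewrite -[LHS](divfK (expf_neq0 k w0)) -/z z1 mul1r.
    by move/eqP; rewrite (eq_prim_root_expr pw) !modn_small// eq_sym.
  have : (z - 1) * \sum_(i < M) z ^+ i = 0.
    rewrite -subrX1 /z expr_div_n -!exprM !(mulnC _ M) !exprM wM !expr1n divr1.
    by rewrite subrr.
  by move/eqP; rewrite mulf_eq0 (negbTE z1)/= => /eqP ->; rewrite mulr0.
under eq_bigr => m _.
  rewrite rmorphM rmorphXn/= wJ mulrACA exprVn mulfV ?expf_neq0// mulr1 mulc_conj.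
  over.
by rewrite sumr_const card_ord rmorph_nat mulr_natl.
Qed.

End parseval.

(** * Moments of the inner product over balls *)

Section moments.
Context {R : realType}.
Local Notation normc := ComplexField.Normc.normc.
Local Notation mu := (@lebesgue_measure R).
Implicit Types (u y : R[i]) (s : R) (j k : nat).

Lemma nsqM u y : nsq (u * y) = nsq u * nsq y.
Proof. by rewrite -!normc_sqr ComplexField.Normc.normcM exprMn. Qed.

Lemma nsqX u k : nsq (u ^+ k) = nsq u ^+ k.
Proof.
elim: k => [|k ih]; last by rewrite !exprS nsqM ih.
by rewrite !expr0 -normc_sqr ComplexField.Normc.normc1 expr1n.
Qed.

Lemma nsq_conj u : nsq (conjc u) = nsq u.
Proof. by case: u => a b; rewrite /nsq/= sqrrN. Qed.

Lemma nsq_nat k : nsq (k%:R : R[i]) = k%:R ^+ 2.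
Proof.
have -> : (k%:R : R[i]) = (k%:R%:C)%C by rewrite rmorph_nat.
by rewrite /nsq/= expr0n addr0.
Qed.

(* Finite averages over roots of unity, exact on polynomials by Parseval's
   identity, take the place of integration in the angular variable. *)
Lemma integral_C_average (M : nat) (w : R[i]) (H : R[i] -> \bar R) :
  normc w = 1 -> measurable_fun setT H -> (forall u, 0 <= H u)%E ->
  (\int[lebesgue_C]_u \sum_(m < M) H (w ^+ m * u)%R =
   M%:R%:E * \int[lebesgue_C]_u H u)%E.
Proof.
move=> w1 mH H0; rewrite ge0_integral_sum//; last first.
  by move=> m; exact: (measurableT_comp mH (measurable_mulC _)).
have wm m : normc (w ^+ m) = 1.
  elim: m => [|m ih]; first by rewrite expr0 ComplexField.Normc.normc1.
  by rewrite exprS ComplexField.Normc.normcM w1 ih mulr1.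
under eq_bigr do rewrite integral_C_rotation//.
rewrite big_const_ord; elim: M => [|M ih]; first by rewrite mul0e.
rewrite iterS ih -natr1 addeC EFinD ge0_muleDl ?mul1e// lee_fin.
Qed.

(** The integral is unchanged when [u] is rotated by the powers of a root of unity of order [k + 1],
    and the average over these rotations removes the cross terms of the expanded binomial by
    Parseval's identity. Order [k + 1] is enough to separate the exponents 0 to [k]; the rotation is
    by [conjc w] because [u] enters conjugated. *)
Lemma integral_C_binomial (g : R -> R) (a y : R[i]) k :
  measurable_fun setT g -> (forall t, 0 <= g t) ->
  (\int[lebesgue_C]_u (g (nsq u) * nsq (a * conjc u + y) ^+ k)%:E =
   \int[lebesgue_C]_u (g (nsq u) * \sum_(j < k.+1)
      ('C(k, j)%:R ^+ 2 * nsq y ^+ (k - j) * nsq a ^+ j * nsq u ^+ j))%:E)%E.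
Proof.
move=> mg g0.
have k0' : k.+1%:R != 0 :> R[i] by rewrite pnatr_eq0.
have [w pw] := closed_prim_root_exists k0'.
have w1 : normc (conjc w) = 1.
  have := normc_unity_root (ltn0Sn k) (prim_expr_order pw).
  by case: (w) => p q /=; rewrite sqrrN.
pose H u : \bar R := (g (nsq u) * nsq (a * conjc u + y) ^+ k)%:E.
have mgn : measurable_fun setT (fun u : R[i] => g (nsq u)).
  exact: (measurableT_comp mg measurable_nsq).
have mH : measurable_fun setT H.
  apply/measurable_EFinP; apply: measurable_funM => //.
  apply: measurable_funX; apply: measurable_nsq_comp; apply: measurable_addC => //.
  by apply: measurable_mulC_fun => //; exact: measurable_conj.
have H0 u : (0 <= H u)%E by rewrite lee_fin mulr_ge0 ?exprn_ge0 ?nsq_ge0.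
have k0 : k.+1%:R != 0 :> R by [].
have := integral_C_average k.+1 w1 mH H0.
move=> /(congr1 (fun x => k.+1%:R^-1%:E * x)%E).
rewrite muleA -EFinM mulVf// mul1e => <-.
rewrite -ge0_integralZl//; last 2 first.
- apply: emeasurable_sum => m.
  exact: (measurableT_comp mH (measurable_mulC _)).
- by move=> u _; apply: sume_ge0.
apply: eq_integral => u _.
have nw m : nsq (conjc w ^+ m * u) = nsq u.
  by rewrite nsqM nsqX -normc_sqr w1 !expr1n mul1r.
rewrite /H; under eq_bigr => m _.
  rewrite nw rmorphM rmorphXn/= conjcK -nsqX addrC exprDn.
  over.
rewrite sumEFin -EFinM -mulr_sumr mulrCA; congr (_ * _)%:E.
have := parseval (fun j => y ^+ (k - j) * (a * conjc u) ^+ j *+ 'C(k, j)) (ltn0Sn k) pw.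
move=> /(congr1 (fun x => k.+1%:R^-1 * x)); rewrite mulKf// => E.
transitivity (k.+1%:R^-1 * (\sum_(m < k.+1) nsq
    (\sum_(j < k.+1) y ^+ (k - j) * (a * conjc u) ^+ j *+ 'C(k, j) * w ^+ (m * j)))).
  congr (_ * _); apply: eq_bigr => m _; congr nsq; apply: eq_bigr => j _.
  rewrite mulrnAl; congr (_ *+ _); rewrite -mulrA; congr (_ * _).
  by rewrite (mulrC (w ^+ m)) mulrA exprMn -exprM.
rewrite E; apply: eq_bigr => j _.
by rewrite -mulr_natl !nsqM !nsqX nsqM nsq_conj nsq_nat exprMn !mulrA.
Qed.

Lemma integral_C_beta b s j : -1 < b ->
  (\int[lebesgue_C]_u (nsq u ^+ j * ppow b (s - nsq u))%:E =
   (disc_area * (j`!%:R * Gamma (b + 1) / Gamma (b + 1 + j%:R + 1)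
     * ppow (b + 1 + j%:R) s))%:E)%E.
Proof.
move=> b1; rewrite EFinM -integral_beta//.
(* The absolute value makes the radial function nonnegative on the whole line, as
   [integral_C_radial] demands. *)
transitivity (\int[lebesgue_C]_u (`|nsq u| ^+ j * ppow b (s - nsq u))%:E)%E.
  by apply: eq_integral => u _; rewrite ger0_norm ?nsq_ge0.
rewrite (@integral_C_radial _ (fun t => (`|t| ^+ j * ppow b (s - t))%:E)).
- congr (_ * _)%E; apply: eq_integral => t; rewrite inE/= in_itv/= andbT => t0.
  by rewrite gtr0_norm.
- apply/measurable_EFinP; apply: measurable_funM.
    by apply: measurable_funX; exact: normr_measurable.
  by apply: (measurableT_comp (measurable_ppow b)); exact: measurable_funB.
- by move=> t; rewrite lee_fin mulr_ge0 ?exprn_ge0 ?ppow_ge0.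
Qed.

Lemma measurable_moment n (a s : R) k (z : n.-tuple R[i]) :
  measurable_fun setT (fun w => (ppow a (s - sqn w) * nsq (dotC z w) ^+ k)%:E).
Proof.
apply/measurable_EFinP; apply: measurable_funM => //.
  apply: (measurableT_comp (measurable_ppow a)); apply: measurable_funB => //.
  exact: measurable_sqn.
by apply: measurable_funX; apply: measurable_nsq_comp; exact: measurable_dotC.
Qed.

(** Induction on [n] with [s] and [k] free. Integration over the angle of the first coordinate [u]
    splits the integrand into powers of $|u|^2$; the induction hypothesis with [s - nsq u] and
    [k - j] integrates the other coordinates, a Beta integral remains in [u], and the binomial
    theorem for $(|z_1|^2+|z'|^2)^k$ collects the sum over [j]. *)
Lemma moment n (a s : R) k (z : n.-tuple R[i]) : -1 < a ->
  (\int[lebesgue_Cn n]_w (ppow a (s - sqn w) * nsq (dotC z w) ^+ k)%:E =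
   (disc_area ^+ n * Gamma (a + 1) * k`!%:R / Gamma (a + 1 + n%:R + k%:R)
     * ppow (a + n%:R + k%:R) s * sqn z ^+ k)%:E)%E.
Proof.
move=> a1; have a10 : 0 < a + 1 by rewrite -ltrBlDr sub0r.
elim: n s k z => [|n ih] s k z.
  rewrite [LHS]integral_dirac//; last exact: measurable_moment.
  rewrite diracT mul1e !sqnE !big_ord0 /dotC big_ord0 subr0 expr0 mul1r !addr0.
  have -> : nsq (0 : R[i]) = 0 by rewrite /nsq/= expr0n addr0.
  case: k => [|k]; last by rewrite !expr0n !mulr0.
  have G0 := Gamma_gt0 a10.
  by rewrite !expr0 !mulr1 !addr0 mulfV ?mul1r// gt_eqF.
rewrite (cons_pair_surj z); move: (thead z) [tuple of behead z] => z1 z'.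
have mH : measurable_fun setT (fun x : R[i] * n.-tuple R[i] =>
    (ppow a (s - sqn x.2 - nsq x.1) * \sum_(j < k.+1)
      ('C(k, j)%:R ^+ 2 * nsq (dotC z' x.2) ^+ (k - j) * nsq z1 ^+ j * nsq x.1 ^+ j))%:E).
  have m1 : measurable_fun setT (fun x : R[i] * n.-tuple R[i] => nsq x.1).
    exact: measurable_nsq_comp.
  apply/measurable_EFinP; apply: measurable_funM.
    apply: (measurableT_comp (measurable_ppow a)); apply: measurable_funB => //.
    apply: measurable_funB => //.
    exact: (measurableT_comp (@measurable_sqn R n) measurable_snd).
  apply: measurable_sum => j; apply: measurable_funM; last exact: measurable_funX.
  apply: measurable_funM => //; apply: measurable_funM => //.
  by apply: measurable_funX; apply: measurable_nsq_comp; exact: measurable_dotC.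
have S0 u (v : n.-tuple R[i]) j : 0 <=
    'C(k, j)%:R ^+ 2 * nsq (dotC z' v) ^+ (k - j) * nsq z1 ^+ j * nsq u ^+ j.
  by rewrite !mulr_ge0// ?exprn_ge0 ?nsq_ge0.
have H0 (x : R[i] * n.-tuple R[i]) : (0 <= (ppow a (s - sqn x.2 - nsq x.1) * \sum_(j < k.+1)
      ('C(k, j)%:R ^+ 2 * nsq (dotC z' x.2) ^+ (k - j) * nsq z1 ^+ j * nsq x.1 ^+ j))%:E)%E.
  by rewrite lee_fin mulr_ge0 ?ppow_ge0// sumr_ge0.
rewrite ge0_integral_CnS'; last 2 first.
- exact: measurable_moment.
- by move=> w; rewrite lee_fin mulr_ge0 ?ppow_ge0 ?exprn_ge0 ?nsq_ge0.
transitivity (\int[lebesgue_Cn n]_v \int[lebesgue_C]_u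
    (ppow a (s - sqn v - nsq u) * \sum_(j < k.+1)
      ('C(k, j)%:R ^+ 2 * nsq (dotC z' v) ^+ (k - j) * nsq z1 ^+ j * nsq u ^+ j))%:E)%E.
  apply: eq_integral => v _.
  rewrite -(@integral_C_binomial (fun t => ppow a (s - sqn v - t))).
  - apply: eq_integral => u _; rewrite sqn_cons dotC_cons; congr (ppow _ _ * _)%:E.
    by rewrite opprD addrA addrAC.
  - by apply: (measurableT_comp (measurable_ppow a)); apply: measurable_funB.
  - by move=> t; exact: ppow_ge0.
(* The average over rotations needed the integral over [u] innermost; the induction hypothesis needs
   the one over [v] innermost. *)
apply: etrans (esym (@fubini_tonelli _ _ _ _ _ lebesgue_C (lebesgue_Cn n) _ mH H0)) _.
pose K j := 'C(k, j)%:R ^+ 2 * nsq z1 ^+ j * (disc_area ^+ n * Gamma (a + 1) * (k - j)`!%:R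
     / Gamma (a + 1 + n%:R + (k - j)%:R) * sqn z' ^+ (k - j)).
have K0 j : 0 <= K j.
  have h1 : 0 <= disc_area :> R by exact: ltW disc_area_gt0.
  have h2 : 0 <= Gamma (a + 1) by exact: ltW (Gamma_gt0 a10).
  have h3 : 0 <= Gamma (a + 1 + n%:R + (k - j)%:R).
    by apply/ltW/Gamma_gt0; rewrite -addrA ltr_wpDr.
  rewrite /K mulr_ge0//.
    by rewrite mulr_ge0 ?exprn_ge0 ?nsq_ge0.
  by rewrite mulr_ge0 ?exprn_ge0 ?sqn_ge0// divr_ge0// !mulr_ge0 ?exprn_ge0.
transitivity (\int[lebesgue_C]_u \sum_(j < k.+1) ((K j)%:E * (nsq u ^+ j *
    ppow (a + n%:R + (k - j)%:R) (s - nsq u))%:E))%E.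
  apply: eq_integral => u _ /=.
  under eq_integral do rewrite mulr_sumr -sumEFin.
  have mterm j : measurable_fun setT (fun v : n.-tuple R[i] =>
      (ppow a (s - nsq u - sqn v) * nsq (dotC z' v) ^+ (k - j))%:E).
    exact: measurable_moment.
  have term j v : (ppow a (s - sqn v - nsq u) *
      ('C(k, j)%:R ^+ 2 * nsq (dotC z' v) ^+ (k - j) * nsq z1 ^+ j * nsq u ^+ j))%:E =
      (('C(k, j)%:R ^+ 2 * nsq z1 ^+ j * nsq u ^+ j)%:E *
       (ppow a (s - nsq u - sqn v) * nsq (dotC z' v) ^+ (k - j))%:E)%E.
    by rewrite -EFinM addrAC; congr (_%:E); ring.
  under eq_integral do under eq_bigr do rewrite term.
  have c0 j : (0 <= ('C(k, j)%:R ^+ 2 * nsq z1 ^+ j * nsq u ^+ j)%:E)%E.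
    by rewrite lee_fin !mulr_ge0// ?exprn_ge0 ?nsq_ge0.
  have t0 j v : (0 <= (ppow a (s - nsq u - sqn v) * nsq (dotC z' v) ^+ (k - j))%:E)%E.
    by rewrite lee_fin mulr_ge0 ?ppow_ge0 ?exprn_ge0 ?nsq_ge0.
  rewrite ge0_integral_sum//; last 2 first.
  - by move=> j; apply: emeasurable_funM.
  - by move=> j v _; exact: mule_ge0.
  apply: eq_bigr => j _.
  rewrite ge0_integralZl// ih -!EFinM; congr (_%:E); rewrite /K; ring.
have mt j : measurable_fun setT (fun u : R[i] => (nsq u ^+ j *
    ppow (a + n%:R + (k - j)%:R) (s - nsq u))%:E).
  apply/measurable_EFinP; apply: measurable_funM.
    by apply: measurable_funX; exact: measurable_nsq.
  apply: (measurableT_comp (measurable_ppow _)); apply: measurable_funB => //.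
  exact: measurable_nsq.
have t0 j u : (0 <= (nsq u ^+ j * ppow (a + n%:R + (k - j)%:R) (s - nsq u))%:E)%E.
  by rewrite lee_fin mulr_ge0 ?ppow_ge0 ?exprn_ge0 ?nsq_ge0.
rewrite ge0_integral_sum//; last 2 first.
- by move=> j; apply: emeasurable_funM.
- by move=> j u _; apply: mule_ge0; [rewrite lee_fin|exact: t0].
have b1 j : -1 < a + n%:R + (k - j)%:R.
  by rewrite -addrA (lt_le_trans a1)// lerDl addr_ge0.
under eq_bigr => j _.
  rewrite ge0_integralZl// ?lee_fin// integral_C_beta//  -EFinM.
  over.
rewrite sumEFin; congr (_%:E).
rewrite sqn_cons (addrC (nsq z1)) exprDn mulr_sumr; apply: eq_bigr => -[j jk] _ /=.
have jk' : (j <= k)%N by rewrite -ltnS.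
have -> : a + n.+1%:R + k%:R = a + n%:R + (k - j)%:R + 1 + j%:R.
  rewrite -{1}(subnK jk') natrD -natr1; ring.
have -> : a + 1 + n.+1%:R + k%:R = a + n%:R + (k - j)%:R + 1 + j%:R + 1.
  rewrite -{1}(subnK jk') natrD -natr1; ring.
(* The factorials from the Beta integral and from the induction hypothesis absorb one of the two
   binomial coefficients, leaving $k!$ and the single coefficient of the binomial theorem. *)
have bf : 'C(k, j)%:R * (j`!%:R * (k - j)`!%:R) = k`!%:R :> R.
  by rewrite -!natrM bin_fact.
have G1 : Gamma (a + n%:R + (k - j)%:R + 1) != 0.
  by rewrite gt_eqF// Gamma_gt0// -ltrBlDr sub0r.
have G2 : Gamma (a + n%:R + (k - j)%:R + 1 + j%:R + 1) != 0.
  by rewrite gt_eqF// Gamma_gt0// -addrA ltr_wpDr// -ltrBlDr sub0r.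
rewrite /K -mulr_natr -bf [disc_area ^+ n.+1]exprS.
move: (ppow _ _) (Gamma (a + 1)) (sqn z' ^+ _) (nsq z1 ^+ j) => P Ga S Z.
have -> : a + 1 + n%:R + (k - j)%:R = a + n%:R + (k - j)%:R + 1 by ring.
by field; rewrite G1 G2.
Qed.

End moments.

(** * The binomial series *)

Section binomial_series.
Context {R : realType}.
Variable l : R.
Hypothesis l0 : 0 < l.
Implicit Types (t x y : R) (u v : nat -> R) (k N : nat).

Definition bcoef (k : nat) : R := Gamma (l + k%:R) / (Gamma l * k`!%:R).

Lemma bcoef0 : bcoef 0 = 1.
Proof. by rewrite /bcoef addr0 fact0 mulr1 divff// gt_eqF// Gamma_gt0. Qed.

Lemma bcoef_gt0 k : 0 < bcoef k.
Proof.
by rewrite /bcoef divr_gt0 ?mulr_gt0 ?Gamma_gt0 ?ltr0n ?fact_gt0// ltr_wpDr.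
Qed.

(** The differential equation $(1-t)S'=lS$ of $S=(1-t)^{-l}$, read coefficient by coefficient. *)
Lemma bcoefS k : k.+1%:R * bcoef k.+1 = (l + k%:R) * bcoef k.
Proof.
rewrite /bcoef -natr1 addrA GammaS ?ltr_wpDr// factS natrM natr1.
have G0 : Gamma l != 0 by rewrite gt_eqF// Gamma_gt0.
have f0 : k`!%:R != 0 :> R by rewrite pnatr_eq0 -lt0n fact_gt0.
by field; rewrite G0 f0 addrC natr1 pnatr_eq0.
Qed.

(** The sequence [u] is constantly 1 for the real series; for the complex one it holds the real or
    the imaginary parts of $(x+iy)^k$. *)
Definition bsum u N t := \sum_(k < N) bcoef k * u k * t ^+ k.
Definition dbsum u N t := \sum_(k < N) bcoef k * u k * (k%:R * t ^+ k.-1).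

Lemma is_derive_bsum u N t : is_derive t (1 : R) (bsum u N) (dbsum u N t).
Proof.
elim: N => [|N ih].
  have -> : bsum u 0 = cst 0 by apply/funext => z; rewrite /bsum big_ord0.
  by rewrite /dbsum big_ord0; exact: is_derive_cst.
have -> : bsum u N.+1 = bsum u N + (fun t => bcoef N * u N * t ^+ N).
  by apply/funext => z; rewrite /bsum big_ord_recr.
rewrite /dbsum big_ord_recr/= -/(dbsum u N t).
apply: is_deriveD => //.
have -> : (fun t => bcoef N * u N * t ^+ N) = (bcoef N * u N) *: (id ^+ N : R -> R).
  by apply/funext => z; rewrite /GRing.scale/= fctE.
apply: is_derive_eq.
by rewrite /GRing.scale/= mulr1.
Qed.

Section ode.
Variables (x y : R) (u v : nat -> R).
Hypothesis uS : forall k, u k.+1 = x * u k - y * v k.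
Hypothesis vS : forall k, v k.+1 = x * v k + y * u k.

(** With $\zeta=x+iy$ and $S$ the complex partial sum, this and [bsum_odeIm] are the real and
    imaginary parts of $(1-t\zeta)S'-l\zeta S$. By [bcoefS] the sum telescopes to its last term. *)
Lemma bsum_odeRe N t :
  (1 - t * x) * dbsum u N t + t * y * dbsum v N t - l * (x * bsum u N t - y * bsum v N t) =
  - (N%:R * bcoef N * u N * t ^+ N.-1).
Proof.
elim: N => [|N ih]; first by rewrite /bsum /dbsum !big_ord0; ring.
rewrite bcoefS uS /bsum /dbsum !big_ord_recr/= -!/(bsum _ _ _) -!/(dbsum _ _ _).
(* The truncated predecessor at [N = 0] is harmless because of the factor [N]. *)
have tN : N%:R * t ^+ N = N%:R * t * t ^+ N.-1.
  by case: (N) => [|m]; rewrite ?mul0r// exprS mulrA.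
transitivity (- (N%:R * bcoef N * u N * t ^+ N.-1) + (bcoef N * u N * N%:R * t ^+ N.-1
  - bcoef N * (N%:R * t * t ^+ N.-1) * (x * u N - y * v N)
  - l * bcoef N * t ^+ N * (x * u N - y * v N))); last by rewrite -tN; ring.
by rewrite -ih; ring.
Qed.

Lemma bsum_odeIm N t :
  (1 - t * x) * dbsum v N t - t * y * dbsum u N t - l * (x * bsum v N t + y * bsum u N t) =
  - (N%:R * bcoef N * v N * t ^+ N.-1).
Proof.
elim: N => [|N ih]; first by rewrite /bsum /dbsum !big_ord0; ring.
rewrite bcoefS vS /bsum /dbsum !big_ord_recr/= -!/(bsum _ _ _) -!/(dbsum _ _ _).
have tN : N%:R * t ^+ N = N%:R * t * t ^+ N.-1.
  by case: (N) => [|m]; rewrite ?mul0r// exprS mulrA.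
transitivity (- (N%:R * bcoef N * v N * t ^+ N.-1) + (bcoef N * v N * N%:R * t ^+ N.-1
  - bcoef N * (N%:R * t * t ^+ N.-1) * (x * v N + y * u N)
  - l * bcoef N * t ^+ N * (x * v N + y * u N))); last by rewrite -tN; ring.
by rewrite -ih; ring.
Qed.

End ode.

(* (1 - t)^l times the partial sum is nonincreasing in t. *)
Lemma bsum_le r N : 0 <= r -> r < 1 -> bsum (fun=> 1) N r <= (1 - r) `^ (- l).
Proof.
move=> r0 r1.
case: N => [|N]; first by rewrite /bsum big_ord0 powR_ge0.
pose P := bsum (fun=> 1) N.+1; pose P' := dbsum (fun=> 1) N.+1.
pose h := P * ((fun z => z `^ l) \o (fun t : R => 1 - t)).
have dh t : t < 1 -> is_derive t (1 : R) h (P t * (l * (1 - t) `^ (l - 1) * -1) + (1 - t) `^ l * P' t).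
  move=> t1; have t10 : 0 < 1 - t by rewrite subr_gt0.
  have d1 : is_derive t (1 : R) (fun t : R => 1 - t) (-1).
    by rewrite -[X in is_derive _ _ _ X]add0r; exact: is_deriveB.
  have d2 := @is_derive1_comp R (fun z => z `^ l) (fun t : R => 1 - t) t _ _ (is_derive1_powR l t10) d1.
  have d3 := is_derive_bsum (fun=> 1) N.+1 t.
  exact: (is_deriveM d3 d2).
have hle : h r <= h 0.
  have [->//|r_neq0] := eqVneq r 0.
  have r_gt0 : 0 < r by rewrite lt_neqAle eq_sym r_neq0.
  have [||c] := MVT (f := h) (df := fun t => P t * (l * (1 - t) `^ (l - 1) * -1) + (1 - t) `^ l * P' t) r_gt0.
  - move=> t; rewrite in_itv/= => /andP[t0 tr]; apply: dh; exact: lt_trans tr r1.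
  - apply: derivable_within_continuous => t; rewrite in_itv/= => /andP[t0 tr].
    by have [] := dh t (le_lt_trans tr r1).
  rewrite in_itv/= => /andP[c0 cr] E.
  have c1 : c < 1 := lt_trans cr r1.
  have c10 : 0 < 1 - c by rewrite subr_gt0.
  rewrite -subr_le0 E subr0 pmulr_lle0//.
  have -> : (1 - c) `^ l = (1 - c) `^ (l - 1) * (1 - c).
    by rewrite mulrC mulr_powRB1// ltW.
  (* The derivative is put in the shape of [bsum_odeRe] with $x=1$, $y=0$ and [v] zero, whose value
     is minus the last term, hence nonpositive. *)
  have -> : P c * (l * (1 - c) `^ (l - 1) * -1) + (1 - c) `^ (l - 1) * (1 - c) * P' c =
    (1 - c) `^ (l - 1) * ((1 - c * 1) * P' c + c * 0 * dbsum (fun=> 0) N.+1 c - l * (1 * P c - 0 * bsum (fun=> 0) N.+1 c)) by ring.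
  rewrite (bsum_odeRe (v := fun=> 0)); last by move=> k; ring.
  rewrite mulrN oppr_le0 /= mulr1.
  rewrite mulr_ge0 ?powR_ge0// mulr_ge0 ?exprn_ge0 ?(ltW c0)// mulr_ge0//.
  exact: ltW (bcoef_gt0 _).
have h0 : h 0 = 1.
  rewrite /h !fctE /= subr0 powR1 mulr1 /P /bsum big_ord_recl big1 ?addr0.
    by rewrite bcoef0 expr0 !mulr1.
  by move=> i _; rewrite /= expr0n mulr0.
have r10 : 0 < 1 - r by rewrite subr_gt0.
rewrite powRN -[leRHS]mul1r ler_pdivlMr ?powR_gt0//.
by move: hle; rewrite h0.
Qed.

(** These are the terms of the series $rS'(r)$. The differential equation bounds its partial sums by
    those of $S$, which [bsum_le] bounds, so the series converges and its terms tend to 0. *)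
Lemma dbsum_cvg0 r : 0 <= r -> r < 1 -> N%:R * bcoef N * r ^+ N @[N --> \oo] --> (0 : R).
Proof.
move=> r0 r1; pose w N := N%:R * bcoef N * r ^+ N.
have w0 N : 0 <= w N.
  by rewrite mulr_ge0 ?exprn_ge0// mulr_ge0// ltW// bcoef_gt0.
have r10 : 0 < 1 - r by rewrite subr_gt0.
have wd N : series w N = r * dbsum (fun=> 1) N r.
  rewrite /series/= big_mkord /dbsum mulr_sumr; apply: eq_bigr => -[[|k] kN] _ /=.
    by rewrite /w !mul0r !mulr0.
  by rewrite /w exprS; ring.
apply: cvg_series_cvg_0; apply: nondecreasing_is_cvgn.
  apply/nondecreasing_seqP => n; rewrite /series/= big_nat_recr//= lerDl.
  exact: w0.
exists (l * (1 - r) `^ (- l) / (1 - r)) => _ [N _ <-]; rewrite wd.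
have h := @bsum_odeRe 1 0 (fun=> 1) (fun=> 0) _ N r.
have {h} : (1 - r) * dbsum (fun=> 1) N r <= l * bsum (fun=> 1) N r.
  have E : (1 - r) * dbsum (fun=> 1) N r - l * bsum (fun=> 1) N r =
    - (N%:R * bcoef N * 1 * r ^+ N.-1).
    by rewrite -h; [ring|move=> k; ring].
  rewrite -subr_le0 E oppr_le0 mulr1 mulr_ge0 ?exprn_ge0// mulr_ge0//.
  exact: ltW (bcoef_gt0 _).
move=> h; rewrite ler_pdivlMr//.
have d0 : 0 <= dbsum (fun=> 1) N r.
  apply: sumr_ge0 => k _; rewrite mulr1 mulr_ge0 ?(ltW (bcoef_gt0 _))//.
  by rewrite mulr_ge0// exprn_ge0.
apply: (@le_trans _ _ ((1 - r) * dbsum (fun=> 1) N r)).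
  have -> : r * dbsum (fun=> 1) N r * (1 - r) = (1 - r) * dbsum (fun=> 1) N r * r by ring.
  by apply: ler_piMr; [rewrite mulr_ge0// ltW|exact: ltW].
by apply: le_trans h _; rewrite ler_pM2l// bsum_le.
Qed.

Section limit.
Variables (x y : R) (u v : nat -> R) (r : R).
Hypothesis uS : forall k, u k.+1 = x * u k - y * v k.
Hypothesis vS : forall k, v k.+1 = x * v k + y * u k.
Hypotheses (r0 : 0 <= r) (r1 : r < 1).
Hypothesis xyr : x ^+ 2 + y ^+ 2 <= r ^+ 2.
Hypotheses (ur : forall k, `|u k| <= r ^+ k) (vr : forall k, `|v k| <= r ^+ k).

Let A N t := bsum u N t.
Let B N t := bsum v N t.
Let D t := (1 - t * x) ^+ 2 + (t * y) ^+ 2.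

Lemma bsum_norm_le (w : nat -> R) N t : (forall k, `|w k| <= r ^+ k) ->
  0 <= t <= 1 -> `|bsum w N t| <= (1 - r) `^ (- l).
Proof.
move=> wr /andP[t0 t1]; apply: le_trans (bsum_le N r0 r1).
apply: le_trans (ler_norm_sum _ _ _) _; apply: ler_sum => k _.
rewrite 2!normrM (gtr0_norm (bcoef_gt0 _)) mulr1 -mulrA ler_pM2l ?bcoef_gt0//.
rewrite -[leRHS]mulr1 ler_pM// normrX ger0_norm// exprn_ile1//.
Qed.

Let x_r : `|x| <= r.
Proof.
rewrite -(@ler_pXn2r _ 2)// ?nnegrE// real_normK ?num_real//.
by apply: le_trans xyr; rewrite lerDl sqr_ge0.
Qed.

Let y_r : `|y| <= r.
Proof.
rewrite -(@ler_pXn2r _ 2)// ?nnegrE// real_normK ?num_real//.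
by apply: le_trans xyr; rewrite lerDr sqr_ge0.
Qed.

(** [D t] is $|1-t(x+iy)|^2$, and both $|tx|$ and $|ty|$ are at most $r<1$; the upper bound is
    $2^2+1^2$. *)
Let D_bounds t : 0 <= t <= 1 -> (1 - r) ^+ 2 <= D t <= 5.
Proof.
move=> /andP[t0 t1]; rewrite /D.
have tx : `|t * x| <= r.
  by rewrite normrM ger0_norm// -[leRHS]mul1r ler_pM.
have ty : `|t * y| <= r.
  by rewrite normrM ger0_norm// -[leRHS]mul1r ler_pM.
move: tx ty; rewrite !ler_norml => /andP[tx1 tx2] /andP[ty1 ty2].
have rr1 := r1; have rr0 := r0.
move: (t * x) (t * y) tx1 tx2 ty1 ty2 => p q p1 p2 q1 q2; apply/andP; split.
  apply: (@le_trans _ _ ((1 - p) ^+ 2)); last by rewrite lerDl sqr_ge0.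
  have h1 : 0 <= 1 - r by lra.
  have h2 : 0 <= 1 - p by lra.
  have h3 : 1 - r <= 1 - p by lra.
  by rewrite lerXn2r// nnegrE.
have hp : (1 - p) ^+ 2 <= 2 ^+ 2.
  have h2 : 0 <= 1 - p by lra.
  have h3 : 1 - p <= 2 by lra.
  by rewrite lerXn2r// nnegrE.
have hq : `|q| ^+ 2 <= 1 ^+ 2.
  have h2 : `|q| <= 1 by rewrite ler_norml; lra.
  by rewrite lerXn2r// nnegrE.
by rewrite real_normK ?num_real// in hq; lra.
Qed.

Let D_gt0 t : 0 <= t <= 1 -> 0 < D t.
Proof.
by move=> /D_bounds/andP[+ _]; apply: lt_le_trans; rewrite exprn_gt0// subr_gt0.
Qed.

(* S = A + i B, a partial sum of the binomial series of (1 - t (x + i y))^(-l),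
   satisfies (1 - t (x + i y)) S' = l (x + i y) S up to its last term, so that
   phi = |S|^2 |1 - t (x + i y)|^(2 l) has a small derivative. *)
Let phi N := ((A N * A N + B N * B N) * ((fun z => z `^ l) \o D)) : R -> R.

(** With $\zeta=x+iy$ and $E=Nb_N\zeta^Nt^{N-1}$, where $b_N$ is [bcoef N], this is
    $-2D^{l-1}\mathrm{Re}(\overline{S(1-t\zeta)}\,E)$ in real coordinates, when [u] and [v] are the
    parts of $\zeta^k$. *)
Let dphi N t : R := 2 * D t `^ (l - 1) *
  (- ((A N t * (1 - t * x) + B N t * (t * y)) * (N%:R * bcoef N * u N * t ^+ N.-1)
      - (A N t * (t * y) - B N t * (1 - t * x)) * (N%:R * bcoef N * v N * t ^+ N.-1))).

Let is_derive_phi N t : 0 <= t <= 1 -> is_derive t (1 : R) (phi N) (dphi N t).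
Proof.
move=> t01; have Dt0 := D_gt0 t01.
have dD : is_derive t (1 : R) D (2 * ((1 - t * x) * - x + t * y * y)).
  have -> : D = (cst 1 - id * cst x) * (cst 1 - id * cst x) + (id * cst y) * (id * cst y) :> (R -> R).
    by apply/funext => z; rewrite /D !expr2.
  apply: is_derive_eq; rewrite /GRing.scale !fctE /=. ring.
have d2 := @is_derive1_comp R (fun z => z `^ l) D t _ _ (is_derive1_powR l Dt0) dD.
have dA := is_derive_bsum u N t; have dB := is_derive_bsum v N t.
have d3 := is_deriveM (is_deriveD (is_deriveM dA dA) (is_deriveM dB dB)) d2.
apply: (is_derive_eq d3).
rewrite /GRing.scale/= /dphi /comp /=.
have -> : D t `^ l = D t `^ (l - 1) * D t by rewrite mulrC mulr_powRB1// ltW.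
have := bsum_odeRe uS N t; have := bsum_odeIm vS N t.
rewrite -/(A N t) -/(B N t).
set P := D t `^ (l - 1).
set e1 := N%:R * bcoef N * v N * t ^+ N.-1; set e2 := N%:R * bcoef N * u N * t ^+ N.-1.
move=> h1 h2.
have -> : e1 = - ((1 - t * x) * dbsum v N t - t * y * dbsum u N t -
  l * (x * B N t + y * A N t)) by rewrite h1 opprK.
have -> : e2 = - ((1 - t * x) * dbsum u N t + t * y * dbsum v N t -
  l * (x * A N t - y * B N t)) by rewrite h2 opprK.
rewrite !fctE /A /B; move: P => P; by rewrite /D; ring.
Qed.

Let norm_dphi_le N t : 0 <= t <= 1 -> `|dphi N t| <=
  12 * (((1 - r) ^+ 2) `^ (l - 1) + 5 `^ (l - 1)) * (1 - r) `^ (- l) * (N%:R * bcoef N * r ^+ N).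
Proof.
move=> t01; have /andP[t0 t1] := t01.
have AG := bsum_norm_le N ur t01; have BG := bsum_norm_le N vr t01.
rewrite -/(A N t) -/(B N t) in AG BG.
have tx : `|t * x| <= 1.
  by rewrite normrM (ger0_norm t0) mulr_ile1// (le_trans x_r)// ltW.
have ty : `|t * y| <= 1.
  by rewrite normrM (ger0_norm t0) mulr_ile1// (le_trans y_r)// ltW.
have tx2 : `|1 - t * x| <= 2.
  by apply: le_trans (ler_normB _ _) _; rewrite normr1 -[leRHS]/(1 + 1) lerD2l.
have w0 : 0 <= N%:R * bcoef N * r ^+ N.
  by rewrite mulr_ge0 ?exprn_ge0// mulr_ge0// ltW// bcoef_gt0.
have term (s : nat -> R) : (forall k, `|s k| <= r ^+ k) ->
    `|N%:R * bcoef N * s N * t ^+ N.-1| <= N%:R * bcoef N * r ^+ N.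
  move=> sr; rewrite 3!normrM (gtr0_norm (bcoef_gt0 _)) normr_nat normrX (ger0_norm t0).
  have nb0 : 0 <= N%:R * bcoef N by rewrite mulr_ge0// ltW// bcoef_gt0.
  rewrite -mulrA; apply: ler_wpM2l => //.
  by rewrite -[leRHS]mulr1 ler_pM// ?exprn_ge0// exprn_ile1.
have hu := term u ur; have hv := term v vr.
(* The sign of [l - 1] decides which end of the range of [D] bounds the power; the sum covers both
   cases. *)
have Q : D t `^ (l - 1) <= ((1 - r) ^+ 2) `^ (l - 1) + 5 `^ (l - 1).
  have /andP[D1 D2] := D_bounds t01; have Dt0 := D_gt0 t01.
  have r20 : 0 < (1 - r) ^+ 2 by rewrite exprn_gt0// subr_gt0.
  have [l1|l1] := leP 1 l.
    apply: (@le_trans _ _ (5 `^ (l - 1))); last by rewrite lerDr powR_ge0.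
    by rewrite ge0_ler_powR ?nnegrE ?subr_ge0// ltW.
  apply: (@le_trans _ _ (((1 - r) ^+ 2) `^ (l - 1))); last by rewrite lerDl powR_ge0.
  rewrite -(opprB 1 l) !powRN lef_pV2 ?posrE ?powR_gt0//.
  by rewrite ge0_ler_powR ?nnegrE ?subr_ge0// ltW.
have Q0 : 0 <= D t `^ (l - 1) by exact: powR_ge0.
rewrite /dphi; move: hu hv w0 Q Q0 AG BG tx2 ty.
set eu := N%:R * bcoef N * u N * t ^+ N.-1; set ev := N%:R * bcoef N * v N * t ^+ N.-1.
move: (N%:R * bcoef N * r ^+ N) (D t `^ (l - 1)) (_ + 5 `^ _) ((1 - r) `^ (- l)) (A N t) (B N t) (1 - t * x) (t * y) eu ev.
move=> w P Q G a b p q eu ev hu hv w0 PQ P0 aG bG p2 q1.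
have G0 : 0 <= G := le_trans (normr_ge0 _) aG.
have i1 : `|a * p + b * q| <= 3 * G.
  apply: le_trans (ler_normD _ _) _; rewrite !normrM.
  have -> : 3 * G = G * 2 + G * 1 by ring.
  by apply: lerD; apply: ler_pM.
have i2 : `|a * q - b * p| <= 3 * G.
  apply: le_trans (ler_normB _ _) _; rewrite !normrM.
  have -> : 3 * G = G * 1 + G * 2 by ring.
  by apply: lerD; apply: ler_pM.
rewrite !normrM normrN normr_nat (ger0_norm P0).
have -> : 12 * Q * G * w = 2 * Q * (3 * G * w + 3 * G * w) by ring.
apply: ler_pM; rewrite ?mulr_ge0//; first by rewrite ler_pM2l.
apply: le_trans (ler_normB _ _) _; rewrite !normrM.
by apply: lerD; apply: ler_pM.
Qed.

Hypotheses (u0 : u 0 = 1) (v0 : v 0 = 0).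

(** [phi] is 1 at $t=0$ and its derivative on $[0,1]$ tends uniformly to 0, so by the mean value
    theorem [phi] at 1 tends to 1; dividing by the power of [D 1] gives the limit. *)
Lemma bsum_sqr_cvg : bsum u N 1 ^+ 2 + bsum v N 1 ^+ 2 @[N --> \oo] -->
  ((1 - x) ^+ 2 + y ^+ 2) `^ (- l).
Proof.
have D1 : D 1 = (1 - x) ^+ 2 + y ^+ 2 by rewrite /D !mul1r.
rewrite -D1.
have D10 : 0 < D 1 by apply: D_gt0; rewrite ler01 lexx.
pose K := 12 * (((1 - r) ^+ 2) `^ (l - 1) + 5 `^ (l - 1)) * (1 - r) `^ (- l).
pose w N := N%:R * bcoef N * r ^+ N.
have phi1 : phi N.+1 1 @[N --> \oo] --> (1 : R).
  have le N : `|phi N.+1 1 - 1| <= K * w N.+1.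
    (* The index is [N.+1] because the empty partial sum would give 0 here. *)
    have p0 : phi N.+1 0 = 1.
      rewrite /phi !fctE /= /A /B /bsum !big_ord_recl !big1; last 2 first.
        by move=> i _; rewrite /= expr0n mulr0.
        by move=> i _; rewrite /= expr0n mulr0.
      by rewrite /D bcoef0 u0 v0 expr0 !mul0r subr0 !addr0 !mulr1 ?mulr0 ?addr0 expr1n expr0n addr0 powR1 mulr1.
    have [||c] := MVT (f := phi N.+1) (df := dphi N.+1) (@ltr01 R).
    - move=> t; rewrite in_itv/= => /andP[t0 t1]; apply: is_derive_phi.
      by rewrite !ltW.
    - apply: derivable_within_continuous => t; rewrite in_itv/= => t01.
      by have [] := is_derive_phi N.+1 t01.
    rewrite in_itv/= => /andP[c0 c1]; rewrite p0 subr0 mulr1 => ->.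
    by apply: norm_dphi_le; rewrite !ltW.
  have wK : K * w N.+1 @[N --> \oo] --> (0 : R).
    rewrite -[X in _ --> X](mulr0 K); apply: cvgM; first exact: cvg_cst.
    by have := dbsum_cvg0 r0 r1; rewrite -(@cvg_shiftS R).
  have wKN : - (K * w N.+1) @[N --> \oo] --> (0 : R).
    by rewrite -oppr0; exact: cvgN.
  apply/subr_cvg0; apply: squeeze_cvgr wKN wK.
  by apply: nearW => N; rewrite -ler_norml.
rewrite -(@cvg_shiftS R).
have -> : (fun N => bsum u N.+1 1 ^+ 2 + bsum v N.+1 1 ^+ 2) =
    (fun N => phi N.+1 1 * D 1 `^ (- l)).
  apply/funext => N; rewrite /phi !fctE /= -mulrA -!expr2 powRN mulfV ?mulr1//.
  by rewrite gt_eqF// powR_gt0.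
have c2 : (fun=> D 1 `^ (- l)) @ \oo --> D 1 `^ (- l) by exact: cvg_cst.
by have := cvgM phi1 c2; rewrite mul1r; apply.
Qed.

End limit.

End binomial_series.

(** * Expansion of the kernel *)

Section kernel_expansion.
Context {R : realType}.
Local Notation normc := ComplexField.Normc.normc.
Implicit Types (n N k : nat).

Definition scale_Cn n (u : R[i]) (w : n.-tuple R[i]) : n.-tuple R[i] :=
  [tuple u * tnth w i | i < n].

Lemma measurable_scale_Cn n (u : R[i]) : measurable_fun setT (@scale_Cn n u).
Proof.
apply/measurable_fun_tnthP => i.
rewrite (_ : _ \o _ = fun w => u * tnth w i); last first.
  by apply/funext => w; rewrite /= tnth_mktuple.
exact: (measurableT_comp (measurable_mulC u) (measurable_tnth i)).
Qed.

Lemma scale_Cn_cons n (u a : R[i]) (v : n.-tuple R[i]) :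
  scale_Cn u (cons_pair (a, v)) = cons_pair (u * a, scale_Cn u v).
Proof.
apply: eq_from_tnth => i; rewrite tnth_mktuple.
case: (unliftP ord0 i) => [j ->|->]; last by [].
by rewrite !tnthS tnth_mktuple.
Qed.

Lemma dotC_scale n (u : R[i]) (z w : n.-tuple R[i]) :
  dotC z (scale_Cn u w) = conjc u * dotC z w.
Proof.
rewrite /dotC mulr_sumr; apply: eq_bigr => i _.
by rewrite tnth_mktuple rmorphM mulrCA.
Qed.

Lemma sqn_scale n (u : R[i]) (w : n.-tuple R[i]) :
  sqn (scale_Cn u w) = nsq u * sqn w.
Proof.
rewrite !sqnE mulr_sumr; apply: eq_bigr => i _.
by rewrite tnth_mktuple nsqM.
Qed.

Lemma integral_Cn_rotation n (u : R[i]) (F : n.-tuple R[i] -> \bar R) :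
  normc u = 1 -> measurable_fun setT F -> (forall w, 0 <= F w)%E ->
  (\int[lebesgue_Cn n]_w F (scale_Cn u w) = \int[lebesgue_Cn n]_w F w)%E.
Proof.
move=> u1; elim: n F => [|n ih] F mF F0.
  by apply: eq_integral => w _; congr F; rewrite [LHS]tuple0 [RHS]tuple0.
have mFs : measurable_fun setT (F \o scale_Cn u).
  exact: (measurableT_comp mF (measurable_scale_Cn u)).
rewrite (ge0_integral_CnS mFs)//; last by move=> w; exact: F0.
rewrite ge0_integral_CnS//.
have mG : measurable_fun setT (F \o (@cons_pair R n)).
  exact: (measurableT_comp mF (@measurable_cons_pair R n)).
rewrite -[RHS](@integral_C_rotation _ u)//; last 2 first.
- exact: (@measurable_fun_fubini_tonelli_F _ _ _ _ _ (lebesgue_Cn n) _ mG (fun z => F0 _)).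
- by move=> z; apply: integral_ge0.
apply: eq_integral => a _.
rewrite -(ih (fun v => F (cons_pair (u * a, v))))//; last first.
  exact: (measurable_fun_pair2 (u * a) mG).
by apply: eq_integral => v _; rewrite /= scale_Cn_cons.
Qed.

Section series.
Variable l : R.
Hypothesis l0 : 0 < l.

Definition bpoly N (y : R[i]) : R[i] := \sum_(k < N) (bcoef l k)%:C%C * y ^+ k.

Lemma measurable_bpoly d (T : measurableType d) (f : T -> R[i]) N :
  measurable_fun setT f -> measurable_fun setT (fun x => bpoly N (f x)).
Proof.
move=> mf; apply: measurable_sumC => k; apply: measurable_mulC_fun => //.
elim: (nat_of_ord k) => [|j ih].
  by rewrite (_ : (fun x => _) = cst 1)//; apply/funext => x; rewrite expr0.
rewrite (_ : (fun x => _) = (fun x => f x * f x ^+ j)); first exact: measurable_mulC_fun.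
by apply/funext => x; rewrite exprS.
Qed.

Let nsq_natC (a : R) : nsq (a%:C)%C = a ^+ 2.
Proof. by rewrite /nsq/= expr0n addr0. Qed.

(** The terms are orthogonal: rotating all coordinates of [w] by the conjugate of [rt ^+ m]
    multiplies the term of degree [k] by [rt ^+ (m * k)], and the average over [m] removes the cross
    terms. What is left are the moments. *)
Lemma integral_bpoly n (a : R) (z : n.-tuple R[i]) N : -1 < a ->
  (\int[lebesgue_Cn n]_w (ppow a (1 - sqn w) * nsq (bpoly N (dotC z w)))%:E =
   (\sum_(k < N) bcoef l k ^+ 2 * (disc_area ^+ n * Gamma (a + 1) * k`!%:R /
     Gamma (a + 1 + n%:R + k%:R) * sqn z ^+ k))%:E)%E.
Proof.
move=> a1; case: N => [|N].
  rewrite big_ord0; apply: integral0_eq => w _.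
  by rewrite /bpoly big_ord0 nsq_natC expr0n mulr0.
have N0' : N.+1%:R != 0 :> R[i] by rewrite pnatr_eq0.
have [rt po] := closed_prim_root_exists N0'.
have rt1 : normc rt = 1 := normc_unity_root (ltn0Sn N) (prim_expr_order po).
have ncm m : normc ((conjc rt) ^+ m) = 1.
  have n1 : normc (conjc rt) = 1 by move: rt1; case: (rt) => p q /=; rewrite sqrrN.
  elim: m => [|m ih]; first by rewrite expr0 ComplexField.Normc.normc1.
  by rewrite exprS ComplexField.Normc.normcM n1 ih mulr1.
pose F w : \bar R := (ppow a (1 - sqn w) * nsq (bpoly N.+1 (dotC z w)))%:E.
have mp : measurable_fun setT (fun w : n.-tuple R[i] => ppow a (1 - sqn w)).
  apply: (measurableT_comp (measurable_ppow a)); apply: measurable_funB => //.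
  exact: measurable_sqn.
have mF : measurable_fun setT F.
  apply/measurable_EFinP; apply: measurable_funM => //.
  by apply: measurable_nsq_comp; apply: measurable_bpoly; exact: measurable_dotC.
have F0 w : (0 <= F w)%E by rewrite lee_fin mulr_ge0 ?ppow_ge0 ?nsq_ge0.
have N0 : N.+1%:R != 0 :> R by [].
have avg : (N.+1%:R%:E * \int[lebesgue_Cn n]_w F w =
    \int[lebesgue_Cn n]_w \sum_(m < N.+1) F (scale_Cn (conjc rt ^+ m)%R w))%E.
  rewrite ge0_integral_sum//; last first.
    by move=> m; exact: (measurableT_comp mF (measurable_scale_Cn _)).
  under eq_bigr do rewrite integral_Cn_rotation//.
  rewrite big_const_ord; elim: N.+1 => [|M ih]; first by rewrite mul0e.
  by rewrite iterS -ih -natr1 addeC EFinD ge0_muleDl ?mul1e// lee_fin.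
have -> : (\int[lebesgue_Cn n]_w F w =
    N.+1%:R^-1%:E * (N.+1%:R%:E * \int[lebesgue_Cn n]_w F w))%E.
  by rewrite muleA -EFinM mulVf// mul1e.
have mterm k : measurable_fun setT (fun w => (ppow a (1 - sqn w) * nsq (dotC z w) ^+ k)%:E).
  exact: measurable_moment.
have t0 k w : (0 <= (ppow a (1 - sqn w) * nsq (dotC z w) ^+ k)%:E)%E.
  by rewrite lee_fin mulr_ge0 ?ppow_ge0 ?exprn_ge0 ?nsq_ge0.
rewrite avg; transitivity (N.+1%:R^-1%:E * \int[lebesgue_Cn n]_w (N.+1%:R%:E *
    \sum_(k < N.+1) ((bcoef l k ^+ 2)%:E * (ppow a (1 - sqn w) * nsq (dotC z w) ^+ k)%:E)))%E.
  congr (_ * _)%E; apply: eq_integral => w _.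
  transitivity ((ppow a (1 - sqn w) * \sum_(m < N.+1) nsq
     (\sum_(k < N.+1) ((bcoef l k)%:C%C * dotC z w ^+ k) * rt ^+ (m * k)))%:E)%E.
    rewrite mulr_sumr -sumEFin; apply: eq_bigr => m _; rewrite /F.
    rewrite sqn_scale dotC_scale rmorphXn/= conjcK -normc_sqr ncm expr1n mul1r.
    congr (_ * nsq _)%:E; apply: eq_bigr => k _.
    by rewrite exprMn -exprM mulrAC mulrA.
  rewrite (parseval (fun k => (bcoef l k)%:C%C * dotC z w ^+ k) (ltn0Sn N) po).
  rewrite mulrCA EFinM mulr_sumr -sumEFin; congr (_ * _)%E; apply: eq_bigr => k _.
  by rewrite -EFinM nsqM nsqX nsq_natC; congr (_%:E); ring.
rewrite ge0_integralZl//; last 2 first.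
- apply: emeasurable_sum => k; exact: emeasurable_funM.
- move=> w _; apply: sume_ge0 => k _; apply: mule_ge0; last exact: t0.
  by rewrite lee_fin sqr_ge0.
rewrite muleA -EFinM mulVf// mul1e ge0_integral_sum//; last 2 first.
- by move=> k; exact: emeasurable_funM.
- by move=> k w _; apply: mule_ge0; [rewrite lee_fin sqr_ge0|exact: t0].
rewrite -sumEFin; apply: eq_bigr => k _.
rewrite ge0_integralZl//; last by rewrite lee_fin sqr_ge0.
rewrite moment// -EFinM; congr (_%:E).
by rewrite /ppow ltr01 powR1 mulr1.
Qed.

End series.
End kernel_expansion.

(** * The kernel integral as a limit of partial sums *)

Section kernel_integral.
Context {R : realType}.
Local Notation normc := ComplexField.Normc.normc.

(** Induction on [n]; the step is the same inequality for two pairs of nonnegative reals, which is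
    Lagrange's identity. *)
Lemma cauchy_schwarz_Cn n (z w : n.-tuple R[i]) : nsq (dotC z w) <= sqn z * sqn w.
Proof.
elim: n z w => [|n ih] z w.
  by rewrite /dotC !sqnE !big_ord0 mul0r /nsq/= expr0n addr0.
rewrite (cons_pair_surj z) (cons_pair_surj w) dotC_cons !sqn_cons.
move: (thead z) (thead w) [tuple of behead z] [tuple of behead w] => a b {}z {}w.
have := ih z w; have := sqn_ge0 z; have := sqn_ge0 w.
have := nsq_ge0 (dotC z w).
move: (sqn z) (sqn w) (dotC z w) => s t d d0 t0 s0 dst.
rewrite -normc_sqr.
have nge0 (y : R[i]) : 0 <= normc y by case: y => ? ?; exact: sqrtr_ge0.
have h : normc (a * conjc b + d) <= normc a * normc b + Num.sqrt s * Num.sqrt t.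
  apply: le_trans (le_normcD _ _) _; rewrite ComplexField.Normc.normcM.
  have -> : normc (conjc b) = normc b by case: (b) => ? ? /=; rewrite sqrrN.
  rewrite lerD2l -sqrtrM// -(@ler_pXn2r _ 2)// ?nnegrE ?sqrtr_ge0//.
  by rewrite normc_sqr sqr_sqrtr// mulr_ge0.
apply: (@le_trans _ _ ((normc a * normc b + Num.sqrt s * Num.sqrt t) ^+ 2)).
  by rewrite ler_pXn2r// nnegrE ?addr_ge0 ?mulr_ge0 ?sqrtr_ge0.
rewrite -!normc_sqr.
have -> : (normc a ^+ 2 + s) * (normc b ^+ 2 + t) =
    (normc a ^+ 2 + Num.sqrt s ^+ 2) * (normc b ^+ 2 + Num.sqrt t ^+ 2).
  by rewrite !sqr_sqrtr.
move: (normc a) (normc b) (Num.sqrt s) (Num.sqrt t) => A B S T.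
rewrite -subr_ge0.
have -> : (A ^+ 2 + S ^+ 2) * (B ^+ 2 + T ^+ 2) - (A * B + S * T) ^+ 2 =
  (A * T - B * S) ^+ 2 by ring.
exact: sqr_ge0.
Qed.

Variable l : R.
Hypothesis l0 : 0 < l.

Lemma nsq_bpoly N (y : R[i]) : nsq (bpoly l N y) =
  bsum l (fun k => complex.Re (y ^+ k)) N 1 ^+ 2 +
  bsum l (fun k => complex.Im (y ^+ k)) N 1 ^+ 2.
Proof.
have E : complex.Re (bpoly l N y) = bsum l (fun k => complex.Re (y ^+ k)) N 1 /\
         complex.Im (bpoly l N y) = bsum l (fun k => complex.Im (y ^+ k)) N 1.
  elim: N => [|N [ih1 ih2]]; first by rewrite /bpoly /bsum !big_ord0.
  have -> : bpoly l N.+1 y = bpoly l N y + (bcoef l N)%:C%C * y ^+ N.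
    by rewrite /bpoly big_ord_recr.
  have bS u : bsum l u N.+1 1 = bsum l u N 1 + bcoef l N * u N * 1 ^+ N.
    by rewrite /bsum big_ord_recr.
  rewrite !bS -ih1 -ih2; case: (bpoly _ _ _) => p q; case: (y ^+ N) => p' q' /=.
  by rewrite !expr1n !mulr1 !mul0r subr0 addr0.
by rewrite /nsq E.1 E.2.
Qed.

Section pointwise.
Variables (y : R[i]) (r : R).
Hypotheses (r0 : 0 <= r) (r1 : r < 1) (yr : nsq y <= r ^+ 2).

Let abs_le (s : R) k : s ^+ 2 <= nsq (y ^+ k) -> `|s| <= r ^+ k.
Proof.
move=> h; rewrite -(@ler_pXn2r _ 2)// ?nnegrE ?exprn_ge0// real_normK ?num_real//.
apply: le_trans h _; rewrite nsqX -exprM mulnC exprM lerXn2r// ?nnegrE ?nsq_ge0//.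
exact: sqr_ge0.
Qed.

Let ur k : `|complex.Re (y ^+ k)| <= r ^+ k.
Proof. by apply: abs_le; rewrite lerDl sqr_ge0. Qed.

Let vr k : `|complex.Im (y ^+ k)| <= r ^+ k.
Proof. by apply: abs_le; rewrite lerDr sqr_ge0. Qed.

Lemma nsq_bpoly_le N : nsq (bpoly l N y) <= 2 * ((1 - r) `^ (- l)) ^+ 2.
Proof.
have t1 : 0 <= (1 : R) <= 1 by rewrite ler01 lexx.
have hu := bsum_norm_le l0 r0 r1 N ur t1; have hv := bsum_norm_le l0 r0 r1 N vr t1.
rewrite nsq_bpoly mulr_natl mulr2n.
by apply: lerD; rewrite -real_normK ?num_real// lerXn2r// nnegrE ?powR_ge0.
Qed.

Lemma nsq_bpoly_cvg : nsq (bpoly l N y) @[N --> \oo] --> nsq (1 - y) `^ (- l).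
Proof.
under eq_fun do rewrite nsq_bpoly.
have -> : nsq (1 - y) = (1 - complex.Re y) ^+ 2 + complex.Im y ^+ 2.
  by case: (y) => a b; rewrite /nsq/= sub0r sqrrN.
apply: (bsum_sqr_cvg l0 _ _ r0 r1) => //.
- by move=> k; rewrite exprS; case: (y) => a b; case: ((a +i* b)%C ^+ k).
- by move=> k; rewrite exprS; case: (y) => a b; case: ((a +i* b)%C ^+ k).
Qed.

End pointwise.

Lemma measurable_kernel d (T : measurableType d) n (z w : T -> n.-tuple R[i]) :
  measurable_fun setT z -> measurable_fun setT w ->
  measurable_fun setT (fun x => nsq (1 - dotC (z x) (w x)) `^ (- l)).
Proof.
move=> mz mw; apply: (measurableT_comp (measurable_powR (- l))).
apply: measurable_nsq_comp.
have -> : (fun x => 1 - dotC (z x) (w x)) = (fun x => 1 + (-1) * dotC (z x) (w x)).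
  by apply/funext => x; rewrite mulN1r.
apply: measurable_addC => //; apply: measurable_mulC_fun => //.
exact: measurable_dotC.
Qed.

(** Dominated convergence: for fixed [z] in the ball and all [w] in it, $|\langle
    z,w\rangle|\le|z|<1$, so the partial sums are bounded by [G] uniformly in [N] and [w], and the
    weight is integrable. *)
Lemma kernel_cvg n (a : R) (z : n.-tuple R[i]) : -1 < a -> sqn z < 1 ->
  ((\sum_(k < N) bcoef l k ^+ 2 * (disc_area ^+ n * Gamma (a + 1) * k`!%:R /
     Gamma (a + 1 + n%:R + k%:R) * sqn z ^+ k))%:E @[N --> \oo] -->
  \int[lebesgue_Cn n]_w (ppow a (1 - sqn w) * nsq (1 - dotC z w) `^ (- l))%:E)%E.
Proof.
move=> a1 z1; pose r := Num.sqrt (sqn z).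
have r0 : 0 <= r by exact: sqrtr_ge0.
have r2 : r ^+ 2 = sqn z by rewrite sqr_sqrtr// sqn_ge0.
have r1 : r < 1 by rewrite -(@ltr_pXn2r _ 2)// ?nnegrE// r2 expr1n.
pose G := 2 * ((1 - r) `^ (- l)) ^+ 2.
have G0 : 0 <= G by rewrite mulr_ge0// sqr_ge0.
have mp : measurable_fun setT (fun w : n.-tuple R[i] => ppow a (1 - sqn w)).
  apply: (measurableT_comp (measurable_ppow a)); apply: measurable_funB => //.
  exact: measurable_sqn.
have yr w : sqn w < 1 -> nsq (dotC z w) <= r ^+ 2.
  move=> w1; apply: le_trans (cauchy_schwarz_Cn z w) _; rewrite r2.
  by rewrite ler_piMr ?sqn_ge0// ltW.
have p0 (w : n.-tuple R[i]) : ~~ (sqn w < 1) -> ppow a (1 - sqn w) = 0.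
  by rewrite /ppow subr_gt0 => /negbTE ->.
under eq_fun do rewrite -(integral_bpoly l z _ a1).
have [] := @dominated_convergence _ _ _ (lebesgue_Cn n) setT measurableT
  (fun N w => (ppow a (1 - sqn w) * nsq (bpoly l N (dotC z w)))%:E)
  (fun w => (ppow a (1 - sqn w) * nsq (1 - dotC z w) `^ (- l))%:E)
  (fun w => (ppow a (1 - sqn w) * G)%:E); last by [].
- move=> N; apply/measurable_EFinP; apply: measurable_funM => //.
  by apply: measurable_nsq_comp; apply: measurable_bpoly; exact: measurable_dotC.
- apply/measurable_EFinP; apply: measurable_funM => //.
  exact: measurable_kernel.
- apply: aeW => w _; have [w1|w1] := boolP (sqn w < 1).
    apply: cvg_EFin; first exact: nearW.
    apply: cvgM; first exact: cvg_cst.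
    exact: (nsq_bpoly_cvg r0 r1 (yr w w1)).
  by rewrite p0// mul0r; under eq_fun do rewrite mul0r; exact: cvg_cst.
- apply/integrableP; split.
    by apply/measurable_EFinP; exact: measurable_funM.
  under eq_integral.
    move=> w _; rewrite gee0_abs; last by rewrite lee_fin mulr_ge0 ?ppow_ge0.
    rewrite EFinM muleC.
    over.
  rewrite ge0_integralZl//; last 2 first.
  + exact/measurable_EFinP.
  + by move=> w _; rewrite lee_fin ppow_ge0.
  rewrite lte_mul_pinfty ?lee_fin//.
  have -> : (\int[lebesgue_Cn n]_w (ppow a (1 - sqn w))%:E =
      \int[lebesgue_Cn n]_w (ppow a (1 - sqn w) * nsq (dotC z w) ^+ 0)%:E)%E.
    by apply: eq_integral => w _; rewrite expr0 mulr1.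
  by rewrite moment// ltry.
- apply: aeW => w N _; rewrite gee0_abs; last first.
    by rewrite lee_fin mulr_ge0 ?ppow_ge0 ?nsq_ge0.
  rewrite lee_fin; have [w1|w1] := boolP (sqn w < 1); last by rewrite p0// !mul0r.
  by rewrite ler_wpM2l ?ppow_ge0// (nsq_bpoly_le r0 r1 (yr w w1)).
Qed.

End kernel_integral.

(** * Ratios of Gamma values *)

Section gamma_estimates.
Context {R : realType}.
Implicit Types x y l b c t : R.

(** Raising the interpolation inequality to the power $1+l$ clears the fractional exponents. *)
Let powR_clear (P Q S l : R) : 0 < l -> 0 < P -> 0 < Q -> 0 < S ->
  P <= Q `^ (l / (1 + l)) * S `^ (1 + l)^-1 -> P * P `^ l <= Q `^ l * S.
Proof.
move=> l0 P0 Q0 S0 h; have l1 : 0 < 1 + l by rewrite addr_gt0.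
have PE : P * P `^ l = P `^ (1 + l).
  by rewrite powRD ?(gt_eqF P0) ?implybT// powRr1// ltW.
have RE : Q `^ l * S = (Q `^ (l / (1 + l)) * S `^ (1 + l)^-1) `^ (1 + l).
  rewrite powRM ?powR_ge0// -(powRrM Q) -(powRrM S) divfK ?(gt_eqF l1)//.
  by rewrite mulVf ?(gt_eqF l1)// powRr1// ltW.
rewrite PE RE; apply: ge0_ler_powR => //; rewrite ?nnegrE ?(ltW l1) ?(ltW P0)//.
by rewrite mulr_ge0 ?powR_ge0.
Qed.

(** Log-convexity at $x<x+1<x+1+l$, with $\Gamma(x+1)=x\Gamma(x)$ used to eliminate $\Gamma(x)$. *)
Lemma Gamma_powR_ge x l : 0 < x -> 0 < l ->
  Gamma (x + 1) * x `^ l <= Gamma (x + 1 + l).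
Proof.
move=> x0 l0; have l1 : 0 < 1 + l by rewrite addr_gt0.
have xl : 0 < x + 1 + l by rewrite !addr_gt0.
have := @Gamma_log_convex R x (x + 1 + l) (l / (1 + l)) (1 + l)^-1 x0 xl.
rewrite divr_gt0// invr_gt0 l1 => /(_ isT isT).
have -> : l / (1 + l) + (1 + l)^-1 = 1 by field; rewrite gt_eqF.
have -> : l / (1 + l) * x + (1 + l)^-1 * (x + 1 + l) = x + 1.
  by field; rewrite gt_eqF.
move=> /(_ erefl) h.
have Gx := Gamma_gt0 x0; have Gxl := Gamma_gt0 xl.
have Gx1 : 0 < Gamma (x + 1) by rewrite Gamma_gt0// addr_gt0.
have := powR_clear l0 Gx1 Gx Gxl h.
rewrite {2}GammaS// powRM ?(ltW x0) ?(ltW Gx)//.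
have : 0 < Gamma x `^ l by rewrite powR_gt0.
move: (Gamma (x + 1)) (Gamma (x + 1 + l)) (Gamma x `^ l) (x `^ l) => A B C D C0 H.
by rewrite -(ler_pM2l C0); apply: le_trans H; rewrite le_eqVlt; apply/orP; left;
    apply/eqP; ring.
Qed.

(** Log-convexity at $y<y+l<y+l+1$, with the recurrence applied at the right end. *)
Lemma Gamma_powR_le y l : 0 < y -> 0 < l ->
  Gamma (y + l) <= Gamma y * (y + l) `^ l.
Proof.
move=> y0 l0; have l1 : 0 < 1 + l by rewrite addr_gt0.
have yl : 0 < y + l by rewrite addr_gt0.
have yl1 : 0 < y + l + 1 by rewrite addr_gt0.
have := @Gamma_log_convex R y (y + l + 1) (1 + l)^-1 (l / (1 + l)) y0 yl1.
rewrite divr_gt0// invr_gt0 l1 => /(_ isT isT).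
have -> : (1 + l)^-1 + l / (1 + l) = 1 by field; rewrite gt_eqF.
have -> : (1 + l)^-1 * y + l / (1 + l) * (y + l + 1) = y + l.
  by field; rewrite gt_eqF.
move=> /(_ erefl) h.
have Gy := Gamma_gt0 y0; have Gyl := Gamma_gt0 yl.
have Gyl1 := Gamma_gt0 yl1.
have := powR_clear l0 Gyl Gyl1 Gy; rewrite mulrC => /(_ h).
rewrite GammaS// powRM ?(ltW yl) ?(ltW Gyl)//.
have : 0 < Gamma (y + l) `^ l by rewrite powR_gt0.
move: (Gamma (y + l)) (Gamma (y + l) `^ l) (Gamma y) ((y + l) `^ l) => A B C D B0 H.
by rewrite -(ler_pM2r B0); apply: le_trans H _; rewrite le_eqVlt; apply/orP; left;
    apply/eqP; ring.
Qed.

Lemma Gamma_mid x y : 0 < x -> 0 < y -> Gamma ((x + y) / 2) ^+ 2 <= Gamma x * Gamma y.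
Proof.
move=> x0 y0; have Gx := Gamma_gt0 x0; have Gy := Gamma_gt0 y0.
have h0 : 0 < 2^-1 :> R by rewrite invr_gt0.
have hh : 2^-1 + 2^-1 = 1 :> R by field.
have := Gamma_log_convex x0 y0 h0 h0 hh.
rewrite -mulrDr mulrC => h.
have G0 : 0 <= Gamma ((x + y) / 2) := ltW (Gamma_gt0 (divr_gt0 (addr_gt0 x0 y0) (ltr0Sn R 1))).
apply: le_trans (_ : (Gamma x `^ 2^-1 * Gamma y `^ 2^-1) ^+ 2 <= _).
  by rewrite lerXn2r// nnegrE mulr_ge0 ?powR_ge0.
rewrite exprMn !powR12_sqrt ?(ltW Gx) ?(ltW Gy)//.
by rewrite (sqr_sqrtr (ltW Gx)) (sqr_sqrtr (ltW Gy)).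
Qed.

(** Both $t+x$ and $t+y$ are convex combinations of $t$ and $t+c$, with complementary weights, so
    the exponents add up to 1 in the product. *)
Lemma Gamma_spread t x y c : 0 < t -> 0 < x -> 0 < y -> x + y = c ->
  Gamma (t + x) * Gamma (t + y) <= Gamma t * Gamma (t + c).
Proof.
move=> t0 x0 y0 xyc; have c0 : 0 < c by rewrite -xyc addr_gt0.
have tc : 0 < t + c by rewrite addr_gt0.
have xc : 0 < x / c by rewrite divr_gt0.
have yc : 0 < y / c by rewrite divr_gt0.
have c1 : x / c + y / c = 1 by rewrite -mulrDl xyc divff// gt_eqF.
have c2 : y / c + x / c = 1 by rewrite addrC.
have cn : c != 0 by rewrite gt_eqF.
have h1 := Gamma_log_convex t0 tc yc xc c2.
have h2 := Gamma_log_convex t0 tc xc yc c1.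
have e1 : y / c * t + x / c * (t + c) = t + x.
  have -> : y / c * t + x / c * (t + c) = (x / c + y / c) * t + x by field.
  by rewrite c1 mul1r.
have e2 : x / c * t + y / c * (t + c) = t + y.
  have -> : x / c * t + y / c * (t + c) = (x / c + y / c) * t + y by field.
  by rewrite c1 mul1r.
rewrite {}e1 in h1; rewrite {}e2 in h2.
have Gt := Gamma_gt0 t0; have Gc := Gamma_gt0 tc.
have G1 : 0 <= Gamma (t + x) := ltW (Gamma_gt0 (addr_gt0 t0 x0)).
have G2 : 0 <= Gamma (t + y) := ltW (Gamma_gt0 (addr_gt0 t0 y0)).
apply: le_trans (ler_pM G1 G2 h1 h2) _.
move: Gt Gc; move: (Gamma t) (Gamma (t + c)) => A B A0 B0.
have EA : A `^ (y / c) * A `^ (x / c) = A.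
  by rewrite -powRD ?(gt_eqF A0) ?implybT// c2 powRr1// ltW.
have EB : B `^ (x / c) * B `^ (y / c) = B.
  by rewrite -powRD ?(gt_eqF B0) ?implybT// c1 powRr1// ltW.
by rewrite mulrACA EA EB.
Qed.

(** With $x=k-1$, the two preceding power bounds give
    $\Gamma(k+l)^2\ge\Gamma(k)\Gamma(k+2l)\,(x/(x+1+2l))^l$. The last factor is at least $\eta$ once
    $x/(x+1+2l)\ge\rho=\eta^{1/l}$. *)
Lemma Gamma_ratio_cvg l (eta : R) : 0 < l -> 0 < eta -> eta < 1 ->
  exists2 K, (0 < K)%N & forall k, (K <= k)%N ->
    eta * (Gamma k%:R * Gamma (k%:R + 2 * l)) <= Gamma (l + k%:R) ^+ 2.
Proof.
move=> l0 e0 e1; pose rho := eta `^ l^-1.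
have rho0 : 0 < rho by rewrite powR_gt0.
have rho1 : rho < 1.
  have E1 : 1 `^ l^-1 = 1 :> R by rewrite powR1.
  by rewrite -[ltRHS]E1 gt0_ltr_powR ?invr_gt0 ?nnegrE ?(ltW e0).
have r10 : 0 < 1 - rho by rewrite subr_gt0.
(* The condition on $\rho$ amounts to $x\ge\rho(1+2l)/(1-\rho)$; the bound used is slightly larger,
   and the offset 2 also makes $x=k-1$ positive. *)
exists (Num.bound ((1 + 2 * l * rho) / (1 - rho))).+2 => // k Kk.
case: k Kk => [|[|k]]// Kk; set x := k.+1%:R : R.
have x0 : 0 < x by rewrite ltr0n.
have -> : k.+2%:R = x + 1 :> R by rewrite natr1.
have hx : rho * (x + 1 + 2 * l) <= x.
  have : (1 + 2 * l * rho) / (1 - rho) <= x.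
    apply: le_trans (ltW (archi_boundP _)) _.
      by rewrite divr_ge0 ?(ltW r10)// addr_ge0// !mulr_ge0// ltW.
    by rewrite ler_nat -ltnS ltnW.
  rewrite ler_pdivrMr// => h; nra.
have x1l : 0 < x + 1 + l by rewrite !addr_gt0.
have x2l : 0 < x + 1 + 2 * l by rewrite !addr_gt0// mulr_gt0.
have h1 := Gamma_powR_ge x0 l0.
have h2 := Gamma_powR_le x1l l0.
have e2l : x + 1 + l + l = x + 1 + 2 * l by ring.
rewrite {}e2l in h2.
have he : eta * (x + 1 + 2 * l) `^ l <= x `^ l.
  have -> : eta = rho `^ l by rewrite /rho -powRrM mulVf ?powRr1 ?gt_eqF// ltW.
  rewrite -powRM ?(ltW rho0) ?(ltW x2l)//.
  by rewrite ge0_ler_powR ?nnegrE ?(ltW l0) ?(ltW x0)// mulr_ge0 ?(ltW rho0) ?(ltW x2l).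
have G1 : 0 < Gamma (x + 1) by rewrite Gamma_gt0// addr_gt0.
have G2 := Gamma_gt0 x1l.
rewrite (addrC l) expr2.
apply: le_trans (_ : Gamma (x + 1) * x `^ l * Gamma (x + 1 + l) <= _);
    last by rewrite ler_pM2r.
apply: le_trans (_ : eta * (Gamma (x + 1) * (Gamma (x + 1 + l) * (x + 1 + 2 * l) `^ l)) <= _).
  by rewrite ler_pM2l// ler_pM2l.
have -> : eta * (Gamma (x + 1) * (Gamma (x + 1 + l) * (x + 1 + 2 * l) `^ l)) =
  Gamma (x + 1) * (eta * (x + 1 + 2 * l) `^ l) * Gamma (x + 1 + l) by ring.
by rewrite ler_pM2r// ler_pM2l.
Qed.

(** Here $\Gamma(y)\le\Gamma(y-e)\,y^e$ and $y^e\le1$. This and [Gamma_add_ge] replace continuity of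
    $\Gamma$ when the exponent of the test functions tends to $1/p$. *)
Lemma Gamma_sub_ge y (e : R) : 0 < e -> e < y -> y <= 1 -> Gamma y <= Gamma (y - e).
Proof.
move=> e0 ey y1; have ye : 0 < y - e by rewrite subr_gt0.
have := Gamma_powR_le ye e0; rewrite subrK => /le_trans; apply.
rewrite ler_piMr ?(ltW (Gamma_gt0 ye))//.
by rewrite -(powRr0 y) ger_powR// ?(ltW e0)// (lt_trans e0 ey).
Qed.

Lemma Gamma_add_ge x (e : R) : 0 < x -> 0 < e ->
  Gamma x * (x * (x + 1) / ((x + e) * (x + 1 + e))) <= Gamma (x + e).
Proof.
move=> x0 e0; have x10 : 0 < x + 1 by rewrite addr_gt0.
have xe : 0 < x + e by rewrite addr_gt0.
have xe1 : 0 < x + 1 + e by rewrite addr_gt0.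
have := Gamma_powR_ge x10 e0.
rewrite GammaS// GammaS//.
have -> : x + 1 + 1 + e = x + e + 1 + 1 by ring.
have xe1' : 0 < x + e + 1 by rewrite addr_gt0.
rewrite (GammaS xe1') (GammaS xe) => h.
have p1 : 1 <= (x + 1) `^ e.
  by rewrite -[leLHS](powRr0 (x + 1)) ler_powR ?(ltW e0)// lerDr ltW.
rewrite mulrA ler_pdivrMr ?mulr_gt0//.
have -> : Gamma (x + e) * ((x + e) * (x + 1 + e)) =
    (x + e + 1) * ((x + e) * Gamma (x + e)) by ring.
apply: le_trans h; rewrite -[leLHS]mulr1.
have -> : Gamma x * (x * (x + 1)) = (x + 1) * (x * Gamma x) by ring.
by rewrite ler_pM2l// mulr_gt0// mulr_gt0// Gamma_gt0.
Qed.

End gamma_estimates.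

(** * Forelli-Rudin integrals *)

Section kernel_estimates.
Context {R : realType}.

(** [bsum_sqr_cvg] with zero imaginary part gives convergence of the squares; the sums are
    nonnegative, so square roots may be taken. *)
Lemma bsum1_cvg (b x : R) : 0 < b -> 0 <= x -> x < 1 ->
  bsum b (fun=> 1) N x @[N --> \oo] --> (1 - x) `^ (- b).
Proof.
move=> b0 x0 x1; pose s N := bsum b (fun=> 1) N x.
have s0 N : 0 <= s N.
  by apply: sumr_ge0 => k _; rewrite mulr1 mulr_ge0 ?exprn_ge0// ltW// bcoef_gt0.
have x10 : 0 <= 1 - x by rewrite subr_ge0 ltW.
have xk k : `|x ^+ k| <= x ^+ k by rewrite ger0_norm ?exprn_ge0.
have zk k : `|0 : R| <= x ^+ k by rewrite normr0 exprn_ge0.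
have h : s N ^+ 2 @[N --> \oo] --> ((1 - x) ^+ 2) `^ (- b).
  have := @bsum_sqr_cvg _ b b0 x 0 (fun k => x ^+ k) (fun=> 0) x.
  have -> : (1 - x) ^+ 2 + 0 ^+ 2 = (1 - x) ^+ 2 by rewrite expr0n addr0.
  have -> : (fun N => bsum b (fun k => x ^+ k) N 1 ^+ 2 + bsum b (fun=> 0) N 1 ^+ 2) =
      (fun N => s N ^+ 2).
    apply/funext => N; have -> : bsum b (fun=> 0) N 1 = 0.
      by rewrite /bsum big1// => k _; rewrite mulr0 mul0r.
    rewrite expr0n addr0; congr (_ ^+ 2); apply: eq_bigr => k _.
    by rewrite expr1n !mulr1.
  apply => //.
  - by move=> k; rewrite exprS; ring.
  - by move=> k; ring.
  - by rewrite expr0n addr0.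
have -> : (fun N => s N) = (fun N => Num.sqrt (s N ^+ 2)).
  by apply/funext => N; rewrite sqrtr_sqr ger0_norm.
have -> : (1 - x) `^ (- b) = Num.sqrt (((1 - x) ^+ 2) `^ (- b)).
  have -> : ((1 - x) ^+ 2) `^ (- b) = ((1 - x) `^ (- b)) ^+ 2.
    by rewrite -(powR_mulrn 2 x10) -powRrM mulrC powRrM powR_mulrn// powR_ge0.
  by rewrite sqrtr_sqr ger0_norm// powR_ge0.
exact: (cvg_comp _ _ h (@sqrt_continuous R _)).
Qed.

Variables (n : nat) (sigma l : R).
Hypotheses (sigma1 : -1 < sigma) (lE : 2 * l = n%:R + sigma + 1).

Let l0 : 0 < l.
Proof.
have n0 : 0 <= n%:R :> R by [].
by have := lE; have := sigma1; lra.
Qed.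

Definition kint (a : R) (z : n.-tuple R[i]) : \bar R :=
  (\int[lebesgue_Cn n]_w (ppow a (1 - sqn w) * nsq (1 - dotC z w) `^ (- l))%:E)%E.

Let kconst (a b : R) := disc_area ^+ n * Gamma (a + 1) * Gamma b / Gamma l ^+ 2.

Section fixed_exponent.
Variables (a b : R) (z : n.-tuple R[i]).
Hypotheses (b0 : 0 < b) (ab : a + b = sigma) (a1 : -1 < a) (z1 : sqn z < 1).

Let term k : bcoef l k ^+ 2 * (disc_area ^+ n * Gamma (a + 1) * k`!%:R /
     Gamma (a + 1 + n%:R + k%:R) * sqn z ^+ k) =
   disc_area ^+ n * Gamma (a + 1) / Gamma l ^+ 2 *
   (Gamma (l + k%:R) ^+ 2 / (k`!%:R * Gamma (a + 1 + n%:R + k%:R)) * sqn z ^+ k).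
Proof.
have a10 : 0 < a + 1 by rewrite -ltrBlDr sub0r.
have G1 : Gamma l != 0 := lt0r_neq0 (Gamma_gt0 l0).
have G2 : Gamma (a + 1 + n%:R + k%:R) != 0.
  by apply/lt0r_neq0/Gamma_gt0; rewrite -addrA ltr_wpDr.
have f0 : k`!%:R != 0 :> R by rewrite pnatr_eq0 -lt0n fact_gt0.
by rewrite /bcoef; field; rewrite G1 G2 f0.
Qed.

Let kc0 : 0 < disc_area ^+ n * Gamma (a + 1) / Gamma l ^+ 2.
Proof.
have a10 : 0 < a + 1 by rewrite -ltrBlDr sub0r.
by rewrite divr_gt0 ?exprn_gt0 ?mulr_gt0 ?exprn_gt0 ?disc_area_gt0 ?Gamma_gt0.
Qed.

Let bE k : Gamma (b + k%:R) / k`!%:R = Gamma b * bcoef b k.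
Proof.
have G1 : Gamma b != 0 := lt0r_neq0 (Gamma_gt0 b0).
have f0 : k`!%:R != 0 :> R by rewrite pnatr_eq0 -lt0n fact_gt0.
by rewrite /bcoef; field; rewrite G1 f0.
Qed.

Let xk k : 0 <= sqn z ^+ k.
Proof. by rewrite exprn_ge0 ?sqn_ge0. Qed.

Let Ck k : 0 < a + 1 + n%:R + k%:R.
Proof. by rewrite -addrA ltr_wpDr// -ltrBlDr sub0r. Qed.

Let term_le k :
  Gamma (l + k%:R) ^+ 2 / (k`!%:R * Gamma (a + 1 + n%:R + k%:R)) * sqn z ^+ k <=
  Gamma b * (bcoef b k * 1 * sqn z ^+ k).
Proof.
have f0 : 0 < k`!%:R :> R by rewrite ltr0n fact_gt0.
have bk : 0 < b + k%:R by rewrite ltr_wpDr.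
have GC := Gamma_gt0 (Ck k).
rewrite mulr1 mulrA -bE; apply: ler_wpM2r => //.
rewrite ler_pdivrMr ?mulr_gt0//.
have -> : Gamma (b + k%:R) / k`!%:R * (k`!%:R * Gamma (a + 1 + n%:R + k%:R)) =
   Gamma (b + k%:R) * Gamma (a + 1 + n%:R + k%:R).
  by field; rewrite gt_eqF.
have := Gamma_mid bk (Ck k).
(* The value of $\lambda$ enters here: $2l=n+\sigma+1$ and $a+b=\sigma$ make $l+k$ the exact
   midpoint. *)
have -> : (b + k%:R + (a + 1 + n%:R + k%:R)) / 2 = l + k%:R by have := lE; have := ab; lra.
by [].
Qed.

(* Termwise, Gamma(l+k)^2 <= Gamma(b+k) Gamma(a+1+n+k), by midpoint log-convexity. *)
Lemma kint_le : (kint a z <= (kconst a b * (1 - sqn z) `^ (- b))%:E)%E.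
Proof.
have cv := kernel_cvg l0 a1 z1.
rewrite /kint -(cvg_lim _ cv)//; apply: lime_le; first by apply/cvg_ex; eexists; exact: cv.
apply: nearW => N; rewrite lee_fin; under eq_bigr do rewrite term.
rewrite -mulr_sumr /kconst.
have -> : disc_area ^+ n * Gamma (a + 1) * Gamma b / Gamma l ^+ 2 * (1 - sqn z) `^ (- b) =
  disc_area ^+ n * Gamma (a + 1) / Gamma l ^+ 2 * (Gamma b * (1 - sqn z) `^ (- b)) by ring.
rewrite ler_pM2l//.
apply: le_trans (_ : Gamma b * bsum b (fun=> 1) N (sqn z) <= _).
  by rewrite /bsum mulr_sumr; apply: ler_sum => k _; exact: term_le.
by rewrite ler_pM2l ?Gamma_gt0// bsum_le// sqn_ge0.
Qed.

Hypothesis b1 : b <= 1.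

Let bcoef_le1 k : bcoef b k <= 1.
Proof.
elim: k => [|k ih]; first by rewrite bcoef0.
have k0 : 0 < k.+1%:R :> R by rewrite ltr0n.
rewrite -(ler_pM2l k0) bcoefS// mulr1; apply: le_trans (_ : (b + k%:R) * 1 <= _).
  by rewrite ler_pM2l// ltr_wpDr.
by rewrite mulr1 -natr1 addrC lerD2l.
Qed.

Let term_ge (eta : R) K k : 0 < eta -> (0 < K)%N ->
  (forall j, (K <= j)%N ->
    eta * (Gamma j%:R * Gamma (j%:R + 2 * l)) <= Gamma (l + j%:R) ^+ 2) ->
  eta * Gamma b * (bcoef b k * 1 * sqn z ^+ k - (k < K)%:R) <=
  Gamma (l + k%:R) ^+ 2 / (k`!%:R * Gamma (a + 1 + n%:R + k%:R)) * sqn z ^+ k.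
Proof.
move=> e0 K0 HK.
have f0 : 0 < k`!%:R :> R by rewrite ltr0n fact_gt0.
have GC := Gamma_gt0 (Ck k); have Gb := Gamma_gt0 b0.
have [kK|kK] := ltnP k K.
  apply: (@le_trans _ _ 0); last first.
    by rewrite mulr_ge0// divr_ge0 ?sqr_ge0// mulr_ge0 ?(ltW f0) ?(ltW GC).
  rewrite pmulr_rle0 ?mulr_gt0// subr_le0 mulr1 mulr_ile1//.
  - by rewrite ltW// bcoef_gt0.
  - by rewrite exprn_ile1 ?sqn_ge0 ?ltW.
rewrite subr0 mulr1 -mulrA (mulrA (Gamma b)) -bE mulrA; apply: ler_wpM2r => //.
rewrite ler_pdivlMr ?mulr_gt0//.
have -> : eta * (Gamma (b + k%:R) / k`!%:R) * (k`!%:R * Gamma (a + 1 + n%:R + k%:R)) =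
   eta * (Gamma (b + k%:R) * Gamma (a + 1 + n%:R + k%:R)).
  by field; rewrite gt_eqF.
apply: le_trans (HK k kK); rewrite ler_pM2l//.
have k0 : 0 < k%:R :> R by rewrite ltr0n (leq_trans K0).
have C0 : 0 < a + 1 + n%:R by have := Ck 0; rewrite addr0.
have bC : b + (a + 1 + n%:R) = 2 * l by rewrite lE -ab; ring.
by have := Gamma_spread k0 b0 C0 bC; rewrite [k%:R + b]addrC [k%:R + (a + 1 + n%:R)]addrC.
Qed.

(* Asymptotically Gamma(l+k)^2 ~ Gamma(k) Gamma(k+2l) >= Gamma(b+k) Gamma(a+1+n+k);
   the first K terms, each at most 1, are given up. *)
Lemma kint_ge (eta : R) K : 0 < eta -> (0 < K)%N ->
  (forall j, (K <= j)%N ->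
    eta * (Gamma j%:R * Gamma (j%:R + 2 * l)) <= Gamma (l + j%:R) ^+ 2) ->
  ((eta * kconst a b * ((1 - sqn z) `^ (- b) - K%:R))%:E <= kint a z)%E.
Proof.
move=> e0 K0 HK.
have cv := kernel_cvg l0 a1 z1.
have cb := bsum1_cvg b0 (sqn_ge0 z) z1.
pose v N := eta * kconst a b * (bsum b (fun=> 1) N (sqn z) - K%:R).
have cv2 : (v N)%:E @[N --> \oo] --> (eta * kconst a b * ((1 - sqn z) `^ (- b) - K%:R))%:E.
  apply: cvg_EFin; first exact: nearW.
  apply: cvgM; first exact: cvg_cst.
  by apply: cvgB => //; exact: cvg_cst.
rewrite /kint -(cvg_lim _ cv)// -(cvg_lim _ cv2)//; apply: lee_lim.
- by apply/cvg_ex; eexists; exact: cv2.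
- by apply/cvg_ex; eexists; exact: cv.
apply: nearW => N; rewrite lee_fin; under [leRHS]eq_bigr do rewrite term.
rewrite -mulr_sumr /v /kconst.
have -> : eta * (disc_area ^+ n * Gamma (a + 1) * Gamma b / Gamma l ^+ 2) * (bsum b (fun=> 1) N (sqn z) - K%:R) =
  disc_area ^+ n * Gamma (a + 1) / Gamma l ^+ 2 * (eta * Gamma b * (bsum b (fun=> 1) N (sqn z) - K%:R)) by ring.
rewrite ler_pM2l//.
apply: le_trans (_ : \sum_(k < N) (eta * Gamma b * (bcoef b k * 1 * sqn z ^+ k - (k < K)%:R)) <= _).
  rewrite -mulr_sumr sumrB -/(bsum _ _ _ _) ler_pM2l ?mulr_gt0 ?Gamma_gt0// lerD2l lerN2.
  rewrite -natr_sum ler_nat.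
  have -> : (\sum_(k < N) (k < K) = minn N K)%N.
    elim: (N) => [|M ih]; first by rewrite big_ord0 min0n.
    rewrite big_ord_recr/= ih; case: (ltnP M K) => h.
      by rewrite (minn_idPl h) addn1.
    by rewrite (minn_idPr (leqW h)) addn0.
  exact: geq_minr.
by apply: ler_sum => k _; exact: term_ge.
Qed.

End fixed_exponent.
End kernel_estimates.

(** * The spaces L^p and the operator *)

(** The right side is the tangent at $X=s^p$ of the concave function $X\mapsto X^{1/p}$, taken at
    $X=y^p$. For [p = 1] one of the weights in Young's inequality vanishes, hence the separate
    case. *)
Lemma young_tangent (R : realType) (p s y : R) : 1 <= p -> 0 < s -> 0 <= y ->
  y <= s / p * s `^ (- p) * y `^ p + s * (1 - p^-1).
Proof.
move=> p1 s0 y0; have p0 : 0 < p by exact: lt_le_trans p1.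
have ys : (y / s) `^ p = s `^ (- p) * y `^ p.
  by rewrite powRM ?invr_ge0 ?(ltW s0)// -(powR_inv1 (ltW s0)) -powRrM mulN1r mulrC.
have -> : s / p * s `^ (- p) * y `^ p = s * (p^-1 * (y / s) `^ p).
  by rewrite ys !mulrA.
rewrite -mulrDr -ler_pdivrMl// mulrC.
have ys0 : 0 <= y / s by rewrite divr_ge0// ltW.
have [->|p_neq1] := eqVneq p 1.
  by rewrite invr1 mul1r subrr addr0 powRr1.
have p_gt1 : 1 < p by rewrite lt_neqAle eq_sym p_neq1.
have a0 : 0 < p^-1 by rewrite invr_gt0.
have b0 : 0 < 1 - p^-1 by rewrite subr_gt0 invf_lt1.
have ab : p^-1 + (1 - p^-1) = 1 by rewrite addrC subrK.
have := weighted_young (powR_ge0 (y / s) p) (@ler01 R) a0 b0 ab.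
by rewrite -powRrM mulfV ?gt_eqF// powRr1// powR1 !mulr1.
Qed.

(** The tangent bound is integrated against [k]; $s=(B/A)^{1/p}$ minimizes the resulting sum when
    $p>1$. Positive upper bounds [A] and [B] in place of the integrals avoid degenerate cases. *)
Lemma weighted_hoelder d (T : measurableType d) (R : realType)
    (mu : {measure set T -> \bar R}) (k g : T -> R) (p A B : R) :
  measurable_fun setT k -> measurable_fun setT g ->
  (forall x, 0 <= k x) -> (forall x, 0 <= g x) -> 1 <= p -> 0 < A -> 0 < B ->
  (\int[mu]_x (k x)%:E <= A%:E)%E -> (\int[mu]_x (k x * g x `^ p)%:E <= B%:E)%E ->
  (\int[mu]_x (k x * g x)%:E <= (A `^ (1 - p^-1) * B `^ p^-1)%:E)%E.
Proof.
move=> mk mg k0 g0 p1 A0 B0 kA kB.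
have p0 : 0 < p by exact: lt_le_trans p1.
pose s := (B / A) `^ p^-1; have s0 : 0 < s by rewrite powR_gt0// divr_gt0.
pose c1 := s / p * s `^ (- p); pose c2 := s * (1 - p^-1).
have c10 : 0 <= c1 by rewrite mulr_ge0 ?powR_ge0// divr_ge0 ?ltW.
have c20 : 0 <= c2 by rewrite mulr_ge0 ?(ltW s0)// subr_ge0 invf_le1.
have mkg : measurable_fun setT (fun x => k x * g x `^ p).
  apply: measurable_funM => //.
  exact: (measurableT_comp (measurable_powR p) mg).
have kg0 x : 0 <= k x * g x `^ p by rewrite mulr_ge0 ?powR_ge0.
have -> : A `^ (1 - p^-1) * B `^ p^-1 = c1 * B + c2 * A.
  have sp : s `^ (- p) = A / B.
    rewrite /s -powRrM mulrN mulVf ?gt_eqF// powR_inv1 ?divr_ge0 ?ltW//.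
    by rewrite invf_div.
  have -> : c1 * B + c2 * A = s * A.
    by rewrite /c1 /c2 sp; field; rewrite !gt_eqF.
  rewrite /s powRM ?invr_ge0 ?(ltW A0) ?(ltW B0)// -(powR_inv1 (ltW A0)) -powRrM mulN1r.
  have AE : A `^ (- p^-1) * A = A `^ (1 - p^-1).
    by rewrite -[X in _ * X](powRr1 (ltW A0)) -powRD ?(gt_eqF A0) ?implybT// addrC.
  by rewrite -mulrA AE mulrC.
apply: (@le_trans _ _ (\int[mu]_x (c1%:E * (k x * g x `^ p)%:E + c2%:E * (k x)%:E))%E).
  apply: ge0_le_integral => //.
  - by move=> x _; rewrite lee_fin mulr_ge0.
  - by apply/measurable_EFinP; exact: measurable_funM.
  - apply: emeasurable_funD; apply: emeasurable_funM => //; exact/measurable_EFinP.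
  - move=> x _; rewrite -!EFinM lee_fin.
    have -> : c1 * (k x * g x `^ p) + c2 * k x = k x * (c1 * g x `^ p + c2) by ring.
    by rewrite ler_wpM2l// young_tangent.
rewrite ge0_integralD//; last 4 first.
- by move=> x _; rewrite mule_ge0 ?lee_fin.
- by apply: emeasurable_funM => //; exact/measurable_EFinP.
- by move=> x _; rewrite mule_ge0 ?lee_fin.
- by apply: emeasurable_funM => //; exact/measurable_EFinP.
rewrite !ge0_integralZl//; last 4 first.
- exact/measurable_EFinP.
- by move=> x _; rewrite lee_fin.
- exact/measurable_EFinP.
- by move=> x _; rewrite lee_fin.
rewrite EFinD !EFinM; apply: leeD; apply: lee_wpmul2l => //; rewrite lee_fin//.
Qed.

Section ball.
Context {R : realType}.
Variable n : nat.
Local Notation normc := ComplexField.Normc.normc.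
Local Notation nv := (@normalized_volume R n).

Definition bext (g : n.-tuple R[i] -> R) (w : n.-tuple R[i]) : R :=
  if sqn w < 1 then g w else 0.

Lemma unit_ball_set : (@unit_ball R n) = [set w | sqn w < 1].
Proof. by apply/funext => w; rewrite -[LHS]/(unit_ball w) unit_ballE. Qed.

Lemma measurable_unit_ball : measurable (@unit_ball R n).
Proof.
rewrite unit_ball_set.
exact: (measurable_set_lt (@measurable_sqn R n) (measurable_cst (1 : R))).
Qed.

Lemma bextE (g : n.-tuple R[i] -> R) : g \_ unit_ball = bext g.
Proof.
apply/funext => w; rewrite patchE /bext unit_ball_set.
by case: ifPn => h; [rewrite ifT//; move: h; rewrite inE|rewrite ifF//; apply/negP => h';
    move/negP: h; rewrite inE].
Qed.

Lemma measurable_bext (g : n.-tuple R[i] -> R) :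
  measurable_fun unit_ball g <-> measurable_fun setT (bext g).
Proof. by rewrite -bextE; apply: measurable_restrictT; exact: measurable_unit_ball. Qed.

(** The moment with $a=k=0$ and $s=1$, for which [ppow] is the indicator of the ball. *)
Lemma lebesgue_Cn_ball :
  lebesgue_Cn n (@unit_ball R n) = (disc_area ^+ n / Gamma (n%:R + 1))%:E.
Proof.
rewrite -[in LHS](setIT unit_ball) -integral_indic//; last exact: measurable_unit_ball.
have a1 : -1 < 0 :> R by rewrite ltrN10.
have := moment 1 0 [tuple of nseq n (0 : R[i])] a1.
rewrite !add0r Gamma1 fact0 !addr0 !mulr1 [1 + _]addrC.
rewrite {2}/ppow ltr01 powR1 mulr1 => <-.
apply: eq_integral => w _; rewrite expr0 mulr1 indicE /ppow unit_ball_set subr_gt0.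
case: ifPn => h; first by rewrite mem_set// powRr0.
by rewrite memNset//=; exact/negP.
Qed.

Definition vol : R := disc_area ^+ n / Gamma (n%:R + 1).

Lemma vol_gt0 : 0 < vol.
Proof. by rewrite divr_gt0 ?exprn_gt0 ?disc_area_gt0 ?Gamma_gt0// ltr_wpDl. Qed.

Lemma integral_nv (F : n.-tuple R[i] -> \bar R) : measurable_fun setT F ->
  (forall w, 0 <= F w)%E ->
  (\int[nv]_w F w = vol^-1%:E * \int[lebesgue_Cn n]_w F w)%E.
Proof.
move=> mF F0; rewrite ge0_integral_mscale//=.
by rewrite lebesgue_Cn_ball.
Qed.

Lemma integral_ball (g : n.-tuple R[i] -> R) :
  (\int[nv]_(w in unit_ball) (g w)%:E = \int[nv]_w (bext g w)%:E)%E.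
Proof.
rewrite integral_mkcond; apply: eq_integral => w _.
by rewrite -bextE restrict_EFin.
Qed.

Lemma nv_setT_ball : (\int[nv]_w (bext (cst 1) w)%:E = 1)%E.
Proof.
rewrite integral_nv; last 2 first.
- apply/measurable_EFinP/measurable_bext; exact: measurable_cst.
- by move=> w; rewrite lee_fin /bext; case: ifP.
have -> : (\int[lebesgue_Cn n]_w (bext (cst 1) w)%:E = vol%:E)%E.
  rewrite -lebesgue_Cn_ball -[in RHS](setIT unit_ball) -integral_indic//;
      last exact: measurable_unit_ball.
  apply: eq_integral => w _; rewrite indicE /bext unit_ball_set.
  by case: ifPn => h; [rewrite mem_set|rewrite memNset//=; exact/negP].
by rewrite -EFinM mulVf// gt_eqF// vol_gt0.
Qed.

Definition fabs (f : n.-tuple R[i] -> R[i]) := bext (fun w => normc (f w)).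

Lemma fabs_ge0 f w : 0 <= fabs f w.
Proof. by rewrite /fabs /bext; case: ifP => // _; case: (f w) => ? ?; exact: sqrtr_ge0. Qed.

Definition lpint (p : R) (f : n.-tuple R[i] -> R[i]) : \bar R :=
  (\int[nv]_w (fabs f w `^ p)%:E)%E.

Lemma Lp_normE (p : R) f : Lp_norm p f = (lpint p f `^ p^-1)%E.
Proof.
rewrite /Lp_norm unlock; congr (_ `^ _)%E; apply: eq_integral => w _.
have -> : ((fun z => (normc (f z))%:E) \_ unit_ball) w = (fabs f w)%:E.
  by rewrite -[fun z => (normc (f z))%:E]/(EFin \o (fun z => normc (f z))) restrict_EFin bextE.
by rewrite abse_EFin ger0_norm ?fabs_ge0// poweR_EFin.
Qed.

Lemma measurable_fabs f : measurable_fun unit_ball f -> measurable_fun setT (fabs f).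
Proof.
move=> mf; apply/measurable_bext.
have -> : (fun w => normc (f w)) = (fun w => nsq (f w) `^ 2^-1).
  by apply/funext => w; rewrite powR12_sqrt ?nsq_ge0//; case: (f w).
exact: (measurableT_comp (measurable_powR _) (measurableT_comp measurable_nsq mf)).
Qed.

Lemma lpint_ge0 p f : (0 <= lpint p f)%E.
Proof. by apply: integral_ge0 => w _; rewrite lee_fin powR_ge0. Qed.

Lemma Lp_ballE (p : R) f : 0 < p ->
  Lp_ball p f <-> measurable_fun unit_ball f /\ (lpint p f < +oo)%E.
Proof.
move=> p0; rewrite /Lp_ball/= Lp_normE; split => -[mf h]; split => //.
  apply: (@lty_poweRy _ _ p^-1) => //; first by rewrite invr_neq0// gt_eqF.
exact: poweR_lty.
Qed.

End ball.

Section nv_fubini.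
Context {R : realType}.
Variables (n : nat) (H : n.-tuple R[i] * n.-tuple R[i] -> \bar R).
Hypotheses (mH : measurable_fun setT H) (H0 : forall x, (0 <= H x)%E).
Local Notation nv := (@normalized_volume R n).
Local Notation leb := (@lebesgue_Cn R n).

Let v0 : (0 <= (@vol R n)^-1%:E)%E.
Proof. by rewrite lee_fin invr_ge0 ltW// vol_gt0. Qed.

Let inner1 z : (\int[nv]_w H (z, w) = (@vol R n)^-1%:E * \int[leb]_w H (z, w))%E.
Proof. by rewrite integral_nv//; exact: measurable_fun_pair2. Qed.

Let inner2 w : (\int[nv]_z H (z, w) = (@vol R n)^-1%:E * \int[leb]_z H (z, w))%E.
Proof. by rewrite integral_nv//; exact: measurable_fun_pair1. Qed.

Let mF : measurable_fun setT (fun z => \int[leb]_w H (z, w))%E.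
Proof. exact: (measurable_fun_fubini_tonelli_F _ mH H0). Qed.

Let mG : measurable_fun setT (fun w => \int[leb]_z H (z, w))%E.
Proof. exact: (measurable_fun_fubini_tonelli_G _ mH H0). Qed.

Lemma measurable_nv_integral : measurable_fun setT (fun z => \int[nv]_w H (z, w))%E.
Proof. by under eq_fun do rewrite inner1; exact: emeasurable_funM. Qed.

Lemma measurable_nv_integral2 : measurable_fun setT (fun w => \int[nv]_z H (z, w))%E.
Proof. by under eq_fun do rewrite inner2; exact: emeasurable_funM. Qed.

(** [nv] is declared only as a measure, so the exchange takes place for the sigma-finite
    [lebesgue_Cn] and the two scalings are pulled out. *)
Lemma nv_tonelli : (\int[nv]_z \int[nv]_w H (z, w) = \int[nv]_w \int[nv]_z H (z, w))%E.
Proof.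
rewrite integral_nv; last 2 first.
- exact: measurable_nv_integral.
- by move=> z; exact: integral_ge0.
rewrite [RHS]integral_nv; last 2 first.
- exact: measurable_nv_integral2.
- by move=> z; exact: integral_ge0.
under eq_integral do rewrite inner1.
under [in RHS]eq_integral do rewrite inner2.
rewrite ge0_integralZl//; last by move=> z _; exact: integral_ge0.
rewrite ge0_integralZl//; last by move=> z _; exact: integral_ge0.
by rewrite (fubini_tonelli _ mH H0).
Qed.

End nv_fubini.

Section operator.
Context {R : realType}.
Local Notation normc := ComplexField.Normc.normc.
Variables (n : nat) (sigma l : R).
Hypotheses (sigma1 : -1 < sigma) (lE : 2 * l = n%:R + sigma + 1).
Local Notation nv := (@normalized_volume R n).
Implicit Types (f : n.-tuple R[i] -> R[i]) (z w : n.-tuple R[i]).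

Let l0 : 0 < l.
Proof.
have n0 : 0 <= n%:R :> R by [].
by have := lE; have := sigma1; lra.
Qed.

(* nsq (1 - <z,w>)^(-l) is |1 - <z,w>|^(-2l). *)
Definition wker (a : R) z w : R := ppow a (1 - sqn w) * nsq (1 - dotC z w) `^ (- l).

Lemma wker_ge0 a z w : 0 <= wker a z w.
Proof. by rewrite mulr_ge0 ?ppow_ge0 ?powR_ge0. Qed.

Lemma measurable_wker2 a : measurable_fun setT (fun x : n.-tuple R[i] * n.-tuple R[i] => wker a x.1 x.2).
Proof.
apply: measurable_funM; last exact: measurable_kernel.
apply: (measurableT_comp (measurable_ppow a)); apply: measurable_funB => //.
exact: (measurableT_comp (@measurable_sqn R n) measurable_snd).
Qed.

Lemma measurable_wker a z : measurable_fun setT (wker a z).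
Proof. exact: (measurable_fun_pair2 z (measurable_wker2 a)). Qed.

Lemma wker_nv a z : (\int[nv]_w (wker a z w)%:E = (vol n)^-1%:E * kint l a z)%E.
Proof.
rewrite integral_nv//; last by move=> w; rewrite lee_fin wker_ge0.
by apply/measurable_EFinP; exact: measurable_wker.
Qed.

(** For $a+b=\sigma$ this is [c_sigma] times the constant of the kernel estimates; $a=\sigma-1/p$,
    $b=1/p$ gives the norm. *)
Definition opconst (a b : R) : R :=
  Gamma (2 * l) / (Gamma l ^+ 2 * Gamma (sigma + 1)) * Gamma (a + 1) * Gamma b.

Lemma c_sigma_gt0 : 0 < c_sigma n sigma.
Proof.
have s0 : 0 < sigma + 1 by rewrite -ltrBlDr sub0r.
have h1 : 0 < n%:R + sigma + 1 by rewrite -addrA ltr_wpDl.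
have h2 : 0 < n%:R + 1 :> R by rewrite ltr_wpDl.
by rewrite /c_sigma divr_gt0 ?mulr_gt0 ?Gamma_gt0.
Qed.

Lemma opconst_gt0 a b : -1 < a -> 0 < b -> 0 < opconst a b.
Proof.
move=> a1 b0; have s0 : 0 < sigma + 1 by rewrite -ltrBlDr sub0r.
have a0 : 0 < a + 1 by rewrite -ltrBlDr sub0r.
by rewrite /opconst !mulr_gt0 ?invr_gt0 ?mulr_gt0 ?exprn_gt0 ?Gamma_gt0// mulr_gt0.
Qed.

Lemma opconstE a b : c_sigma n sigma * ((vol n)^-1 *
  (disc_area ^+ n * Gamma (a + 1) * Gamma b / Gamma l ^+ 2)) = opconst a b.
Proof.
have s0 : 0 < sigma + 1 by rewrite -ltrBlDr sub0r.
have h2 : 0 < n%:R + 1 :> R by rewrite ltr_wpDl.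
rewrite /opconst /c_sigma /vol lE.
have := lt0r_neq0 (Gamma_gt0 l0); have := lt0r_neq0 (Gamma_gt0 s0).
have := lt0r_neq0 (Gamma_gt0 h2); have := lt0r_neq0 (@disc_area_gt0 R).
move: (Gamma l) (Gamma (sigma + 1)) (Gamma (n%:R + 1)) (disc_area) (Gamma (n%:R + sigma + 1)).
move=> A B C D E D0 C0 B0 A0; field.
by rewrite A0 B0 C0 expf_neq0.
Qed.

Lemma wker_le a b z : 0 < b -> a + b = sigma -> -1 < a -> sqn z < 1 ->
  (\int[nv]_w (wker a z w)%:E <=
   (opconst a b / c_sigma n sigma * (1 - sqn z) `^ (- b))%:E)%E.
Proof.
move=> b0 ab a1 z1; rewrite wker_nv.
have h := kint_le sigma1 lE b0 ab a1 z1.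
have -> : opconst a b / c_sigma n sigma = (vol n)^-1 *
  (disc_area ^+ n * Gamma (a + 1) * Gamma b / Gamma l ^+ 2).
  by rewrite -opconstE mulrC mulKf// gt_eqF// c_sigma_gt0.
have v0 : (0 <= (@vol R n)^-1%:E)%E by rewrite lee_fin invr_ge0 ltW// vol_gt0.
by apply: le_trans (lee_wpmul2l v0 h) _; rewrite -EFinM lee_fin mulrA.
Qed.

Lemma wker_ge a b z (eta : R) K : 0 < b -> a + b = sigma -> -1 < a -> sqn z < 1 ->
  b <= 1 -> 0 < eta -> (0 < K)%N ->
  (forall j, (K <= j)%N ->
    eta * (Gamma j%:R * Gamma (j%:R + 2 * l)) <= Gamma (l + j%:R) ^+ 2) ->
  ((eta * (opconst a b / c_sigma n sigma) * ((1 - sqn z) `^ (- b) - K%:R))%:E <=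
   \int[nv]_w (wker a z w)%:E)%E.
Proof.
move=> b0 ab a1 z1 b1 e0 K0 HK; rewrite wker_nv.
have h := kint_ge sigma1 lE b0 ab a1 z1 b1 e0 K0 HK.
have -> : opconst a b / c_sigma n sigma = (vol n)^-1 *
  (disc_area ^+ n * Gamma (a + 1) * Gamma b / Gamma l ^+ 2).
  by rewrite -opconstE mulrC mulKf// gt_eqF// c_sigma_gt0.
have v0 : (0 <= (@vol R n)^-1%:E)%E by rewrite lee_fin invr_ge0 ltW// vol_gt0.
apply: le_trans (lee_wpmul2l v0 h); rewrite -EFinM lee_fin le_eqVlt; apply/orP; left.
by apply/eqP; move: ((vol n)^-1) (Gamma b) (Gamma (a + 1)) (Gamma l) => v G1 G2 G3; ring.
Qed.

Lemma integrandE f z w : sqn w < 1 ->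
  Tsigma_integrand sigma l f z w = ((wker sigma z w)%:C)%C * f w.
Proof.
move=> w1; rewrite /Tsigma_integrand.
have nc : 0 <= normc (1 - dotC z w) by case: (1 - dotC z w) => ? ?; exact: sqrtr_ge0.
rewrite /wker /ppow subr_gt0 w1 normCn_sqr.
by rewrite powRrM (powR_mulrn 2 nc) normc_sqr powRN.
Qed.

Definition fRe f := bext (fun w => complex.Re (f w)).
Definition fIm f := bext (fun w => complex.Im (f w)).

Lemma measurable_fRe f : measurable_fun unit_ball f -> measurable_fun setT (fRe f).
Proof.
by move=> mf; apply/measurable_bext; exact: (measurableT_comp measurable_Re mf).
Qed.

Lemma measurable_fIm f : measurable_fun unit_ball f -> measurable_fun setT (fIm f).
Proof.
by move=> mf; apply/measurable_bext; exact: (measurableT_comp measurable_Im mf).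
Qed.

Lemma norm_fRe_le f w : `|fRe f w| <= fabs f w.
Proof.
rewrite /fRe /fabs /bext; case: ifP => _; last by rewrite normr0.
by case: (f w) => a b /=; rewrite -sqrtr_sqr ler_wsqrtr// lerDl sqr_ge0.
Qed.

Lemma norm_fIm_le f w : `|fIm f w| <= fabs f w.
Proof.
rewrite /fIm /fabs /bext; case: ifP => _; last by rewrite normr0.
by case: (f w) => a b /=; rewrite -sqrtr_sqr ler_wsqrtr// lerDr sqr_ge0.
Qed.

Lemma bext_Re_integrand f z w :
  bext (fun w => complex.Re (Tsigma_integrand sigma l f z w)) w = wker sigma z w * fRe f w.
Proof.
rewrite /fRe /bext; case: ifPn => w1; last by rewrite mulr0.
by rewrite (integrandE _ _ w1); case: (f w) => a b /=; rewrite mul0r subr0.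
Qed.

Lemma bext_Im_integrand f z w :
  bext (fun w => complex.Im (Tsigma_integrand sigma l f z w)) w = wker sigma z w * fIm f w.
Proof.
rewrite /fIm /bext; case: ifPn => w1; last by rewrite mulr0.
by rewrite (integrandE _ _ w1); case: (f w) => a b /=; rewrite mul0r addr0.
Qed.

(** The absolute version of the operator, without [c_sigma]: where it is finite, the defining
    integral converges. *)
Definition absT f z : \bar R := (\int[nv]_w (wker sigma z w * fabs f w)%:E)%E.

End operator.

(** * The upper bound *)

(** The bound $|\int(u+iv)|\le\int h$. With $U$, $V$ the two integrals and $m=|U+iV|$, one has
    $m^2=\int(Uu+Vv)\le m\int h$ by the Cauchy-Schwarz inequality in the plane. *)
Lemma sqr_Rintegral_le d (T : measurableType d) (R : realType)
    (mu : {measure set T -> \bar R}) (u v h : T -> R) :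
  measurable_fun setT u -> measurable_fun setT v ->
  (forall x, u x ^+ 2 + v x ^+ 2 <= h x ^+ 2) -> (forall x, 0 <= h x) ->
  mu.-integrable setT (EFin \o h) ->
  (\int[mu]_x u x) ^+ 2 + (\int[mu]_x v x) ^+ 2 <= (\int[mu]_x h x) ^+ 2.
Proof.
move=> mu_ mv uvh h0 ih.
have sq (a b c : R) : a ^+ 2 + b ^+ 2 <= c ^+ 2 -> 0 <= c -> `|a| <= c.
  move=> abc c0; rewrite -(ger0_norm c0) -ler_sqr ?nnegrE// !real_normK ?num_real//.
  by apply: le_trans abc; rewrite lerDl sqr_ge0.
have iu : mu.-integrable setT (EFin \o u).
  apply: le_integrable ih => //; first exact/measurable_EFinP.
  by move=> x _; rewrite lee_fin (ger0_norm (h0 x)); exact: sq.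
have iv : mu.-integrable setT (EFin \o v).
  apply: le_integrable ih => //; first exact/measurable_EFinP.
  by move=> x _; rewrite lee_fin (ger0_norm (h0 x)); apply: sq (u x) _ _ (h0 x); rewrite addrC.
set U := \int[mu]_x u x; set V := \int[mu]_x v x; set I := \int[mu]_x h x.
have I0 : 0 <= I by exact: Rintegral_ge0.
set m := Num.sqrt (U ^+ 2 + V ^+ 2).
have mE : m ^+ 2 = U ^+ 2 + V ^+ 2 by rewrite sqr_sqrtr// addr_ge0 ?sqr_ge0.
have m0 : 0 <= m by exact: sqrtr_ge0.
have key : m * m <= m * I.
  rewrite -expr2 mE !expr2 -(RintegralZl _ _ iu)// -(RintegralZl _ _ iv)//.
  rewrite -(RintegralZl _ _ ih)// -RintegralD//; last 2 first.
  - exact: (integrableZl measurableT U iu).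
  - exact: (integrableZl measurableT V iv).
  apply: le_Rintegral => //.
  - exact: (integrableD measurableT (integrableZl measurableT U iu) (integrableZl measurableT V iv)).
  - exact: (integrableZl measurableT m ih).
  move=> x _; apply: le_trans (ler_norm _) _.
  rewrite -ler_sqr ?nnegrE ?mulr_ge0// real_normK ?num_real// exprMn mE.
  apply: le_trans (ler_wpM2l _ (uvh x)); last by rewrite addr_ge0 ?sqr_ge0.
  rewrite -subr_ge0 (_ : _ - _ = (U * v x - V * u x) ^+ 2) ?sqr_ge0//; ring.
rewrite -mE ler_sqr ?nnegrE//.
have [->//|m1] := eqVneq m 0.
have mp : 0 < m by rewrite lt_def m1.
by rewrite -(ler_pM2l mp).
Qed.

(** * Schur's test: Hölder's inequality in the inner variable *)

Section schur.
Context {R : realType}.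
Local Notation normc := ComplexField.Normc.normc.
Variables (n : nat) (sigma l : R).
Hypotheses (sigma1 : -1 < sigma) (lE : 2 * l = n%:R + sigma + 1).
Local Notation nv := (@normalized_volume R n).
Implicit Types (f : n.-tuple R[i] -> R[i]) (z w : n.-tuple R[i]).
Local Notation cs := (c_sigma n sigma).
Local Notation wker := (@wker R n l).
Local Notation opconst := (opconst sigma l).

Let l0 : 0 < l.
Proof.
have n0 : 0 <= n%:R :> R by [].
by have := lE; have := sigma1; lra.
Qed.

Let cs0 : 0 < cs. Proof. exact: c_sigma_gt0. Qed.

Lemma nsq_1dotC_sym z w : nsq (1 - dotC z w) = nsq (1 - dotC w z).
Proof.
rewrite -(nsq_conj (1 - dotC z w)) rmorphB rmorph1; congr (nsq (1 - _)).
rewrite /dotC rmorph_sum; apply: eq_bigr => i _.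
by rewrite rmorphM /= conjcK mulrC.
Qed.

Lemma kernel_bounded z : sqn z < 1 ->
  exists2 M, 0 <= M & forall w, sqn w < 1 -> nsq (1 - dotC z w) `^ (- l) <= M.
Proof.
move=> z1; set r := Num.sqrt (sqn z).
have r0 : 0 <= r by exact: sqrtr_ge0.
have r1 : 0 < 1 - r by rewrite subr_gt0 -sqrtr1 ltr_sqrt.
exists (((1 - r) ^+ 2) `^ (- l)) => [|w w1]; first exact: powR_ge0.
have h : (1 - r) ^+ 2 <= nsq (1 - dotC z w).
  have dr : nsq (dotC z w) <= sqn z.
    apply: le_trans (cauchy_schwarz_Cn z w) _.
    by rewrite -[leRHS]mulr1 ler_wpM2l ?sqn_ge0 ?ltW.
  move: dr; case: (dotC z w) => a b; rewrite /nsq /= => dr.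
  have ar : `|a| <= r.
    by rewrite -sqrtr_sqr ler_wsqrtr// (le_trans _ dr)// lerDl sqr_ge0.
  have ar' : a <= r by exact: le_trans (ler_norm a) ar.
  apply: (@le_trans _ _ ((1 - a) ^+ 2)); last by rewrite lerDl sqr_ge0.
  by rewrite ler_sqr ?nnegrE ?(ltW r1)//; lra.
have h0 : 0 < (1 - r) ^+ 2 by rewrite exprn_gt0.
have h1 : 0 < nsq (1 - dotC z w) by exact: lt_le_trans h.
rewrite !powRN lef_pV2 ?posrE ?powR_gt0//.
by rewrite ge0_ler_powR ?nnegrE ?(ltW l0) ?(ltW h0) ?(ltW h1).
Qed.

Lemma ppow_le1 (b t : R) : 0 <= b -> t <= 1 -> ppow b t <= 1.
Proof.
move=> b0 t1; rewrite /ppow; case: ifPn => // t0.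
have := ge0_ler_powR b0 (ltW t0 : t \is Num.nneg) (ler01 : (1 : R) \is Num.nneg) t1.
by rewrite powR1.
Qed.

Lemma ppowM (a b t : R) : ppow a t * ppow b t = ppow (a + b) t.
Proof.
rewrite /ppow; case: ifPn => t0; last by rewrite mulr0.
by rewrite powRD// (gt_eqF t0) implybT.
Qed.

Variables p q : R.
Hypotheses (p1 : 1 <= p) (qE : q = p^-1) (sp : q - 1 < sigma).
Let p0 : 0 < p. Proof. exact: lt_le_trans p1. Qed.
Let q0 : 0 < q. Proof. by rewrite qE invr_gt0. Qed.
Let q1 : q <= 1. Proof. by rewrite qE invf_le1. Qed.
Let pq : p * q = 1. Proof. by rewrite qE mulfV ?gt_eqF. Qed.
Let sq : -1 < sigma - q. Proof. by have := sp; lra. Qed.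
Local Notation C := (opconst (sigma - q) q).
Let C0 : 0 < C. Proof. exact: (opconst_gt0 sigma1 lE sq q0). Qed.

(** The second factor in Hölder's inequality: compensating the weight $(1-|w|^2)^{-q}$ puts
    $(1-|w|^2)^q$ next to $|f|$, and its $p$-th power raises the exponent by $pq=1$. *)
Definition schur_ker f z w : R := wker (sigma - q + 1) z w * fabs f w `^ p.

Lemma schur_ker_ge0 f z w : 0 <= schur_ker f z w.
Proof. by rewrite mulr_ge0 ?wker_ge0 ?powR_ge0. Qed.

Lemma measurable_schur_ker f : measurable_fun unit_ball f ->
  measurable_fun setT (fun x : n.-tuple R[i] * n.-tuple R[i] => schur_ker f x.1 x.2).
Proof.
move=> mf; apply: measurable_funM; first exact: measurable_wker2.
apply: (measurableT_comp (measurable_powR p)).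
exact: (measurableT_comp (measurable_fabs mf) measurable_snd).
Qed.

Lemma schur_ker_fin f z : measurable_fun unit_ball f -> (lpint p f < +oo)%E ->
  sqn z < 1 -> (\int[nv]_w (schur_ker f z w)%:E < +oo)%E.
Proof.
move=> mf fo z1; have [M M0 HM] := kernel_bounded z1.
apply: (@le_lt_trans _ _ (M%:E * lpint p f)%E); last first.
  by rewrite lte_mul_pinfty ?lee_fin// ge0_fin_numE ?lpint_ge0.
have mfp : measurable_fun setT (fun w => (fabs f w `^ p)%:E).
  by apply/measurable_EFinP;
      exact: (measurableT_comp (measurable_powR p) (measurable_fabs mf)).
rewrite /lpint -ge0_integralZl//; last by move=> w _; rewrite lee_fin powR_ge0.
apply: ge0_le_integral => //.
- by move=> w _; rewrite lee_fin schur_ker_ge0.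
- by apply/measurable_EFinP; exact: (measurable_fun_pair2 z (measurable_schur_ker mf)).
- exact: emeasurable_funM.
move=> w _; rewrite -EFinM lee_fin ler_wpM2r ?powR_ge0//.
rewrite /wker; have [w1|w1] := ltP (sqn w) 1; last first.
  by rewrite {1}/ppow ifF ?mul0r//; apply/negbTE; rewrite -leNgt subr_le0.
rewrite -[leRHS]mul1r ler_pM ?ppow_ge0 ?powR_ge0 ?HM//.
by apply: ppow_le1; [have := sp; lra|rewrite gerBl sqn_ge0].
Qed.

Let A z := C / cs * (1 - sqn z) `^ (- q).

Let A_gt0 z : sqn z < 1 -> 0 < A z.
Proof.
move=> z1; have h : 0 < C / cs by exact: divr_gt0 C0 cs0.
by apply: (mulr_gt0 h); apply: powR_gt0; rewrite subr_gt0.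
Qed.

(* Hoelder's inequality with the Schur weight (1 - |w|^2)^(-1/p). *)
Lemma absT_le f z : measurable_fun unit_ball f -> (lpint p f < +oo)%E -> sqn z < 1 ->
  (absT sigma l f z < +oo)%E /\
  ((fine (absT sigma l f z) `^ p)%:E <=
   (A z `^ (p - 1))%:E * \int[nv]_w (schur_ker f z w)%:E)%E.
Proof.
move=> mf fo z1; have A0 := A_gt0 z1.
have Qfin := schur_ker_fin mf fo z1.
have Q0 : (0 <= \int[nv]_w (schur_ker f z w)%:E)%E.
  by apply: integral_ge0 => w _; rewrite lee_fin schur_ker_ge0.
have [I IE] : exists I, (\int[nv]_w (schur_ker f z w)%:E)%E = I%:E.
  by exists (fine (\int[nv]_w (schur_ker f z w)%:E)); rewrite fineK// ge0_fin_numE.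
rewrite IE; rewrite IE lee_fin in Q0.
(* [weighted_hoelder] needs a positive bound, while [I] may vanish; the margin [e] is removed at the
   end. *)
have H (e : R) : 0 < e -> (absT sigma l f z <= (A z `^ (1 - q) * (I + e) `^ q)%:E)%E.
  move=> e0; pose g w := fabs f w * ppow q (1 - sqn w).
  have m1 : measurable_fun setT (fun w => 1 - sqn w).
    by apply: measurable_funB => //; exact: measurable_sqn.
  have := @weighted_hoelder _ _ R nv (wker (sigma - q) z) g p (A z) (I + e); rewrite -qE.
  have -> : (\int[nv]_x (wker (sigma - q) z x * g x)%:E = absT sigma l f z)%E.
    apply: eq_integral => w _; congr EFin.
    by rewrite /wker /g mulrC -(mulrA (fabs f w)) (mulrA (ppow q _)) ppowM (addrC q) subrK mulrC.
  apply => //.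
  - exact: measurable_wker.
  - apply: measurable_funM; first exact: measurable_fabs.
    exact: (measurableT_comp (measurable_ppow q)).
  - by move=> w; exact: wker_ge0.
  - by move=> w; rewrite mulr_ge0 ?fabs_ge0 ?ppow_ge0.
  - by rewrite ltr_wpDl.
  - by apply: wker_le => //; [rewrite subrK].
  - apply: (@le_trans _ _ I%:E); last by rewrite lee_fin lerDl ltW.
    rewrite -IE le_eqVlt; apply/orP; left; apply/eqP; apply: eq_integral => w _; congr EFin.
    rewrite /schur_ker /wker /g powRM ?fabs_ge0 ?ppow_ge0//.
    have -> : ppow q (1 - sqn w) `^ p = ppow 1 (1 - sqn w).
      rewrite /ppow; case: ifP => _; first by rewrite -powRrM mulrC pq.
      by rewrite powR0// gt_eqF.
    rewrite -(ppowM (sigma - q) 1);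
        move: (ppow _ _) (ppow _ _) (_ `^ _) (_ `^ _) => a b c d; ring.
have T0 : (0 <= absT sigma l f z)%E.
  by apply: integral_ge0 => w _; rewrite lee_fin mulr_ge0 ?wker_ge0 ?fabs_ge0.
have Tfin : (absT sigma l f z < +oo)%E by apply: le_lt_trans (H 1 ltr01) _; exact: ltry.
split=> //.
have [t tE] : exists t, absT sigma l f z = t%:E.
  by exists (fine (absT sigma l f z)); rewrite fineK// ge0_fin_numE.
rewrite tE /= -EFinM lee_fin; rewrite tE lee_fin in T0.
have Ap0 : 0 < A z `^ (p - 1) by exact: powR_gt0.
apply/ler_addgt0Pl => e e0.
(* Scaled so that the margin contributes exactly [e] after the $p$-th power is taken. *)
have e'0 : 0 < e / A z `^ (p - 1) by exact: divr_gt0.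
have := H _ e'0; rewrite tE lee_fin => h.
have Ie : 0 <= I + e / A z `^ (p - 1) by rewrite addr_ge0// ltW.
have : t `^ p <= (A z `^ (1 - q) * (I + e / A z `^ (p - 1)) `^ q) `^ p.
  by rewrite ge0_ler_powR ?nnegrE ?(ltW p0)// mulr_ge0 ?powR_ge0.
move=> /le_trans; apply.
rewrite powRM ?powR_ge0// -!powRrM (_ : (1 - q) * p = p - 1); last by have := pq; lra.
rewrite (_ : q * p = 1); last by rewrite mulrC.
rewrite powRr1// mulrDr addrC lerD2r mulrCA divff ?mulr1//.
by rewrite gt_eqF.
Qed.

End schur.

(** * Schur's test: integration in the outer variable *)

Section bounded.
Context {R : realType}.
Local Notation normc := ComplexField.Normc.normc.
Variables (n : nat) (sigma l : R).
Hypotheses (sigma1 : -1 < sigma) (lE : 2 * l = n%:R + sigma + 1).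
Local Notation nv := (@normalized_volume R n).
Implicit Types (f : n.-tuple R[i] -> R[i]) (z w : n.-tuple R[i]).
Local Notation cs := (c_sigma n sigma).
Local Notation wker := (@wker R n l).
Local Notation opconst := (opconst sigma l).
Local Notation T := (@Tsigma R n sigma l).

Let cs0 : 0 < cs. Proof. exact: (c_sigma_gt0 n sigma1). Qed.

Lemma integrable_absT f z : measurable_fun unit_ball f ->
  (absT sigma l f z < +oo)%E ->
  nv.-integrable setT (EFin \o (fun w => wker sigma z w * fabs f w)).
Proof.
move=> mf fo; apply/integrableP; split.
  apply/measurable_EFinP; apply: measurable_funM; first exact: measurable_wker.
  exact: measurable_fabs.
apply: le_lt_trans fo; rewrite le_eqVlt; apply/orP; left; apply/eqP.
apply: eq_integral => w _.
by rewrite /= ger0_norm// mulr_ge0 ?wker_ge0 ?fabs_ge0.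
Qed.

Lemma Tsigma_integrable f z : measurable_fun unit_ball f ->
  (absT sigma l f z < +oo)%E -> integrableC (Tsigma_integrand sigma l f z).
Proof.
move=> mf fo; have ih := integrable_absT mf fo.
split; apply/integrable_mkcond; try exact: measurable_unit_ball.
- have -> : (fun w => (complex.Re (Tsigma_integrand sigma l f z w))%:E) \_ unit_ball =
      EFin \o bext (fun w => complex.Re (Tsigma_integrand sigma l f z w)).
    by rewrite -bextE -restrict_EFin.
  apply: le_integrable ih => //.
    apply/measurable_EFinP.
    rewrite (_ : bext _ = fun w => wker sigma z w * fRe f w); last first.
      by apply/funext => w; rewrite bext_Re_integrand.
    by apply: measurable_funM; [exact: measurable_wker|exact: measurable_fRe].
  move=> w _; rewrite /= bext_Re_integrand// lee_fin normrM [leRHS]normrM.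
  by rewrite (ger0_norm (fabs_ge0 _ _)) ler_wpM2l// norm_fRe_le.
- have -> : (fun w => (complex.Im (Tsigma_integrand sigma l f z w))%:E) \_ unit_ball =
      EFin \o bext (fun w => complex.Im (Tsigma_integrand sigma l f z w)).
    by rewrite -bextE -restrict_EFin.
  apply: le_integrable ih => //.
    apply/measurable_EFinP.
    rewrite (_ : bext _ = fun w => wker sigma z w * fIm f w); last first.
      by apply/funext => w; rewrite bext_Im_integrand.
    by apply: measurable_funM; [exact: measurable_wker|exact: measurable_fIm].
  move=> w _; rewrite /= bext_Im_integrand// lee_fin normrM [leRHS]normrM.
  by rewrite (ger0_norm (fabs_ge0 _ _)) ler_wpM2l// norm_fIm_le.
Qed.

Lemma TsigmaE f z : T f z =
  ((cs * \int[nv]_w (wker sigma z w * fRe f w)) +i*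
   (cs * \int[nv]_w (wker sigma z w * fIm f w)))%C.
Proof.
rewrite /Tsigma /integralC /Rintegral !integral_ball.
have -> : (\int[nv]_w (bext (fun w => complex.Re (Tsigma_integrand sigma l f z w)) w)%:E =
    \int[nv]_w (wker sigma z w * fRe f w)%:E)%E.
  by apply: eq_integral => w _; rewrite bext_Re_integrand.
have -> : (\int[nv]_w (bext (fun w => complex.Im (Tsigma_integrand sigma l f z w)) w)%:E =
    \int[nv]_w (wker sigma z w * fIm f w)%:E)%E.
  by apply: eq_integral => w _; rewrite bext_Im_integrand.
by apply/eqP; rewrite eq_complex /= !mul0r subr0 addr0 !eqxx.
Qed.

Lemma normc_Tsigma_le f z : measurable_fun unit_ball f ->
  (absT sigma l f z < +oo)%E -> normc (T f z) <= cs * fine (absT sigma l f z).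
Proof.
move=> mf fo; have ih := integrable_absT mf fo.
rewrite TsigmaE /=; move: (cs) cs0 => c c0.
rewrite !exprMn -mulrDr sqrtrM ?sqr_ge0// sqrtr_sqr (gtr0_norm c0).
rewrite ler_pM2l//.
set I := fine _; have I0 : 0 <= I.
  by apply: fine_ge0; apply: integral_ge0 => w _; rewrite lee_fin mulr_ge0 ?wker_ge0 ?fabs_ge0.
rewrite -[leRHS](ger0_norm I0) -sqrtr_sqr ler_wsqrtr//.
apply: sqr_Rintegral_le ih.
- by apply: measurable_funM; [exact: measurable_wker|exact: measurable_fRe].
- by apply: measurable_funM; [exact: measurable_wker|exact: measurable_fIm].
- move=> w; move: (wker sigma z w) => k.
  rewrite /fRe /fIm /fabs /bext; case: (sqn w < 1); last by rewrite mulr0 expr0n addr0.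
  case: (f w) => a b /=; rewrite !exprMn -mulrDr ler_wpM2l ?sqr_ge0//.
  by rewrite sqr_sqrtr// addr_ge0 ?sqr_ge0.
- by move=> w; rewrite mulr_ge0 ?wker_ge0 ?fabs_ge0.
Qed.

(** Integrability of [g] is not assumed: the positive and negative parts are integrated separately
    by Tonelli, and their difference is measurable in the extended reals before [fine] is
    applied. *)
Lemma measurable_Rintegral_wker (g : n.-tuple R[i] -> R) : measurable_fun setT g ->
  measurable_fun setT (fun z => cs * \int[nv]_w (wker sigma z w * g w)).
Proof.
move=> mg; apply: measurable_funM => //.
pose H x := (wker sigma x.1 x.2 * g x.2)%:E.
have mH : measurable_fun setT H.
  apply/measurable_EFinP; apply: measurable_funM; first exact: measurable_wker2.
  exact: (measurableT_comp mg measurable_snd).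
have mp : measurable_fun setT (fun z => \int[nv]_w (H^\+ (z, w)))%E.
  exact: (measurable_nv_integral (measurable_funepos mH)).
have mn : measurable_fun setT (fun z => \int[nv]_w (H^\- (z, w)))%E.
  exact: (measurable_nv_integral (measurable_funeneg mH)).
apply: (measurableT_comp (fine_measurable measurableT)).
rewrite (_ : (fun z => _) = fun z => \int[nv]_w (H^\+ (z, w)) - \int[nv]_w (H^\- (z, w)))%E.
  exact: emeasurable_funB.
apply/funext => z; rewrite [LHS]integralE.
by congr (_ - _)%E; apply: eq_integral => w _; rewrite ?funeposE ?funenegE.
Qed.

Lemma measurable_Tsigma f : measurable_fun unit_ball f -> measurable_fun setT (T f).
Proof.
move=> mf; rewrite (funext (TsigmaE f)); apply: measurable_fun_C => /=.
- exact: measurable_Rintegral_wker (measurable_fRe mf).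
- exact: measurable_Rintegral_wker (measurable_fIm mf).
Qed.

Variables p q : R.
Hypotheses (p1 : 1 <= p) (qE : q = p^-1) (sp : q - 1 < sigma).
Let p0 : 0 < p. Proof. exact: lt_le_trans p1. Qed.
Let q0 : 0 < q. Proof. by rewrite qE invr_gt0. Qed.
Let q1 : q <= 1. Proof. by rewrite qE invf_le1. Qed.
Let pq : p * q = 1. Proof. by rewrite qE mulfV ?gt_eqF. Qed.
Let sq : -1 < sigma - q. Proof. by have := sp; lra. Qed.
Local Notation C := (opconst (sigma - q) q).
Let C0 : 0 < C. Proof. exact: (opconst_gt0 sigma1 lE sq q0). Qed.

(** The power of $1-|z|^2$ is the one in $A(z)^{p-1}$, since $-q(p-1)=q-1$. *)
Let H f x : R := ppow (q - 1) (1 - sqn x.1) * schur_ker sigma l p q f x.1 x.2.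

Let H0 f x : 0 <= H f x.
Proof. by rewrite mulr_ge0 ?ppow_ge0 ?schur_ker_ge0. Qed.

Let mH f : measurable_fun unit_ball f -> measurable_fun setT (fun x => (H f x)%:E).
Proof.
move=> mf; apply/measurable_EFinP; apply: measurable_funM; last exact: measurable_schur_ker.
apply: (measurableT_comp (measurable_ppow (q - 1))); apply: measurable_funB => //.
exact: (measurableT_comp (@measurable_sqn R n) measurable_fst).
Qed.

Let pointwise f z : measurable_fun unit_ball f -> (lpint p f < +oo)%E ->
  ((fabs (T f) z `^ p)%:E <= (cs * C `^ (p - 1))%:E * \int[nv]_w (H f (z, w))%:E)%E.
Proof.
move=> mf fo.
have I0 : (0 <= \int[nv]_w (H f (z, w))%:E)%E.
  by apply: integral_ge0 => w _; rewrite lee_fin.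
have c0 : 0 <= cs * C `^ (p - 1) by rewrite mulr_ge0 ?powR_ge0// ltW.
rewrite {1}/fabs {1}/bext; case: ifPn => z1; last first.
  by rewrite powR0 ?gt_eqF// mule_ge0.
have [To Tle] := absT_le sigma1 lE p1 qE sp mf fo z1.
have h := normc_Tsigma_le mf To.
have t0 : 0 <= fine (absT sigma l f z).
  by apply: fine_ge0; apply: integral_ge0 => w _; rewrite lee_fin mulr_ge0 ?wker_ge0 ?fabs_ge0.
have n0 : 0 <= normc (T f z) by case: (T f z) => ? ?; exact: sqrtr_ge0.
have z10 : 0 < 1 - sqn z by rewrite subr_gt0.
have -> : (\int[nv]_w (H f (z, w))%:E =
    ((1 - sqn z) `^ (q - 1))%:E * \int[nv]_w (schur_ker sigma l p q f z w)%:E)%E.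
  rewrite -ge0_integralZl//.
  - by apply: eq_integral => w _; rewrite /H /= /ppow z10.
  - by apply/measurable_EFinP;
      exact: (measurable_fun_pair2 z (measurable_schur_ker sigma l p q mf)).
  - by move=> w _; rewrite lee_fin schur_ker_ge0.
  - by rewrite lee_fin powR_ge0.
apply: (@le_trans _ _ ((cs `^ p)%:E * (fine (absT sigma l f z) `^ p)%:E)%E).
  rewrite -EFinM lee_fin -powRM ?(ltW cs0)//.
  by rewrite ge0_ler_powR ?nnegrE ?(ltW p0)// mulr_ge0// ltW.
apply: le_trans (lee_wpmul2l _ Tle) _; first by rewrite lee_fin powR_ge0.
rewrite !muleA -!EFinM; apply: lee_wpmul2r.
  by apply: integral_ge0 => w _; rewrite lee_fin schur_ker_ge0.
rewrite lee_fin le_eqVlt; apply/orP; left; apply/eqP.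
have Cc0 : 0 <= C / cs by rewrite ltW// divr_gt0.
rewrite powRM ?powR_ge0// -powRrM (_ : - q * (p - 1) = q - 1); last by have := pq; lra.
rewrite mulrA; congr (_ * _).
rewrite powRM ?(ltW C0) ?invr_ge0 ?(ltW cs0)// -(powR_inv1 (ltW cs0)) -powRrM.
rewrite mulrCA mulrC -powRD; last by rewrite (gt_eqF cs0) implybT.
by rewrite (_ : p + -1 * (p - 1) = 1) ?powRr1 ?(ltW cs0)//; ring.
Qed.

(** The modulus $|1-\langle z,w\rangle|$ is symmetric, so [wker_le] applies with $a=q-1$ and
    $b=\sigma-q+1$. Its constant is again [C], and its power of $1-|w|^2$ cancels the weight. *)
Let fiber f w : measurable_fun unit_ball f ->
  (\int[nv]_z (H f (z, w))%:E <= (C / cs * fabs f w `^ p)%:E)%E.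
Proof.
move=> mf; have fp0 := powR_ge0 (fabs f w) p.
have C'0 : 0 <= ppow (sigma - q + 1) (1 - sqn w) * fabs f w `^ p by rewrite mulr_ge0 ?ppow_ge0.
have -> : (\int[nv]_z (H f (z, w))%:E =
    (ppow (sigma - q + 1) (1 - sqn w) * fabs f w `^ p)%:E * \int[nv]_z (wker (q - 1) w z)%:E)%E.
  have mw : measurable_fun setT (fun z => (wker (q - 1) w z)%:E).
    by apply/measurable_EFinP; exact: measurable_wker.
  have w0 z : setT z -> (0 <= (wker (q - 1) w z)%:E)%E by move=> _; rewrite lee_fin wker_ge0.
  rewrite -(ge0_integralZl nv measurableT mw w0); last by rewrite lee_fin.
  apply: eq_integral => z _; rewrite /H /schur_ker /wker /= (nsq_1dotC_sym z w) -EFinM.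
  by congr EFin; move: (ppow _ _) (ppow _ _) (_ `^ _) (_ `^ _) => a b c d; ring.
have [w1|w1] := ltP (sqn w) 1; last first.
  have -> : ppow (sigma - q + 1) (1 - sqn w) = 0.
    by rewrite /ppow ifF//; apply/negbTE; rewrite -leNgt subr_le0.
  have Cc0 : 0 <= C / cs by rewrite ltW// divr_gt0.
  by rewrite mul0r mul0e lee_fin mulr_ge0.
have b0 : 0 < sigma - q + 1 by have := sq; lra.
have ab : (q - 1) + (sigma - q + 1) = sigma by ring.
have a1 : -1 < q - 1 by have := q0; lra.
have := wker_le sigma1 lE b0 ab a1 w1 => hw.
apply: le_trans (lee_wpmul2l _ hw) _; first by rewrite lee_fin.
rewrite -EFinM lee_fin /ppow subr_gt0 w1 le_eqVlt; apply/orP; left; apply/eqP.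
have -> : opconst (q - 1) (sigma - q + 1) = C by rewrite /opconst subrK mulrAC.
have w10 : 0 < (1 - sqn w) `^ (sigma - q + 1) by apply: powR_gt0; rewrite subr_gt0.
rewrite powRN; move: ((1 - sqn w) `^ (sigma - q + 1)) w10 (fabs _ _ `^ _) (C / cs) => a a0 b c; field.
by rewrite gt_eqF.
Qed.

(** The inner bound contributes $c_\sigma C^{p-1}$ and the outer one $C/c_\sigma$; Tonelli's theorem
    joins them to $C^p$. *)
Lemma lpint_Tsigma_le f : measurable_fun unit_ball f -> (lpint p f < +oo)%E ->
  (lpint p (T f) <= (C `^ p)%:E * lpint p f)%E.
Proof.
move=> mf fo; have mHf := mH mf.
have mTf : measurable_fun unit_ball (T f).
  exact: measurable_funS measurableT (@subsetT _ _) (measurable_Tsigma mf).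
have c0 : 0 <= cs * C `^ (p - 1) by rewrite mulr_ge0 ?powR_ge0// ltW.
have HI : measurable_fun setT (fun z => \int[nv]_w (H f (z, w))%:E)%E.
  by apply: (measurable_nv_integral mHf) => x; rewrite lee_fin.
have HI2 : measurable_fun setT (fun w => \int[nv]_z (H f (z, w))%:E)%E.
  by apply: (measurable_nv_integral2 mHf) => x; rewrite lee_fin.
have pw z := pointwise z mf fo.
have kE : cs * C `^ (p - 1) * (C / cs) = C `^ p.
  rewrite mulrAC (mulrC cs) divfK ?(gt_eqF cs0)// mulrC.
  rewrite -{2}(powRr1 (ltW C0)) -powRD; last by rewrite (gt_eqF C0) implybT.
  by rewrite subrK.
move: (cs * _) c0 pw kE => k c0 pw kE.
apply: (@le_trans _ _ (k%:E * \int[nv]_z \int[nv]_w (H f (z, w))%:E)%E).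
  have I0 z : setT z -> (0 <= \int[nv]_w (H f (z, w))%:E)%E.
    by move=> _; apply: integral_ge0 => w _; rewrite lee_fin.
  rewrite -(ge0_integralZl nv measurableT HI I0); last by rewrite lee_fin.
  apply: ge0_le_integral => //.
  - by move=> z _; rewrite lee_fin powR_ge0.
  - apply/measurable_EFinP; exact: (measurableT_comp (measurable_powR p) (measurable_fabs mTf)).
  - exact: (emeasurable_funM (measurable_cst _) HI).
have HP x : (0 <= (H f x)%:E)%E by rewrite lee_fin.
rewrite (nv_tonelli mHf HP).
apply: (@le_trans _ _ (k%:E * ((C / cs)%:E * lpint p f))%E).
  apply: lee_wpmul2l; first by rewrite lee_fin.
  have mfp : measurable_fun setT (fun w => (fabs f w `^ p)%:E).
    by apply/measurable_EFinP;
        exact: (measurableT_comp (measurable_powR p) (measurable_fabs mf)).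
  have Cc0 : 0 <= C / cs by rewrite ltW// divr_gt0.
  rewrite /lpint -ge0_integralZl//; last by move=> w _; rewrite lee_fin powR_ge0.
  apply: ge0_le_integral => //.
  - by move=> w _; apply: integral_ge0 => z _; rewrite lee_fin.
  - exact: (emeasurable_funM (measurable_cst _) mfp).
  - by move=> w _; rewrite -EFinM; exact: fiber.
by rewrite muleA -EFinM kE.
Qed.

Lemma Tsigma_bounded f : Lp_ball p f -> [/\ Tsigma_defined sigma l f,
  Lp_ball p (T f) & (Lp_norm p (T f) <= C%:E * Lp_norm p f)%E].
Proof.
move=> /(Lp_ballE _ p0)[mf fo]; have h := lpint_Tsigma_le mf fo.
have Cp : (0 <= (C `^ p)%:E)%E by rewrite lee_fin powR_ge0.
split.
- move=> z z1; rewrite unit_ballE in z1.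
  by apply: Tsigma_integrable => //; have [] := absT_le sigma1 lE p1 qE sp mf fo z1.
- apply/(Lp_ballE _ p0); split.
    exact: measurable_funS measurableT (@subsetT _ _) (measurable_Tsigma mf).
  apply: le_lt_trans h _.
  by rewrite lte_mul_pinfty// ge0_fin_numE ?lpint_ge0.
rewrite !Lp_normE -qE.
have -> : (C%:E = ((C `^ p)%:E) `^ q)%E.
  by rewrite poweR_EFin -powRrM pq powRr1// ltW.
rewrite -poweRM ?lpint_ge0//.
apply: gt0_ler_poweR; rewrite ?in_itv /= ?leey ?andbT ?lpint_ge0 ?mule_ge0 ?lpint_ge0 //.
exact: ltW.
Qed.

End bounded.

(** * The lower bound *)

Lemma minkowski_le d (T : measurableType d) (R : realType)
    (mu : {measure set T -> \bar R}) (p a b : R) (h f g : T -> R) :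
  1 <= p -> 0 <= a -> 0 <= b ->
  measurable_fun setT h -> measurable_fun setT f -> measurable_fun setT g ->
  (forall x, 0 <= h x) -> (forall x, 0 <= f x) -> (forall x, 0 <= g x) ->
  (forall x, h x <= a * f x + b * g x) ->
  ((\int[mu]_x (h x `^ p)%:E) `^ p^-1 <=
   a%:E * (\int[mu]_x (f x `^ p)%:E) `^ p^-1 +
   b%:E * (\int[mu]_x (g x `^ p)%:E) `^ p^-1)%E.
Proof.
move=> p1 a0 b0 mh mf mg h0 f0 g0 hfg; have p0 : 0 < p by exact: lt_le_trans p1.
have NE (k : T -> R) : (forall x, 0 <= k x) ->
    ('N[mu]_p%:E[EFin \o k] = (\int[mu]_x (k x `^ p)%:E) `^ p^-1)%E.
  move=> k0; rewrite unlock; congr (_ `^ _)%E; apply: eq_integral => x _.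
  by rewrite /= ger0_norm.
have NZ (c : R) (k : T -> R) : 0 <= c -> (forall x, 0 <= k x) -> measurable_fun setT k ->
    ('N[mu]_p%:E[EFin \o (fun x => c * k x)%R] = c%:E * (\int[mu]_x (k x `^ p)%:E) `^ p^-1)%E.
  move=> c0 k0 mk; rewrite NE; last by move=> x; rewrite mulr_ge0.
  under eq_integral do rewrite powRM// EFinM.
  have mkp : measurable_fun setT (fun x => (k x `^ p)%:E).
    by apply/measurable_EFinP; exact: (measurableT_comp (measurable_powR p)).
  rewrite ge0_integralZl//; last first.
  - by rewrite lee_fin powR_ge0.
  - by move=> x _; rewrite lee_fin powR_ge0.
  rewrite poweRM ?lee_fin ?powR_ge0//; last first.
    by apply: integral_ge0 => x _; rewrite lee_fin powR_ge0.
  by rewrite poweR_EFin -powRrM mulfV ?gt_eqF// powRr1.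
have maf : measurable_fun setT (fun x => a * f x) by exact: measurable_funM.
have mbg : measurable_fun setT (fun x => b * g x) by exact: measurable_funM.
rewrite -NZ// -[X in (_ <= _ + X)%E]NZ//.
apply: le_trans (minkowski_EFin mu maf mbg p1).
have fg0 x : 0 <= a * f x + b * g x by rewrite addr_ge0 ?mulr_ge0.
rewrite NE//.
have I0 (k : T -> R) : (0 <= \int[mu]_x (k x `^ p)%:E)%E.
  by apply: integral_ge0 => x _; rewrite lee_fin powR_ge0.
have mkp (k : T -> R) : measurable_fun setT k -> measurable_fun setT (fun x => (k x `^ p)%:E).
  by move=> mk; apply/measurable_EFinP; exact: (measurableT_comp (measurable_powR p)).
apply: gt0_ler_poweR; rewrite ?in_itv /= ?leey ?andbT ?I0 ?invr_ge0 ?(ltW p0)//.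
apply: ge0_le_integral => //.
- by move=> x _; rewrite lee_fin powR_ge0.
- exact: mkp.
- by apply: mkp; exact: measurable_funD.
- by move=> x _; rewrite lee_fin ge0_ler_powR ?nnegrE ?(ltW p0)//.
Qed.

(** * Integrals of powers of $1-|w|^2$ over the ball *)

Section ball_mass.
Context {R : realType}.
Variable n : nat.
Hypothesis n_gt0 : (0 < n)%N.
Local Notation nv := (@normalized_volume R n).

Definition ball_mass (s : R) : R := Gamma (n%:R + 1) * Gamma s / Gamma (n%:R + s).

Lemma integral_ppow_ball (s : R) : 0 < s ->
  (\int[nv]_w (ppow (s - 1) (1 - sqn w))%:E = (ball_mass s)%:E)%E.
Proof.
move=> s0; have a1 : -1 < s - 1 by rewrite ltrBrDr addNr.
rewrite integral_nv; last 2 first.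
- apply/measurable_EFinP; apply: (measurableT_comp (measurable_ppow (s - 1))).
  by apply: measurable_funB => //; exact: measurable_sqn.
- by move=> w; rewrite lee_fin ppow_ge0.
have := moment 1 0 [tuple of nseq n (0 : R[i])] a1.
rewrite subrK fact0 !addr0 !mulr1 (addrC s n%:R).
rewrite {2}/ppow ltr01 powR1 mulr1 => h.
rewrite [X in (_ * X)%E](_ : _ = (disc_area ^+ n * Gamma s / Gamma (n%:R + s))%:E); last first.
  by rewrite -h; apply: eq_integral => w _; rewrite expr0 mulr1.
rewrite -EFinM /vol /ball_mass; congr EFin.
have n1 : 0 < n%:R + 1 :> R by rewrite ltr_wpDl.
have ns : 0 < n%:R + s :> R by rewrite ltr_wpDl.
have := lt0r_neq0 (Gamma_gt0 n1); have := lt0r_neq0 (Gamma_gt0 ns).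
have := lt0r_neq0 (@disc_area_gt0 R).
move: (Gamma _) (Gamma (n%:R + s)) (Gamma (n%:R + 1)) (disc_area) => A B C D D0 B0 C0; field.
by rewrite B0 C0 expf_neq0.
Qed.

(** By [Gamma_add_ge], $s\Gamma(s)=\Gamma(1+s)\ge2/((1+s)(2+s))$, which is at least $1/3$ for
    $s\le1$. *)
Lemma Gamma_ge_inv (s : R) : 0 < s -> s <= 1 -> (3 * s)^-1 <= Gamma s.
Proof.
move=> s0 s1; have := @Gamma_add_ge R 1 s ltr01 s0.
rewrite Gamma1 mul1r (addrC 1 s) GammaS// mul1r => h.
have s3 : 0 < 3 * s by rewrite mulr_gt0.
rewrite -(ler_pM2l s0); apply: le_trans h.
rewrite invfM mulrCA divff ?gt_eqF// mulr1 ler_pdivlMr; last by rewrite mulr_gt0//; lra.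
rewrite mulrC ler_pdivrMr//; nra.
Qed.

Lemma ball_mass_gt0 (s : R) : 0 < s -> 0 < ball_mass s.
Proof.
move=> s0; have n1 : 0 < n%:R + 1 :> R by rewrite ltr_wpDl.
have ns : 0 < n%:R + s :> R by rewrite ltr_wpDl.
by rewrite /ball_mass divr_gt0 ?mulr_gt0 ?Gamma_gt0.
Qed.

(** The pole of $\Gamma$ at 0 gives $1/s$, while $\Gamma(n+s)$ stays below $\Gamma(n)+\Gamma(n+1)$
    by log-convexity. *)
Lemma ball_mass_ge : exists2 k : R, 0 < k & forall s, 0 < s -> s < 1 -> k / s <= ball_mass s.
Proof.
have n0 : 0 < n%:R :> R by rewrite ltr0n.
have n1 : 0 < n%:R + 1 :> R by rewrite ltr_wpDl.
have G0 := Gamma_gt0 n0; have G1 := Gamma_gt0 n1.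
pose G : R := Gamma n%:R + Gamma (n%:R + 1); have Gp : 0 < G by exact: addr_gt0.
exists (Gamma (n%:R + 1) / (3 * G)) => [|s s0 s1].
  by rewrite divr_gt0// mulr_gt0.
have s'0 : 0 < 1 - s by rewrite subr_gt0.
have ns : 0 < n%:R + s :> R by rewrite ltr_wpDl// ltW.
have GsG : Gamma (n%:R + s) <= G.
  have := Gamma_log_convex n0 n1 s'0 s0 (subrK s 1).
  rewrite (_ : (1 - s) * n%:R + s * (n%:R + 1) = n%:R + s); last by ring.
  move/le_trans; apply; apply: le_trans (weighted_young (ltW G0) (ltW G1) s'0 s0 (subrK s 1)) _.
  by rewrite /G lerD// ler_piMl ?ltW//; lra.
have Gs := Gamma_ge_inv s0 (ltW s1).
have Gns := Gamma_gt0 ns.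
rewrite /ball_mass (_ : _ / s = Gamma (n%:R + 1) * (3 * s)^-1 / G); last first.
  by rewrite !invfM; ring.
apply: ler_pM => //.
- by rewrite mulr_ge0 ?(ltW G1)// invr_ge0 mulr_ge0// ltW.
- by rewrite invr_ge0 ltW.
- by rewrite ler_pM2l.
- by rewrite lef_pV2.
Qed.

(** For [s = p * e] this power normalizes the test function, and it multiplies the error term in the
    lower bound. *)
Lemma ball_mass_root_small (p d : R) : 0 < p -> 0 < d ->
  exists2 s0, 0 < s0 & forall s, 0 < s -> s <= s0 -> ball_mass s `^ (- p^-1) <= d.
Proof.
move=> p0 d0; have [k k0 Hk] := ball_mass_ge.
have dp : 0 < d `^ p by exact: powR_gt0.
exists (Num.min (2^-1) (k * d `^ p)) => [|s s0].
  by rewrite lt_min mulr_gt0// invr_gt0 ltr0n.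
rewrite le_min => /andP[s1 sk].
have s1' : s < 1 by apply: le_lt_trans s1 _; rewrite invf_lt1 ?ltr0n// ltr1n.
have m0 := ball_mass_gt0 s0.
have h : (d `^ p)^-1 <= ball_mass s.
  apply: le_trans (Hk s s0 s1').
  by rewrite -div1r ler_pdivrMr// mulrAC ler_pdivlMr// mul1r.
have -> : d = (d `^ p) `^ p^-1 by rewrite -powRrM mulfV ?gt_eqF// powRr1// ltW.
rewrite powRN -[leRHS]invrK lef_pV2 ?posrE ?invr_gt0 ?powR_gt0//.
rewrite -powRN -mulN1r powRrM powR_inv1 ?(ltW dp)//.
by apply: ge0_ler_powR; rewrite ?nnegrE ?invr_ge0 ?(ltW p0) ?(ltW dp) ?(ltW m0).
Qed.

End ball_mass.

(** The lower bound loses four factors [eta]: one in the ratio of Gamma values, one in the bounded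
    error, two in moving the exponent to $1/p$. *)
Lemma le_of_pow4 (R : realFieldType) (C M : R) : 0 < C ->
  (forall eta, 0 < eta -> eta < 1 -> eta ^+ 4 * C <= M) -> C <= M.
Proof.
move=> C0 H; rewrite leNgt; apply/negP => MC.
pose d := Num.min (2^-1) ((C - M) / (8 * C)).
have C8 : 0 < 8 * C by rewrite mulr_gt0.
have d0 : 0 < d by rewrite lt_min invr_gt0 ltr0n divr_gt0 ?subr_gt0.
have d2 : d <= 2^-1 by rewrite ge_min lexx.
have dC : d * (8 * C) <= C - M by rewrite -ler_pdivlMr// ge_min lexx orbT.
have h : (1 - d) ^+ 4 * C <= M by apply: H; lra.
have h4 : 1 - 4 * d <= (1 - d) ^+ 4.
  have -> : (1 - d) ^+ 4 = 1 - 4 * d + d ^+ 2 * ((2 - d) ^+ 2 + 2) by ring.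
  by rewrite lerDl mulr_ge0 ?sqr_ge0// addr_ge0 ?sqr_ge0.
have : (1 - 4 * d) * C <= M by apply: le_trans h; rewrite ler_pM2r.
by lra.
Qed.

(** * Test functions: sharpness, the endpoint, and divergence below it *)

Section test_functions.
Context {R : realType}.
Local Notation normc := ComplexField.Normc.normc.
Variables (n : nat) (sigma l p q : R).
Hypotheses (n_gt0 : (0 < n)%N) (sigma1 : -1 < sigma).
Hypotheses (lE : 2 * l = n%:R + sigma + 1) (p1 : 1 <= p) (qE : q = p^-1).
Local Notation nv := (@normalized_volume R n).
Local Notation cs := (c_sigma n sigma).
Local Notation wker := (@wker R n l).
Local Notation opconst := (opconst sigma l).
Local Notation T := (@Tsigma R n sigma l).
Implicit Types (z w : n.-tuple R[i]).

Let p0 : 0 < p. Proof. exact: lt_le_trans p1. Qed.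
Let q0 : 0 < q. Proof. by rewrite qE invr_gt0. Qed.
Let q1 : q <= 1. Proof. by rewrite qE invf_le1. Qed.
Let pq : p * q = 1. Proof. by rewrite qE mulfV ?gt_eqF. Qed.
Let cs0 : 0 < cs. Proof. exact: (c_sigma_gt0 n sigma1). Qed.
Let l0 : 0 < l.
Proof.
have n0 : 0 <= n%:R :> R by [].
by have := lE; have := sigma1; lra.
Qed.

Let sg0 : 0 < sigma + 1. Proof. by rewrite -ltrBlDr sub0r. Qed.
Let l2 : 0 < 2 * l. Proof. exact: mulr_gt0. Qed.

Definition ball_power (t b : R) (w : n.-tuple R[i]) : R[i] :=
  ((t * ppow (- b) (1 - sqn w))%:C)%C.

Let ppow_out b w : sqn w < 1 = false -> ppow b (1 - sqn w) = 0.
Proof. by rewrite /ppow subr_gt0 => ->. Qed.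

Lemma fRe_ball_power t b w : fRe (ball_power t b) w = t * ppow (- b) (1 - sqn w).
Proof.
by rewrite /fRe /bext; case: ifPn => // /negbTE h; rewrite ppow_out ?mulr0.
Qed.

Lemma fabs_ball_power t b w : 0 <= t ->
  fabs (ball_power t b) w = t * ppow (- b) (1 - sqn w).
Proof.
move=> t0; rewrite /fabs /bext; case: ifPn => [_|/negbTE h]; last first.
  by rewrite ppow_out ?mulr0.
by rewrite /= expr0n /= addr0 sqrtr_sqr ger0_norm// mulr_ge0 ?ppow_ge0.
Qed.

Lemma measurable_ball_power t b : measurable_fun setT (ball_power t b).
Proof.
apply: measurable_fun_C => //=; apply: measurable_funM => //.
apply: (measurableT_comp (measurable_ppow (- b))); apply: measurable_funB => //.
exact: measurable_sqn.
Qed.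

Lemma lpint_ball_power t e : 0 <= t -> 0 < e ->
  lpint p (ball_power t (q - e)) = (t `^ p * ball_mass n (p * e))%:E.
Proof.
move=> t0 e0; have pe : 0 < p * e by exact: mulr_gt0.
rewrite EFinM -integral_ppow_ball// -ge0_integralZl//.
- apply: eq_integral => w _; rewrite fabs_ball_power// powRM ?ppow_ge0// EFinM.
  congr (_ * _%:E)%E; rewrite /ppow; case: ifP => _; last by rewrite powR0// gt_eqF.
  by rewrite -powRrM; congr (_ `^ _); have := pq; lra.
- apply/measurable_EFinP; apply: (measurableT_comp (measurable_ppow (p * e - 1))).
  by apply: measurable_funB => //; exact: measurable_sqn.
- by move=> w _; rewrite lee_fin ppow_ge0.
- by rewrite lee_fin powR_ge0.
Qed.

Lemma Lp_ball_power t e : 0 <= t -> 0 < e -> Lp_ball p (ball_power t (q - e)).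
Proof.
move=> t0 e0; apply/(Lp_ballE _ p0); split; last by rewrite lpint_ball_power// ltry.
exact: measurable_funS measurableT (@subsetT _ _) (measurable_ball_power _ _).
Qed.

Definition unit_test e := ball_power (ball_mass n (p * e) `^ (- q)) (q - e).

Lemma Lp_norm_unit_test e : 0 < e -> Lp_norm p (unit_test e) = 1%E.
Proof.
move=> e0; have m0 : 0 < ball_mass n (p * e) by apply: ball_mass_gt0; exact: mulr_gt0.
rewrite Lp_normE lpint_ball_power ?powR_ge0//.
rewrite -powRrM (_ : - q * p = -1); last by have := pq; lra.
by rewrite powR_inv1 ?(ltW m0)// mulVf ?gt_eqF// poweR_EFin powR1.
Qed.

(** The test function lowers the weight exponent of the kernel from $\sigma$ to $\sigma-b$, so
    [wker_ge] with $a=\sigma-b$ applies; its error [K] becomes a multiple of the indicator of the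
    ball. *)
Lemma Tsigma_ball_power_ge t b eta K z : 0 <= t -> 0 < b -> b <= 1 -> -1 < sigma - b ->
  0 < eta -> (0 < K)%N ->
  (forall j, (K <= j)%N ->
    eta * (Gamma j%:R * Gamma (j%:R + 2 * l)) <= Gamma (l + j%:R) ^+ 2) ->
  eta * opconst (sigma - b) b * (fabs (ball_power t b) z - K%:R * t * bext (cst 1) z) <=
  fabs (T (ball_power t b)) z.
Proof.
move=> t0 b0 b1 a1 e0 K0 HK; rewrite fabs_ball_power//.
rewrite /fabs /bext; case: ifPn => [z1|/negbTE z1]; last first.
  by rewrite ppow_out// !mulr0 subr0 mulr0.
have ab : sigma - b + b = sigma by rewrite subrK.
have ge := wker_ge sigma1 lE b0 ab a1 z1 b1 e0 K0 HK.
have le := wker_le sigma1 lE b0 ab a1 z1.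
have I0 : (0 <= \int[nv]_w (wker (sigma - b) z w)%:E)%E.
  by apply: integral_ge0 => w _; rewrite lee_fin wker_ge0.
have [i iE] : exists i, (\int[nv]_w (wker (sigma - b) z w)%:E)%E = i%:E.
  exists (fine (\int[nv]_w (wker (sigma - b) z w)%:E)); rewrite fineK// ge0_fin_numE//.
  by apply: le_lt_trans le _; exact: ltry.
rewrite iE lee_fin in ge.
apply: (@le_trans _ _ (complex.Re (T (ball_power t b) z))); last first.
  case: (T _ z) => x y /=; apply: le_trans (ler_norm x) _.
  by rewrite -sqrtr_sqr ler_wsqrtr// lerDl sqr_ge0.
rewrite TsigmaE /= /Rintegral.
have -> : (\int[nv]_w (wker sigma z w * fRe (ball_power t b) w)%:E = (t * i)%:E)%E.
  rewrite EFinM -iE -ge0_integralZl//.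
  - apply: eq_integral => w _; rewrite fRe_ball_power -EFinM; congr EFin.
    by rewrite /wker -(ppowM sigma (- b)); move: (ppow _ _) (ppow _ _) (_ `^ _) => x y u; ring.
  - by apply/measurable_EFinP; exact: measurable_wker.
  - by move=> w _; rewrite lee_fin wker_ge0.
rewrite /ppow subr_gt0 z1 /=.
have h : t * (cs * (eta * (opconst (sigma - b) b / cs) * ((1 - sqn z) `^ (- b) - K%:R))) <=
    t * (cs * i) by rewrite ler_wpM2l// ler_pM2l.
rewrite (mulrCA cs); apply: le_trans h; rewrite le_eqVlt; apply/orP; left; apply/eqP.
move: (_ `^ _) (opconst _ _) (cs) (gt_eqF cs0) => x y c c0; field.
by rewrite c0.
Qed.

Lemma unit_test_lower e eta K M : 0 < e -> e < q -> q - 1 <= sigma ->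
  0 < eta -> (0 < K)%N ->
  (forall j, (K <= j)%N ->
    eta * (Gamma j%:R * Gamma (j%:R + 2 * l)) <= Gamma (l + j%:R) ^+ 2) ->
  (Lp_norm p (T (unit_test e)) <= M%:E)%E ->
  eta * opconst (sigma - (q - e)) (q - e) * (1 - K%:R * ball_mass n (p * e) `^ (- q)) <= M.
Proof.
move=> e0 eq' sq eta0 K0 HK hM.
have b0 : 0 < q - e by rewrite subr_gt0.
have b1 : q - e <= 1 by have := q1; lra.
have a1 : -1 < sigma - (q - e) by lra.
have o0 := opconst_gt0 sigma1 lE a1 b0.
set t := ball_mass n (p * e) `^ (- q).
have t0 : 0 <= t by exact: powR_ge0.
have ge z := Tsigma_ball_power_ge z t0 b0 b1 a1 eta0 K0 HK.
move: (opconst _ _) o0 ge => y y0 ge.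
have ey : 0 < eta * y by exact: mulr_gt0.
have mf := @measurable_ball_power t (q - e).
have mfb : measurable_fun unit_ball (ball_power t (q - e)).
  exact: measurable_funS measurableT (@subsetT _ _) mf.
have mTf : measurable_fun unit_ball (T (ball_power t (q - e))).
  exact: measurable_funS measurableT (@subsetT _ _) (measurable_Tsigma sigma l mfb).
have Kt0 : 0 <= K%:R * t by rewrite mulr_ge0.
have ey' : 0 <= (eta * y)^-1 by rewrite invr_ge0 ltW.
have m1 : measurable_fun setT (@bext R n (cst 1)).
  by apply/measurable_bext; exact: measurable_cst.
have b10 w : 0 <= bext (cst 1) w :> R by rewrite /bext; case: ifP.
have pw z : fabs (ball_power t (q - e)) z <=
    (eta * y)^-1 * fabs (T (ball_power t (q - e))) z + K%:R * t * bext (cst 1) z.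
  by rewrite -lerBlDr -(ler_pM2l ey) mulVKf ?gt_eqF//; exact: ge.
have := minkowski_le nv p1 ey' Kt0 (measurable_fabs mfb) (measurable_fabs mTf) m1
  (fabs_ge0 _) (fabs_ge0 _) b10 pw.
have -> : (\int[nv]_x (bext (cst 1) x `^ p)%:E = 1)%E.
  rewrite -[RHS](@nv_setT_ball R n); apply: eq_integral => w _; rewrite /bext.
  by case: ifP => _; rewrite ?powR1// powR0// gt_eqF.
rewrite poweR1r mule1 => hm.
have N1 : Lp_norm p (ball_power t (q - e)) = 1%E := Lp_norm_unit_test e0.
have h : (1 <= ((eta * y)^-1)%:E * Lp_norm p (T (ball_power t (q - e))) + (K%:R * t)%:E)%E.
  by rewrite -N1 (Lp_normE p (ball_power _ _)) (Lp_normE p (T _)); exact: hm.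
have : (1%:E <= ((eta * y)^-1 * M + K%:R * t)%:E)%E.
  apply: (le_trans h); rewrite EFinD leeD2r//.
  by rewrite EFinM; apply: (lee_wpmul2l _ hM); rewrite lee_fin.
by rewrite lee_fin -lerBlDr ler_pdivlMl.
Qed.

Let opconst_lower e : 0 < e -> e < q -> 0 < sigma - q + 1 ->
  opconst (sigma - q) q * ((sigma - q + 1) * (sigma - q + 1 + 1) /
     ((sigma - q + 1 + e) * (sigma - q + 1 + 1 + e))) <= opconst (sigma - (q - e)) (q - e).
Proof.
move=> e0 eq' X0.
rewrite /opconst (_ : sigma - (q - e) + 1 = sigma - q + 1 + e); last by ring.
have h1 := Gamma_add_ge X0 e0.
have h2 := Gamma_sub_ge e0 eq' q1.
have k0 : 0 < Gamma (2 * l) / (Gamma l ^+ 2 * Gamma (sigma + 1)).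
  by rewrite divr_gt0 ?mulr_gt0 ?exprn_gt0 ?Gamma_gt0.
have GX := Gamma_gt0 X0; have Gq := Gamma_gt0 q0.
move: (_ / (_ * Gamma (sigma + 1))) k0 => k k0.
move: (Gamma (sigma - q + 1)) GX h1 => G G0 h1.
move: (Gamma (sigma - q + 1 + e)) h1 => G' h1.
move: (Gamma q) Gq h2 => H H0 h2; move: (Gamma (q - e)) h2 => H' h2.
set r := _ / (_ * _) in h1 *.
have r0 : 0 < r.
  by rewrite /r divr_gt0 ?mulr_gt0//; lra.
have -> : k * G * H * r = k * (G * r * H) by ring.
rewrite -(mulrA k G' H') ler_pM2l//; apply: ler_pM => //; last exact: ltW.
by rewrite mulr_ge0 ?(ltW G0) ?(ltW r0).
Qed.

Lemma Tsigma_norm_ge M : q - 1 < sigma ->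
  (forall f, Lp_ball p f -> Lp_norm p f = 1%E -> (Lp_norm p (T f) <= M%:E)%E) ->
  opconst (sigma - q) q <= M.
Proof.
move=> sq HM; have sq' : -1 < sigma - q by lra.
have C0 := opconst_gt0 sigma1 lE sq' q0.
apply: le_of_pow4 => // eta eta0 eta1.
have [K K0 HK] := Gamma_ratio_cvg l0 eta0 eta1.
have K0' : 0 < K%:R :> R by rewrite ltr0n.
have d0 : 0 < (1 - eta) / K%:R by rewrite divr_gt0// subr_gt0.
have [s0 s00 Hs] := ball_mass_root_small n_gt0 p0 d0.
have X0 : 0 < sigma - q + 1 by lra.
(* The first bound keeps the rational factor of [opconst_lower] above $\eta^2$, the second makes the
   normalized error at most $1-\eta$, the third keeps [e] below [q]. *)
pose e := Num.min ((sigma - q + 1) * (1 - eta)) (Num.min (s0 / p) (q / 2)).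
have e0 : 0 < e by rewrite !lt_min mulr_gt0 ?subr_gt0// !divr_gt0.
have eX : e <= (sigma - q + 1) * (1 - eta) by rewrite ge_min lexx.
have es : p * e <= s0 by rewrite mulrC -ler_pdivlMr// !ge_min lexx !orbT.
have eq2 : e <= q / 2 by rewrite !ge_min lexx !orbT.
have eq' : e < q by have := q0; lra.
have := Hs _ (mulr_gt0 p0 e0) es; rewrite -qE => tle.
have low := unit_test_lower e0 eq' (ltW sq) eta0 K0 HK
  (HM _ (Lp_ball_power (powR_ge0 _ _) e0) (Lp_norm_unit_test e0)).
apply: le_trans low.
have := opconst_lower e0 eq' X0.
move: (opconst _ _) C0 => C C0; move: (opconst _ _) => C'.
move: (ball_mass _ _ `^ _) tle => t tle.
have Kt : eta <= 1 - K%:R * t.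
  by rewrite lerBrDr -lerBrDl mulrC -ler_pdivlMr.
move: (sigma - q + 1) X0 eX => X X0 eX hC.
have ee : eta * e <= e by rewrite ler_piMl ?(ltW e0) ?(ltW eta1).
have h1 : eta * (X + e) <= X by lra.
have h2 : eta * (X + 1 + e) <= X + 1 by lra.
have r2 : eta ^+ 2 <= X * (X + 1) / ((X + e) * (X + 1 + e)).
  rewrite ler_pdivlMr; last by rewrite mulr_gt0//; lra.
  by rewrite expr2 mulrACA ler_pM// mulr_ge0 ?(ltW eta0)//; lra.
have hC' : C * eta ^+ 2 <= C' by apply: le_trans hC; rewrite ler_pM2l.
rewrite (_ : eta ^+ 4 * C = eta * (C * eta ^+ 2) * eta); last by ring.
have Ce : 0 <= C * eta ^+ 2 by rewrite mulr_ge0 ?sqr_ge0// ltW.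
apply: ler_pM => //; [by rewrite mulr_ge0// ltW|exact: ltW|].
by rewrite ler_pM2l.
Qed.

(** Here the constant for the exponent $q-e$ contains $\Gamma(\sigma-(q-e)+1)=\Gamma(e)\ge1/(3e)$,
    while the other factors stay bounded below. *)
Lemma Tsigma_endpoint M : sigma = q - 1 ->
  ~ (forall f, Lp_ball p f -> Lp_norm p f = 1%E -> (Lp_norm p (T f) <= M%:E)%E).
Proof.
move=> sq HM; have eta0 : 0 < 2^-1 :> R by rewrite invr_gt0.
have eta1 : 2^-1 < 1 :> R by rewrite invf_lt1 ?ltr0n// ltr1n.
have [K K0 HK] := Gamma_ratio_cvg l0 eta0 eta1.
have K0' : 0 < K%:R :> R by rewrite ltr0n.
have d0 : 0 < 2^-1 / K%:R :> R by rewrite divr_gt0.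
have [s0 s00 Hs] := ball_mass_root_small n_gt0 p0 d0.
pose k := Gamma (2 * l) / (Gamma l ^+ 2 * Gamma (sigma + 1)).
have k0 : 0 < k by rewrite divr_gt0 ?mulr_gt0 ?exprn_gt0 ?Gamma_gt0.
have opE a b : opconst a b = k * Gamma (a + 1) * Gamma b by [].
clearbody k; have Gq := Gamma_gt0 q0.
have M1 : 0 < 12 * (`|M| + 1) by rewrite mulr_gt0// ltr_wpDl.
have kG : 0 < k * Gamma q / (12 * (`|M| + 1)) by exact: (divr_gt0 (mulr_gt0 k0 Gq) M1).
(* In 12, a factor 3 comes from [Gamma_ge_inv] and a factor 2 each from $\eta=1/2$ and from the
   error term; this [e] makes $k\Gamma(q)/(12e)$ exceed $|M|$. *)
pose e := Num.min (k * Gamma q / (12 * (`|M| + 1)) / 2) (Num.min (s0 / p) (q / 2)).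
have e0 : 0 < e by rewrite !lt_min (divr_gt0 kG) ?(divr_gt0 s00) ?(divr_gt0 q0).
have ek : e <= k * Gamma q / (12 * (`|M| + 1)) / 2 by rewrite ge_min lexx.
have es : p * e <= s0 by rewrite mulrC -ler_pdivlMr// !ge_min lexx !orbT.
have eq2 : e <= q / 2 by rewrite !ge_min lexx !orbT.
clearbody e; have eq' : e < q by have := q0; lra.
have e1 : e <= 1 by have := q1; lra.
have := Hs _ (mulr_gt0 p0 e0) es; rewrite -qE => tle.
have sq' : q - 1 <= sigma by rewrite sq.
have := unit_test_lower e0 eq' sq' eta0 K0 HK
  (HM _ (Lp_ball_power (powR_ge0 _ _) e0) (Lp_norm_unit_test e0)).
have -> : opconst (sigma - (q - e)) (q - e) = k * Gamma e * Gamma (q - e).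
  by rewrite opE (_ : sigma - (q - e) + 1 = e)// sq; ring.
have h2 := Gamma_sub_ge e0 eq' q1.
have h3 := Gamma_ge_inv e0 e1.
move: (ball_mass _ _ `^ _) tle => t tle.
have Kt : 2^-1 <= 1 - K%:R * t.
  rewrite lerBrDr -lerBrDl (_ : 1 - 2^-1 = 2^-1); last by field.
  by rewrite mulrC -ler_pdivlMr.
have G'0 : 0 < Gamma (q - e) by apply: Gamma_gt0; rewrite subr_gt0.
have Ge0 := Gamma_gt0 e0.
have big : k * (3 * e)^-1 * Gamma q <= k * Gamma e * Gamma (q - e).
  have e3 : 0 <= (3 * e)^-1 by rewrite invr_ge0 mulr_ge0 ?(ltW e0).
  apply: (ler_pM _ (ltW Gq) _ h2); first exact: (mulr_ge0 (ltW k0) e3).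
  by rewrite (ler_pM2l k0).
move: (k * Gamma e * Gamma (q - e)) big => P big le.
move: (Gamma q) Gq kG ek big => G G0 kG ek big.
have kE : k * G / (12 * e) <= `|M|.
  apply: le_trans (ler_norm M); apply: le_trans le.
  rewrite (_ : k * G / (12 * e) = 2^-1 * (k * (3 * e)^-1 * G) * 2^-1); last first.
    by field; rewrite gt_eqF.
  have P0 : 0 <= k * (3 * e)^-1 * G.
    by rewrite !mulr_ge0 ?(ltW k0) ?(ltW G0)// invr_ge0 mulr_ge0 ?(ltW e0).
  by apply: ler_pM => //; [exact: (mulr_ge0 (ltW eta0) P0)|rewrite ler_pM2l].
move: kE; rewrite ler_pdivrMr ?mulr_gt0// => kE.
have : e * (12 * (`|M| + 1)) <= k * G / 2.
  by rewrite -ler_pdivlMr// mulrAC.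
have -> : e * (12 * (`|M| + 1)) = `|M| * (12 * e) + 12 * e by ring.
have kG0 : 0 < k * G by exact: mulr_gt0.
have e12 : `|M| * (12 * e) < `|M| * (12 * e) + 12 * e by rewrite ltrDl mulr_gt0.
move/(lt_le_trans (le_lt_trans kE e12)).
by rewrite ltNge (ler_piMr (ltW kG0) (ltW eta1)).
Qed.

(** At $z=0$ the kernel is 1 and the integrand becomes $(1-|w|^2)^{-1}$. A finite integral would
    bound [ball_mass s], hence [k / s], for every [s] in $(0,1)$. *)
Lemma Tsigma_undefined : sigma < q - 1 ->
  ~ (forall f, Lp_ball p f -> Tsigma_defined (n := n) sigma l f).
Proof.
move=> sq HD; have [k k0 Hk] := @ball_mass_ge R n n_gt0.
have e0 : 0 < q - 1 - sigma by rewrite subr_gt0.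
have qe : q - (q - 1 - sigma) = 1 + sigma by ring.
have f0 := Lp_ball_power ler01 e0; rewrite qe in f0.
pose z0 := [tuple of nseq n (0 : R[i])].
have d0 w : dotC z0 w = 0.
  rewrite /dotC big1// => i _.
  by rewrite tnth_nseq mul0r.
have z01 : unit_ball z0 by rewrite unit_ballE /sqn d0.
have [/integrable_mkcond iRe _] := HD _ f0 z0 z01.
have := iRe (@measurable_unit_ball R n).
have -> : (fun w => (complex.Re (Tsigma_integrand sigma l (ball_power 1 (1 + sigma)) z0 w))%:E)
    \_ unit_ball = EFin \o (fun w => ppow (-1) (1 - sqn w)).
  rewrite -[LHS]/((EFin \o (fun w => complex.Re (Tsigma_integrand sigma l (ball_power 1 (1 + sigma)) z0 w))) \_ unit_ball).
  rewrite restrict_EFin bextE; apply/funext => w; rewrite /comp bext_Re_integrand.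
  rewrite fRe_ball_power mul1r /wker d0 subr0 /nsq /= expr1n expr0n addr0 powR1 mulr1 ppowM.
  by congr (ppow _ _)%:E; ring.
case/integrableP => _ ifin.
pose I := fine (\int[nv]_w (ppow (-1) (1 - sqn w))%:E)%E.
have IE : (\int[nv]_w (ppow (-1) (1 - sqn w))%:E = I%:E)%E.
  rewrite fineK// ge0_fin_numE.
    apply: le_lt_trans ifin; rewrite le_eqVlt; apply/orP; left; apply/eqP.
    by apply: eq_integral => w _; rewrite /= ger0_norm ?ppow_ge0.
  by apply: integral_ge0 => w _; rewrite lee_fin ppow_ge0.
have H s : 0 < s -> s < 1 -> k / s <= I.
  move=> s0 sl1; apply: le_trans (Hk s s0 sl1) _.
  rewrite -lee_fin -IE -integral_ppow_ball//.
  have mp c : measurable_fun setT (fun w : n.-tuple R[i] => (ppow c (1 - sqn w))%:E).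
    apply/measurable_EFinP; apply: (measurableT_comp (measurable_ppow c)).
    by apply: measurable_funB => //; exact: measurable_sqn.
  apply: ge0_le_integral => //; try by move=> w _; rewrite lee_fin ppow_ge0.
  move=> w _; rewrite lee_fin addrC -(ppowM (-1)) -[leRHS]mulr1 ler_wpM2l ?ppow_ge0//.
  by apply: ppow_le1; [exact: ltW|rewrite gerBl sqn_ge0].
have I0 : 0 <= I.
  have h2 : 0 < 2^-1 :> R by rewrite invr_gt0.
  apply: le_trans (H (2^-1) h2 _); first by rewrite divr_ge0 ?(ltW k0) ?(ltW h2).
  by rewrite invf_lt1 ?ltr0n// ltr1n.
pose s := Num.min (2^-1) (k / (2 * (I + 1))).
have I1 : 0 < 2 * (I + 1) by rewrite mulr_gt0// ltr_wpDl.
have s0 : 0 < s by rewrite lt_min invr_gt0 ltr0n divr_gt0.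
have sl1 : s < 1.
  have h : s <= 2^-1 by rewrite ge_min lexx.
  by apply: le_lt_trans h _; rewrite invf_lt1 ?ltr0n// ltr1n.
have sk : s * (2 * (I + 1)) <= k by rewrite -ler_pdivlMr// ge_min lexx orbT.
have := H s s0 sl1; rewrite ler_pdivrMr// => kI.
have Is : 0 <= I * s by rewrite mulr_ge0// ltW.
lra.
Qed.

End test_functions.

Theorem theorem2p2 (R : realType) (n : nat) (p sigma lambda : R)
    (n_gt0 : (0 < n)%N) (p_ge1 : 1 <= p) (sigma_gtN1 : -1 < sigma)
    (lambdaE : lambda = (n%:R + sigma + 1) / 2) :
  ((forall f, Lp_ball (n := n) p f -> Tsigma_defined sigma lambda f) /\
     bounded_on_Lp (n := n) p (Tsigma sigma lambda)
   <-> 1 / p - 1 < sigma)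
  /\
  (1 / p - 1 < sigma ->
     opnorm_Lp (n := n) p (Tsigma sigma lambda) =
       (Gamma (2 * lambda) / (Gamma lambda ^+ 2 * Gamma (sigma + 1))
        * Gamma (1 / p) * Gamma (sigma + 1 - 1 / p))%:E
     /\
     Gamma (2 * lambda) / (Gamma lambda ^+ 2 * Gamma (sigma + 1))
        * Gamma (1 / p) * Gamma (sigma + 1 - 1 / p)
     = Gamma (n%:R + sigma + 1)
        / (Gamma ((n%:R + sigma + 1) / 2) ^+ 2 * Gamma (sigma + 1))
        * Gamma (1 / p) * Gamma (sigma + 1 - 1 / p)).
Proof.
have lE : 2 * lambda = n%:R + sigma + 1 by rewrite lambdaE mulrC divfK.
rewrite !div1r; have [q qE] : {q | q = p^-1} by exists p^-1.
rewrite -!qE.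
have CE : Gamma (2 * lambda) / (Gamma lambda ^+ 2 * Gamma (sigma + 1)) * Gamma q *
    Gamma (sigma + 1 - q) = opconst sigma lambda (sigma - q) q.
  by rewrite /opconst mulrAC (addrAC sigma).
rewrite CE.
split; first split.
- move=> [def [_ [M HM]]]; rewrite ltNge; apply/negP => sq.
  (* At the endpoint the norm bound is contradicted; below it, the convergence of the defining
     integral. *)
  move: sq; rewrite le_eqVlt => /orP[/eqP sq|sq].
    apply: (Tsigma_endpoint (M := M) n_gt0 sigma_gtN1 lE p_ge1 qE sq) => f Lf Nf.
    by have := HM f Lf; rewrite Nf mule1.
  exact: (Tsigma_undefined n_gt0 p_ge1 qE sq def).
- move=> sq; have bd f := Tsigma_bounded sigma_gtN1 lE p_ge1 qE sq (f := f).
  split; first by move=> f /bd[].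
  split; first by move=> f /bd[].
  by exists (opconst sigma lambda (sigma - q) q) => f /bd[].
- move=> sq; split; last by rewrite -CE lE lambdaE.
  apply/eqP; rewrite eq_le; apply/andP; split.
    apply: ge_ereal_sup => _ [f [Lf Nf] <-].
    have [_ _ h] := Tsigma_bounded sigma_gtN1 lE p_ge1 qE sq Lf.
    apply: le_trans h _; rewrite -[leRHS]mule1; apply: lee_wpmul2l => //.
    rewrite lee_fin ltW//; apply: (opconst_gt0 sigma_gtN1 lE); first by lra.
    by rewrite qE invr_gt0 (lt_le_trans ltr01).
  (* [Tsigma_norm_ge] compares with real bounds only, so the supremum is then split into cases; the
     value $-\infty$ is excluded by taking [M] below the constant. *)
  have ub (M : R) : (opnorm_Lp (n := n) p (Tsigma sigma lambda) <= M%:E)%E ->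
      opconst sigma lambda (sigma - q) q <= M.
    move=> h; apply: (Tsigma_norm_ge n_gt0 sigma_gtN1 lE p_ge1 qE sq) => f Lf Nf.
    by apply: le_trans h; apply: ereal_sup_ubound; exists f => //; split=> //; rewrite Nf.
  case: (opnorm_Lp _ _) ub => [r| |] ub.
  + by rewrite lee_fin ub.
  + exact: leey.
  + have := ub (opconst sigma lambda (sigma - q) q - 1) (leNye _).
    by rewrite lerBrDl gerDr ler10.
Qed.
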